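(* Let $\Lambda=K\Gamma/I$ be a string algebra and let $$\mathcal T=\{\mathrm{St}(p^{-1}q)\in\mathcal P^{<\infty}(\Lambda\text{-mod})\mid \mathrm{St}(p^{-1}q)\text{ embeds in }J\},$$ where $p,q$ (possibly trivial) are paths such that $p^{-1}q$ is a word. Then $$\mathrm{l\,fin\,dim}\,\Lambda=\mathrm{l\,Fin\,dim}\,\Lambda=t+1,$$ where $t=\sup\{\mathrm{p\,dim}\,M\mid M\in\mathcal T\}$ in case $\mathcal T$ is nonempty, and $t=-1$ otherwise.
   Context: **Setting.** $K$ is an algebraically closed field and $\Lambda=K\Gamma/I$ is a finite dimensional string algebra: $\Gamma$ is a finite quiver, $I\subseteq K\Gamma$ is an admissible ideal which can be generated by paths, at most two arrows enter and at most two arrows leave any vertex of $\Gamma$, and for any arrow $\alpha$ there is at most one arrow $\beta$ with $\alpha\beta\notin I$ and at most one arrow $\gamma$ with $\gamma\alpha\notin I$. The product $pq$ of paths means ''$p$ after $q$''. Vertices of $\Gamma$ are identified with primitive idempotents of $\Lambda$. $J$ is the Jacobson radical of $\Lambda$; all modules are left modules, and $\mathrm{p\,dim}$ is projective dimension. $\mathcal P^{<\infty}(\Lambda\text{-mod})$ and $\mathcal P^{<\infty}(\Lambda\text{-Mod})$ are the categories of finite dimensional, resp. arbitrary, left $\Lambda$-modules of finite projective dimension. The left little and big finitistic dimensions are $\mathrm{l\,fin\,dim}\,\Lambda=\sup\{\mathrm{p\,dim}\,M\mid M\in\mathcal P^{<\infty}(\Lambda\text{-mod})\}$ and $\mathrm{l\,Fin\,dim}\,\Lambda=\sup\{\mathrm{p\,dim}\,M\mid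 M\in\mathcal P^{<\infty}(\Lambda\text{-Mod})\}$. **Cyclic string modules.** For paths $p,q$ in $K\Gamma\setminus I$ (possibly trivial, i.e. of length $0$), $p^{-1}q$ is a word if $p$ and $q$ have the same starting vertex $e$ and, in case both are nontrivial, distinct first arrows. If $p=q=e$ are trivial, $\mathrm{St}(p^{-1}q)=\Lambda e/Je$. Otherwise $\mathrm{St}(p^{-1}q)=\Lambda e/(C_{\rm left}+C_{\rm right})$, where $C_{\rm left}=\Lambda\alpha p$ if there is a (necessarily unique) arrow $\alpha$ such that $(\alpha p)^{-1}q$ is again a word, $C_{\rm left}=0$ if there is no such arrow, and symmetrically $C_{\rm right}=\Lambda\beta q$ if there is a (necessarily unique) arrow $\beta$ such that $p^{-1}(\beta q)$ is again a word, $C_{\rm right}=0$ if there is none. *)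

(* Defs.v *)
From HB Require Import structures.
From mathcomp Require Import all_boot all_order all_algebra.
From mathcomp Require Import generic_quotient ring_quotient.
From mathcomp Require Import finmap.
From mathcomp.multinomials Require Import monalg.
From mathcomp Require Import boolp classical_sets constructive_ereal.

Set Implicit Arguments.
Unset Strict Implicit.
Unset Printing Implicit Defensive.

Import Order.TTheory GRing.Theory Num.Theory.
Local Open Scope ring_scope.
Local Open Scope quotient_scope.

Record quiver := Quiver {
  vertex : finType;
  arrow : finType;
  src : arrow -> vertex;
  tgt : arrow -> vertex }.

Fixpoint is_walk (G : quiver) (v : vertex G) (s : seq (arrow G)) : bool :=
  if s is a :: s' then (src a == v) && is_walk (tgt a) s' else true.

(** A path is its starting vertex together with the list of its arrows in the
    order in which they are traversed, so that the head of the list is the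
    rightmost factor in the product notation "p q = p after q". *)
Record qpath (G : quiver) := QPath {
  path_val : vertex G * seq (arrow G);
  path_valP : is_walk path_val.1 path_val.2 }.

HB.instance Definition _ (G : quiver) := [isSub for @path_val G].
HB.instance Definition _ (G : quiver) := [Choice of qpath G by <:].

Section Paths.
Variable G : quiver.
Implicit Types (p q r : qpath G) (a b : arrow G) (v : vertex G).

Definition path_src p : vertex G := (path_val p).1.
Definition path_arrows p : seq (arrow G) := (path_val p).2.
Definition path_tgt p : vertex G :=
  last (path_src p) (map (@tgt G) (path_arrows p)).
Definition path_trivial p : bool := nilp (path_arrows p).

Definition vertex_path v : qpath G := @QPath G (v, [::]) isT.

Lemma arrow_pathP a : is_walk (src a) [:: a].
Proof. by rewrite /= eqxx. Qed.
Definition arrow_path a : qpath G := @QPath G (src a, [:: a]) (arrow_pathP a).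

Lemma is_walk_cat v s1 s2 :
  @is_walk G v (s1 ++ s2) =
  is_walk v s1 && is_walk (last v (map (@tgt G) s1)) s2.
Proof. by elim: s1 v => //= a s1 IH v; rewrite IH andbA. Qed.

(** [path_mul p q] is the concatenation "p after q", [None] if p does not start
    where q ends. *)
Definition path_mul p q : option (qpath G) :=
  if path_src p == path_tgt q
  then insub (path_src q, path_arrows q ++ path_arrows p) else None.

Lemma path_ext p q : path_src p = path_src q ->
  path_arrows p = path_arrows q -> p = q.
Proof.
case: p q => [[v s] P] [[w t] Q]; rewrite /path_src /path_arrows /= => E1 E2.
by apply/val_inj => /=; rewrite E1 E2.
Qed.

Variant path_mul_spec p q : option (qpath G) -> Prop :=
| PathMulSome r of path_src p = path_tgt q & path_src r = path_src q
    & path_arrows r = path_arrows q ++ path_arrows p & path_tgt r = path_tgt p :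
    path_mul_spec p q (Some r)
| PathMulNone of path_src p != path_tgt q : path_mul_spec p q None.

Lemma path_mulP p q : path_mul_spec p q (path_mul p q).
Proof.
rewrite /path_mul; case: eqVneq => [E|]; last by constructor.
have W : is_walk (path_src q) (path_arrows q ++ path_arrows p).
  rewrite is_walk_cat; apply/andP; split; first exact: (path_valP q).
  by rewrite -/(path_tgt q) -E; exact: (path_valP p).
rewrite (@insubT _ _ (qpath G) (path_src q, path_arrows q ++ path_arrows p) W).
constructor => //.
by rewrite /path_tgt /= /path_src /path_arrows /= map_cat last_cat
           -/(path_tgt q) -E.
Qed.

Lemma path_mulA p q r :
  obind (path_mul p) (path_mul q r) = obind (path_mul^~ r) (path_mul p q).
Proof.
case: (path_mulP q r) => [qr Eqr sqr aqr tqr|Nqr] /=;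
  case: (path_mulP p q) => [pq Epq spq apq tpq|Npq] //=.
- case: (path_mulP p qr) => [x E1 s1 a1 t1|]; last by rewrite tqr Epq eqxx.
  case: (path_mulP pq r) => [y E2 s2 a2 t2|]; last by rewrite spq Eqr eqxx.
  congr Some; apply: path_ext; first by rewrite s1 s2 sqr.
  by rewrite a1 a2 aqr apq catA.
- by case: (path_mulP p qr) => // x; rewrite tqr => /eqP; rewrite (negbTE Npq).
- by case: (path_mulP pq r) => // x; rewrite spq => /eqP; rewrite (negbTE Nqr).
Qed.

Lemma path_mul1p v p :
  path_mul (vertex_path v) p = if v == path_tgt p then Some p else None.
Proof.
case: path_mulP => [r E s a t|]; last by rewrite /path_src /= => /negbTE ->.
rewrite {1}/path_src /= in E; rewrite E eqxx; congr Some.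
by apply: path_ext; rewrite // a cats0.
Qed.

Lemma path_mulp1 v p :
  path_mul p (vertex_path v) = if v == path_src p then Some p else None.
Proof.
case: path_mulP => [r E s a t|]; last first.
  by rewrite /path_tgt /= eq_sym => /negbTE ->.
rewrite {1}/path_tgt /= /path_src /= in E; rewrite /path_src E eqxx; congr Some.
by apply: path_ext; rewrite ?s ?a // E.
Qed.

End Paths.

Definition pathalg (K : fieldType) (G : quiver) : Type := {malg K[qpath G]}.

HB.instance Definition _ K G := GRing.Lmodule.on (pathalg K G).

Section PathAlgebra.
Variables (K : fieldType) (G : quiver).
Implicit Types (f g h : pathalg K G) (p q r : qpath G) (c : K).

Definition path_term c (o : option (qpath G)) : pathalg K G :=
  if o is Some p then << c *g p >> else 0.

Definition pathalg_mul f g : pathalg K G :=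
  \sum_(p <- msupp f) \sum_(q <- msupp g)
    path_term (mcoeff p f * mcoeff q g) (path_mul p q).

Definition pathalg_one : pathalg K G := \sum_(v : vertex G) << vertex_path v >>.

Let path_term0 o : path_term 0 o = 0.
Proof. by case: o => //= p; rewrite monalgU0. Qed.

Let path_termD c d o : path_term (c + d) o = path_term c o + path_term d o.
Proof. by case: o => [p|] /=; rewrite ?monalgUD ?addr0. Qed.

Let mulw (d1 d2 : {fset qpath G}) f g :
  (msupp f `<=` d1)%fset -> (msupp g `<=` d2)%fset ->
  pathalg_mul f g = \sum_(p <- d1) \sum_(q <- d2)
    path_term (mcoeff p f * mcoeff q g) (path_mul p q).
Proof.
move=> le1 le2; rewrite /pathalg_mul (big_fset_incl _ le1) /=; last first.
  move=> p _ /mcoeff_outdom fp; rewrite big1 // => q _.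
  by rewrite fp mul0r path_term0.
apply: eq_bigr => p _; apply: big_fset_incl => // q _ /mcoeff_outdom ->.
by rewrite mulr0 path_term0.
Qed.

Let mulDl : left_distributive pathalg_mul +%R.
Proof.
move=> f g h.
rewrite (mulw (msuppD_le f g) (fsubset_refl _)).
rewrite (mulw (fsubsetUl (msupp f) (msupp g)) (fsubset_refl (msupp h))).
rewrite (mulw (fsubsetUr (msupp f) (msupp g)) (fsubset_refl (msupp h))).
rewrite -big_split; apply: eq_bigr => p _ /=.
rewrite -big_split; apply: eq_bigr => q _ /=.
by rewrite mcoeffD mulrDl path_termD.
Qed.

Let mulDr : right_distributive pathalg_mul +%R.
Proof.
move=> h f g.
rewrite (mulw (fsubset_refl _) (msuppD_le f g)).
rewrite (mulw (fsubset_refl (msupp h)) (fsubsetUl (msupp f) (msupp g))).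
rewrite (mulw (fsubset_refl (msupp h)) (fsubsetUr (msupp f) (msupp g))).
rewrite -big_split; apply: eq_bigr => p _ /=.
rewrite -big_split; apply: eq_bigr => q _ /=.
by rewrite mcoeffD mulrDr path_termD.
Qed.

Let mul0g f : pathalg_mul 0 f = 0.
Proof. by rewrite /pathalg_mul msupp0 big_seq_fset0. Qed.

Let mulg0 f : pathalg_mul f 0 = 0.
Proof. by rewrite /pathalg_mul big1 // => p _; rewrite msupp0 big_seq_fset0. Qed.

Let mulUU c d p q :
  pathalg_mul << c *g p >> << d *g q >> = path_term (c * d) (path_mul p q).
Proof. by rewrite (mulw msuppU_le msuppU_le) !big_seq_fset1 !mcoeffUU. Qed.

Let mul_suml (I : Type) (s : seq I) (F : I -> pathalg K G) g :
  pathalg_mul (\sum_(i <- s) F i) g = \sum_(i <- s) pathalg_mul (F i) g.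
Proof. exact: (big_morph (pathalg_mul^~ g) (fun x y => mulDl x y g) (mul0g g)). Qed.

Let mul_sumr (I : Type) (s : seq I) (F : I -> pathalg K G) g :
  pathalg_mul g (\sum_(i <- s) F i) = \sum_(i <- s) pathalg_mul g (F i).
Proof. exact: (big_morph (pathalg_mul g) (mulDr g) (mulg0 g)). Qed.

Let mulTU c d o q :
  pathalg_mul (path_term c o) << d *g q >>
  = path_term (c * d) (obind (fun p => path_mul p q) o).
Proof. by case: o => [p|] /=; rewrite ?mul0g ?mulUU. Qed.

Let mulUT c d o p :
  pathalg_mul << c *g p >> (path_term d o)
  = path_term (c * d) (obind (path_mul p) o).
Proof. by case: o => [q|] /=; rewrite ?mulg0 ?mulUU. Qed.

Let mulA : associative pathalg_mul.
Proof.
have mulAr g h f : (forall c p, pathalg_mul << c *g p >> (pathalg_mul g h)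
    = pathalg_mul (pathalg_mul << c *g p >> g) h) ->
  pathalg_mul f (pathalg_mul g h) = pathalg_mul (pathalg_mul f g) h.
  move=> E; pose F p : pathalg K G := << mcoeff p f *g p >>.
  rewrite [f]monalgE (mul_suml _ F g) (mul_suml _ F).
  rewrite (mul_suml _ (fun p => pathalg_mul (F p) g)).
  by apply: eq_bigr => p _; apply: E.
have mulAm f h g : (forall c p, pathalg_mul f (pathalg_mul << c *g p >> h)
    = pathalg_mul (pathalg_mul f << c *g p >>) h) ->
  pathalg_mul f (pathalg_mul g h) = pathalg_mul (pathalg_mul f g) h.
  move=> E; pose F p : pathalg K G := << mcoeff p g *g p >>.
  rewrite [g]monalgE (mul_suml _ F h) (mul_sumr _ F).
  rewrite (mul_suml _ (fun p => pathalg_mul f (F p))).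
  rewrite (mul_sumr _ (fun p => pathalg_mul (F p) h)).
  by apply: eq_bigr => p _; apply: E.
have mulAl f g h : (forall c p, pathalg_mul f (pathalg_mul g << c *g p >>)
    = pathalg_mul (pathalg_mul f g) << c *g p >>) ->
  pathalg_mul f (pathalg_mul g h) = pathalg_mul (pathalg_mul f g) h.
  move=> E; pose F p : pathalg K G := << mcoeff p h *g p >>.
  rewrite [h]monalgE (mul_sumr _ F g) (mul_sumr _ F).
  rewrite (mul_sumr _ (fun p => pathalg_mul g (F p))).
  by apply: eq_bigr => p _; apply: E.
move=> f g h; apply: mulAr => c p; apply: mulAm => d q; apply: mulAl => e r.
by rewrite !mulUU mulUT mulTU path_mulA mulrA.
Qed.

Let mul1g : left_id pathalg_one pathalg_mul.
Proof.
move=> f; rewrite {2}[f]monalgE {1}[f]monalgE mul_sumr.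
apply: eq_bigr => p _; rewrite /pathalg_one mul_suml (bigD1 (path_tgt p)) //=.
rewrite mulUU path_mul1p eqxx /= mul1r big1 ?addr0 // => v /negbTE ne.
by rewrite mulUU path_mul1p ne.
Qed.

Let mulg1 : right_id pathalg_one pathalg_mul.
Proof.
move=> f; rewrite {2}[f]monalgE {1}[f]monalgE mul_suml.
apply: eq_bigr => p _; rewrite /pathalg_one mul_sumr (bigD1 (path_src p)) //=.
rewrite mulUU path_mulp1 eqxx /= mulr1 big1 ?addr0 // => v /negbTE ne.
by rewrite mulUU path_mulp1 ne.
Qed.

HB.instance Definition _ := GRing.Zmodule_isPzRing.Build (pathalg K G)
  mulA mul1g mulg1 mulDl mulDr.

Definition of_path p : pathalg K G := << p >>.
Definition of_arrow a : pathalg K G := of_path (arrow_path a).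

End PathAlgebra.

HB.mixin Record isTwoSided (R : pzRingType) (S : R -> bool) := {
  two_sided_subproof :
    forall a x : R, S x -> S (a * x) /\ S (x * a) }.

#[short(type="tsideal")]
HB.structure Definition TwoSidedIdeal (R : pzRingType) :=
  {S of GRing.ZmodClosed R S & isTwoSided R S}.

Section IdealOps.
Variable R : pzRingType.

Definition ideal_gen (S : set R) : set R :=
  [set x | forall I : tsideal R, (forall s, S s -> s \in I) -> x \in I].

Definition ideal_pow (F : set R) (n : nat) : set R :=
  ideal_gen [set y | exists x : 'I_n -> R,
                       (forall i, F (x i)) /\ y = \prod_(i < n) x i].

Variable I : tsideal R.

Definition quotring : Type := Quotient.quot I.
HB.instance Definition _ := EqQuotient.on quotring.
HB.instance Definition _ := Choice.on quotring.
HB.instance Definition _ := GRing.Zmodule.on quotring.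

Definition quotring_one : quotring := \pi_quotring (1 : R).
Definition quotring_mul (x y : quotring) : quotring :=
  \pi_quotring (repr x * repr y).

Let eqmodP (x y : R) : reflect (\pi_quotring x = \pi_quotring y) (x - y \in I).
Proof. by rewrite Quotient.idealrBE; apply: eqP. Qed.

Let pi_mul (x y : R) :
  quotring_mul (\pi_quotring x) (\pi_quotring y) = \pi_quotring (x * y).
Proof.
apply/eqmodP; set x' := repr _; set y' := repr _.
have hx : x' - x \in I by apply/eqmodP; rewrite reprK.
have hy : y' - y \in I by apply/eqmodP; rewrite reprK.
have -> : x' * y' - x * y = (x' - x) * y' + x * (y' - y).
  by rewrite mulrBl mulrBr addrA subrK.
by rewrite rpredD //; [case: (two_sided_subproof (s:=I) y' _ hx)
                      |case: (two_sided_subproof (s:=I) x _ hy)].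
Qed.

Let pi_add (x y : R) : \pi_quotring x + \pi_quotring y = \pi_quotring (x + y).
Proof. by rewrite piE. Qed.

Let mulA : associative quotring_mul.
Proof.
elim/quotW=> x; elim/quotW=> y; elim/quotW=> z.
by rewrite (pi_mul y z) (pi_mul x y) (pi_mul x) (pi_mul _ z) mulrA.
Qed.
Let mul1q : left_id quotring_one quotring_mul.
Proof. by elim/quotW=> x; rewrite (pi_mul 1 x) mul1r. Qed.
Let mulq1 : right_id quotring_one quotring_mul.
Proof. by elim/quotW=> x; rewrite (pi_mul x 1) mulr1. Qed.
Let mulDl : left_distributive quotring_mul +%R.
Proof.
elim/quotW=> x; elim/quotW=> y; elim/quotW=> z.
by rewrite pi_add (pi_mul _ z) (pi_mul x z) (pi_mul y z) pi_add mulrDl.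
Qed.
Let mulDr : right_distributive quotring_mul +%R.
Proof.
elim/quotW=> x; elim/quotW=> y; elim/quotW=> z.
by rewrite pi_add (pi_mul x) (pi_mul x y) (pi_mul x z) pi_add mulrDr.
Qed.

HB.instance Definition _ := GRing.Zmodule_isPzRing.Build quotring
  mulA mul1q mulq1 mulDl mulDr.

End IdealOps.

Section Submodules.
Variables (R : pzRingType) (M : lmodType R).

Record submodule (U : submodClosed M) := Submodule {
  submodule_val : M;
  submodule_valP : submodule_val \in U }.

HB.instance Definition _ U := [isSub for @submodule_val U].
HB.instance Definition _ U := [Choice of submodule U by <:].
HB.instance Definition _ U := [SubChoice_isSubLmodule of submodule U by <:].

(** Over a ring, closure under opposites follows from closure under scaling,
    but the library has no such inference for a variable [submodClosed]. *)
Definition as_zmodClosed (U : submodClosed M) : M -> bool := fun x => x \in U.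
Fact as_zmodClosed_closed U : zmod_closed (as_zmodClosed U).
Proof. exact: GRing.submod_closedB (submodClosedP U). Qed.
HB.instance Definition _ U :=
  GRing.isZmodClosed.Build M (as_zmodClosed U) (as_zmodClosed_closed U).

Definition quotmod (U : submodClosed M) : Type :=
  @Quotient.quot M (GRing.ZmodClosed.clone M (as_zmodClosed U) _).
HB.instance Definition _ U := EqQuotient.on (quotmod U).
HB.instance Definition _ U := Choice.on (quotmod U).
HB.instance Definition _ U := GRing.Zmodule.on (quotmod U).

Section QuotMod.
Variable U : submodClosed M.

Definition quotmod_scale (a : R) (x : quotmod U) : quotmod U :=
  \pi_(quotmod U) (a *: repr x).

Let eqmodP (x y : M) :
  reflect (\pi_(quotmod U) x = \pi_(quotmod U) y) (x - y \in U).
Proof.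
by rewrite -[_ \in U]/(_ \in as_zmodClosed U) Quotient.idealrBE; apply: eqP.
Qed.

Let pi_scale a (x : M) :
  quotmod_scale a (\pi_(quotmod U) x) = \pi_(quotmod U) (a *: x).
Proof.
apply/eqmodP; rewrite -scalerBr rpredZ //.
by apply/eqmodP; rewrite reprK.
Qed.

Let pi_add (x y : M) :
  \pi_(quotmod U) x + \pi_(quotmod U) y = \pi_(quotmod U) (x + y).
Proof. by rewrite piE. Qed.

Let scaleA a b x : quotmod_scale a (quotmod_scale b x) = quotmod_scale (a * b) x.
Proof.
by elim/quotW: x => x; rewrite (pi_scale b x) !pi_scale scalerA.
Qed.
Let scale1 : left_id 1 quotmod_scale.
Proof. by elim/quotW=> x; rewrite pi_scale scale1r. Qed.
Let scaleDr : right_distributive quotmod_scale +%R.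
Proof.
move=> a; elim/quotW=> x; elim/quotW=> y.
by rewrite pi_add !pi_scale pi_add scalerDr.
Qed.
Let scaleDl x : {morph quotmod_scale^~ x : a b / a + b}.
Proof.
by elim/quotW: x => x a b; rewrite !pi_scale pi_add scalerDl.
Qed.

HB.instance Definition _ := GRing.Zmodule_isLmodule.Build R (quotmod U)
  scaleA scale1 scaleDr scaleDl.

End QuotMod.

Definition addsub_pred (U W : submodClosed M) : M -> bool :=
  fun x => `[< exists u w, [/\ u \in U, w \in W & x = u + w] >].

Fact addsub_closed U W : subsemimod_closed (addsub_pred U W).
Proof.
split; last first.
  move=> a x /asboolP[u [w [Uu Ww ->]]]; apply/asboolP.
  by exists (a *: u), (a *: w); rewrite !rpredZ // scalerDr.
split; first by apply/asboolP; exists 0, 0; rewrite !rpred0 addr0.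
move=> x y /asboolP[u [w [Uu Ww ->]]] /asboolP[u' [w' [Uu' Ww' ->]]].
by apply/asboolP; exists (u + u'), (w + w'); rewrite !rpredD // addrACA.
Qed.
HB.instance Definition _ U W :=
  GRing.isSubmodClosed.Build R M (addsub_pred U W) (addsub_closed U W).
Definition addsub U W : submodClosed M :=
  GRing.SubmodClosed.clone R M (addsub_pred U W) _.

Definition in_submodule_pred (U W : submodClosed M) : submodule U -> bool :=
  fun x => submodule_val x \in W.

Fact in_submodule_closed U W : subsemimod_closed (@in_submodule_pred U W).
Proof.
split; last by move=> a x Wx; rewrite unfold_in /in_submodule_pred /= rpredZ.
split; first by rewrite unfold_in /in_submodule_pred /= rpred0.
by move=> x y Wx Wy; rewrite unfold_in /in_submodule_pred /= rpredD.
Qed.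
HB.instance Definition _ U W :=
  GRing.isSubmodClosed.Build R (submodule U) (@in_submodule_pred U W)
    (in_submodule_closed U W).
Definition in_submodule U W : submodClosed (submodule U) :=
  GRing.SubmodClosed.clone R (submodule U) (@in_submodule_pred U W) _.

End Submodules.

(** U / W when W is contained in U (in general, U modulo its intersection
    with W) *)
Definition subquot (R : pzRingType) (M : lmodType R) (U W : submodClosed M) :
  lmodType R := quotmod (in_submodule U W).

Section LeftIdeals.
Variable R : pzRingType.

Definition principal_pred (x : R) : R^o -> bool :=
  fun y => `[< exists a : R, y = a * x >].

Fact principal_closed x : subsemimod_closed (principal_pred x).
Proof.
split; last first.
  by move=> b y /asboolP[a ->]; apply/asboolP; exists (b * a); rewrite -mulrA.
split; first by apply/asboolP; exists 0; rewrite mul0r.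
move=> y z /asboolP[a ->] /asboolP[b ->]; apply/asboolP.
by exists (a + b); rewrite mulrDl.
Qed.
HB.instance Definition _ x :=
  GRing.isSubmodClosed.Build R R^o (principal_pred x) (principal_closed x).
Definition principal x : submodClosed R^o :=
  GRing.SubmodClosed.clone R R^o (principal_pred x) _.

Definition maximal_left_ideal (U : submodClosed R^o) : Prop :=
  (exists x, x \notin U) /\
  forall W : submodClosed R^o, {subset U <= W} ->
    {subset W <= U} \/ (forall x, x \in W).

Definition jacobson_pred : R^o -> bool :=
  fun x => `[< forall U : submodClosed R^o, maximal_left_ideal U -> x \in U >].

Fact jacobson_closed : subsemimod_closed jacobson_pred.
Proof.
split; last by move=> a x /asboolP Jx; apply/asboolP=> U /Jx; apply: rpredZ.
split; first by apply/asboolP=> U _; apply: rpred0.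
move=> x y /asboolP Jx /asboolP Jy; apply/asboolP=> U mU.
by rewrite rpredD ?Jx ?Jy.
Qed.
HB.instance Definition _ :=
  GRing.isSubmodClosed.Build R R^o jacobson_pred jacobson_closed.
Definition jacobson : submodClosed R^o :=
  GRing.SubmodClosed.clone R R^o jacobson_pred _.

Definition jacobson_mul_pred (e : R) : R^o -> bool :=
  fun y => `[< exists2 x : R, x \in jacobson & y = x * e >].

Fact jacobson_mul_closed e : subsemimod_closed (jacobson_mul_pred e).
Proof.
split; last first.
  move=> a y /asboolP[x Jx ->]; apply/asboolP; exists (a * x); last first.
    by rewrite -mulrA.
  exact: (@rpredZ _ _ jacobson a x Jx).
split.
  by apply/asboolP; exists 0; rewrite ?mul0r //; exact: (rpred0 jacobson).
move=> y z /asboolP[a Ja ->] /asboolP[b Jb ->]; apply/asboolP.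
by exists (a + b); rewrite ?mulrDl //; exact: (@rpredD _ jacobson).
Qed.
HB.instance Definition _ e :=
  GRing.isSubmodClosed.Build R R^o (jacobson_mul_pred e) (jacobson_mul_closed e).
Definition jacobson_mul e : submodClosed R^o :=
  GRing.SubmodClosed.clone R R^o (jacobson_mul_pred e) _.

End LeftIdeals.

Section Homological.
Variable R : pzRingType.

Definition projective (P : lmodType R) : Prop :=
  forall (M N : lmodType R) (g : {linear M -> N}) (f : {linear P -> N}),
    (forall y, exists x, g x = y) ->
    exists h : {linear P -> M}, forall x, g (h x) = f x.

(** There is an exact sequence 0 -> P_n -> ... -> P_0 -> M -> 0 with all P_i
    projective (continued by P_i = 0 for i > n). *)
Definition has_proj_resolution (M : lmodType R) (n : nat) : Prop :=
  exists (P : nat -> lmodType R) (d : forall i, {linear P i.+1 -> P i})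
         (eps : {linear P 0%N -> M}),
    [/\ forall i, projective (P i),
        forall m, exists x, eps x = m,
        forall x, eps x = 0 <-> exists y, d 0%N y = x,
        forall i x, d i x = 0 <-> exists y, d i.+1 y = x
      & forall i (x : P i), (n < i)%N -> x = 0].

(** The least length of a projective resolution, [+oo] if there is no finite one;
    the zero module has projective dimension 0. *)
Definition pdim (M : lmodType R) : \bar int :=
  infimum +oo%E [set (n%:Z)%:E | n in has_proj_resolution M].

Definition embeds (M N : lmodType R) : Prop :=
  exists f : {linear M -> N}, injective f.

End Homological.

Section StringAlgebra.
Variables (K : fieldType) (G : quiver).

Definition arrow_ideal : set (pathalg K G) :=
  ideal_gen [set of_arrow K a | a in [set: arrow G]].

Definition admissible (I : tsideal (pathalg K G)) : Prop :=
  exists N : nat, [/\ (2 <= N)%N,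
    forall x, ideal_pow arrow_ideal N x -> x \in I
  & forall x, x \in I -> ideal_pow arrow_ideal 2 x].

Definition generated_by_paths (I : tsideal (pathalg K G)) : Prop :=
  exists S : set (qpath G),
    forall x, x \in I <-> ideal_gen [set of_path K p | p in S] x.

Definition string_presentation (I : tsideal (pathalg K G)) : Prop :=
  [/\ admissible I,
      generated_by_paths I,
      forall v : vertex G, (#|[pred a : arrow G | tgt a == v]| <= 2)%N
                        /\ (#|[pred a : arrow G | src a == v]| <= 2)%N,
      forall a b b' : arrow G,
        of_arrow K a * of_arrow K b \notin I ->
        of_arrow K a * of_arrow K b' \notin I -> b = b'
    & forall a c c' : arrow G,
        of_arrow K c * of_arrow K a \notin I ->
        of_arrow K c' * of_arrow K a \notin I -> c = c'].

Variable I : tsideal (pathalg K G).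

Definition Lambda : pzRingType := quotring I.

Definition cls (x : pathalg K G) : Lambda := \pi_(quotring I) x.

Definition scal (c : K) : Lambda := cls (c *: (1 : pathalg K G)).

(** Finite dimensionality over K, which acts on modules through [scal]. *)
Definition fin_dimensional (M : lmodType Lambda) : Prop :=
  exists (n : nat) (b : 'I_n -> M),
    forall m : M, exists c : 'I_n -> K, m = \sum_(i < n) scal (c i) *: b i.

Definition pdims (C : lmodType Lambda -> Prop) : set (\bar int) :=
  [set x | exists2 M : lmodType Lambda, C M & x = pdim M].

Definition Pfin_little (M : lmodType Lambda) : Prop :=
  fin_dimensional M /\ (pdim M < +oo)%E.
Definition Pfin_big (M : lmodType Lambda) : Prop := (pdim M < +oo)%E.

(** The default -oo is irrelevant: the zero module belongs to both classes. *)
Definition little_findim : \bar int := supremum -oo%E (pdims Pfin_little).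
Definition big_findim : \bar int := supremum -oo%E (pdims Pfin_big).

(** [word p q] stands for "p^{-1} q is a word"; the heads of the two lists are
    the first arrows of p and q. *)
Definition word (p q : qpath G) : bool :=
  [&& of_path K p \notin I, of_path K q \notin I, path_src p == path_src q
    & match path_arrows p, path_arrows q with
      | a :: _, b :: _ => a != b
      | _, _ => true
      end].

Definition extends_left (p q : qpath G) (a : arrow G) : bool :=
  if path_mul (arrow_path a) p is Some ap then word ap q else false.
Definition extends_right (p q : qpath G) (b : arrow G) : bool :=
  if path_mul (arrow_path b) q is Some bq then word p bq else false.

(** In a string algebra at most one arrow qualifies in each of the two [pick]s;
    [principal 0] is the zero ideal. *)
Definition C_left (p q : qpath G) : submodClosed Lambda^o :=
  if [pick a | extends_left p q a] is Some a
  then principal (cls (of_arrow K a * of_path K p)) else principal (0 : Lambda).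
Definition C_right (p q : qpath G) : submodClosed Lambda^o :=
  if [pick b | extends_right p q b] is Some b
  then principal (cls (of_arrow K b * of_path K q)) else principal (0 : Lambda).

Definition St (p q : qpath G) : lmodType Lambda :=
  let e : Lambda := cls (of_path K (vertex_path (path_src p))) in
  if path_trivial p && path_trivial q
  then subquot (principal e) (jacobson_mul e)
  else subquot (principal e) (addsub (C_left p q) (C_right p q)).

Definition string_T (M : lmodType Lambda) : Prop :=
  exists p q : qpath G, [/\ word p q, M = St p q, Pfin_little M
    & embeds M (submodule (jacobson Lambda))].

(** [supremum x A] is x when A is empty. *)
Definition string_t : \bar int := supremum (-1)%:E (pdims string_T).

End StringAlgebra.

(* Main.v *)
Require Import Defs.
From HB Require Import structures.
From mathcomp Require Import all_boot all_order all_algebra.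
From mathcomp Require Import finmap.
From mathcomp.multinomials Require Import monalg.
From mathcomp Require Import boolp classical_sets constructive_ereal.

Set Implicit Arguments.
Unset Strict Implicit.
Unset Printing Implicit Defensive.

Import GRing.Theory.
Local Open Scope ring_scope.
Local Open Scope quotient_scope.

(** Let X be the kernel of a projective cover P -> M.  It lies in J P, and P is a
    direct sum of modules Lambda e, so the images of X under distinct arrows are
    independent.  Choosing at each vertex a basis adapted to the two chains of
    kernels of the paths beginning with either of the two outgoing arrows makes X
    a direct sum of one-peak string modules St(p^-1 q); hence p dim M is at most
    1 + sup p dim St(p^-1 q), over the strings embedding in J P.

    Such a string need not embed in J.  If u and v in J are paths whose nonzero
    left multiples are the initial segments of p and of q, then u + v generates a
    copy of St(p^-1 q) in J unless v = r u, in which case p = q r.  Then either r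
    can play the part of v, or q is replaced by the longest q' with q' r <> 0.
    This does not change the projective dimension: if beta follows q in q', then
    there is an exact sequence 0 -> Lambda (beta p) -> St(p^-1 q') -> St(p^-1 q) -> 0,
    and Lambda (beta p) is a direct summand of the syzygies of both strings.

    Conversely, a nonzero submodule S of J e is not a direct summand of Lambda e, so
    Lambda e / S has projective dimension p dim S + 1. *)

(** * Modules and projective dimension *)

Section Submodules.
Variable R : pzRingType.

(** Strings are handled through annihilators: a generator has type (p, q) when its annihilator is
    that of the generator of [St p q]. Modules with generators of one type are isomorphic, and a
    type can be recognised inside any module. Since M may have infinite dimension, Zorn's lemma
    supplies the bases and direct sums are infinite; the summands are nevertheless cyclic, which is
    why the big dimension does not exceed the little one. The obstacle to an adapted basis is that
    it must respect the two chains in X itself while being a basis only modulo JX. It is removed by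
    the string condition: an arrow into a vertex is killed by at least one of two arrows leaving it,
    so an error term in JX splits into two parts, each harmless to one chain. The replacement of a
    string may have to be repeated. It stops because an enlargement lengthens p or q, whose lengths
    are bounded, and between enlargements the total length of u and v drops. Nonprojectivity always
    has the same source: an annihilator contained in the radical contains no nonzero idempotent. *)

Definition mklin (M N : lmodType R) (f : M -> N) (h : linear f) :
  {linear M -> N} := HB.pack f (GRing.isLinear.Build R M N *:%R f h).

Lemma mklinE (M N : lmodType R) (f : M -> N) (h : linear f) x : mklin h x = f x.
Proof. by []. Qed.

Definition submod_prop (M : lmodType R) (P : M -> Prop) : Prop :=
  P 0 /\ forall a x y, P x -> P y -> P (a *: x + y).

Definition psub_pred (M : lmodType R) (P : M -> Prop) (h : submod_prop P) :
  M -> bool := fun x => `[< P x >].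

Fact psub_closed (M : lmodType R) (P : M -> Prop) (h : submod_prop P) :
  subsemimod_closed (psub_pred h).
Proof.
case: (h) => h0 hD; split; last first.
  move=> a x /asboolP Px; apply/asboolP.
  by have := hD a x 0 Px h0; rewrite addr0.
split; first exact/asboolP.
move=> x y /asboolP Px /asboolP Py; apply/asboolP.
by have := hD 1 x y Px Py; rewrite scale1r.
Qed.
HB.instance Definition _ (M : lmodType R) (P : M -> Prop) (h : submod_prop P) :=
  GRing.isSubmodClosed.Build R M (psub_pred h) (psub_closed h).
Definition psub (M : lmodType R) (P : M -> Prop) (h : submod_prop P) :
  submodClosed M := GRing.SubmodClosed.clone R M (psub_pred h) _.

Lemma in_psub (M : lmodType R) (P : M -> Prop) (h : submod_prop P) x :
  (x \in psub h) <-> P x.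
Proof. by split=> [/asboolP|/asboolP]. Qed.

Lemma subval_linear (M : lmodType R) (U : submodClosed M) :
  linear (@submodule_val R M U).
Proof. by []. Qed.
Definition subval (M : lmodType R) (U : submodClosed M) :
  {linear submodule U -> M} := mklin (@subval_linear M U).

Lemma subvalP (M : lmodType R) (U : submodClosed M) (x : submodule U) :
  subval U x \in U.
Proof. exact: submodule_valP. Qed.

Lemma subval_inj (M : lmodType R) (U : submodClosed M) : injective (subval U).
Proof. exact: val_inj. Qed.

Lemma lift_subP (M N : lmodType R) (U : submodClosed N) (f : {linear M -> N})
  (h : forall x, f x \in U) : linear (fun x => Submodule (h x)).
Proof. by move=> a x y; apply/val_inj; rewrite /= linearP. Qed.
Definition lift_sub (M N : lmodType R) (U : submodClosed N) (f : {linear M -> N})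
  (h : forall x, f x \in U) : {linear M -> submodule U} := mklin (lift_subP h).

Lemma ker_prop (M N : lmodType R) (f : {linear M -> N}) :
  submod_prop (fun x => f x = 0).
Proof.
by split=> [|a x y fx fy]; rewrite ?linear0 // linearP fx fy scaler0 addr0.
Qed.
Definition ker (M N : lmodType R) (f : {linear M -> N}) : submodClosed M :=
  psub (ker_prop f).
Lemma in_ker (M N : lmodType R) (f : {linear M -> N}) x :
  (x \in ker f) <-> f x = 0.
Proof. exact: in_psub. Qed.

Lemma img_prop (M N : lmodType R) (f : {linear M -> N}) :
  submod_prop (fun y => exists x, f x = y).
Proof.
split=> [|a _ _ [x <-] [y <-]]; first by exists 0; rewrite linear0.
by exists (a *: x + y); rewrite linearP.
Qed.
Definition img (M N : lmodType R) (f : {linear M -> N}) : submodClosed N :=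
  psub (img_prop f).
Lemma in_img (M N : lmodType R) (f : {linear M -> N}) y :
  (y \in img f) <-> exists x, f x = y.
Proof. exact: in_psub. Qed.

Definition surj (M N : lmodType R) (f : {linear M -> N}) : Prop :=
  forall y, exists x, f x = y.

Lemma lin_inj (M N : lmodType R) (f : {linear M -> N}) :
  (forall x, f x = 0 -> x = 0) -> injective f.
Proof.
move=> h x y fxy; apply/eqP; rewrite -subr_eq0; apply/eqP/h.
by rewrite linearB fxy subrr.
Qed.

Lemma lin_inv (M N : lmodType R) (f : {linear M -> N}) :
  injective f -> surj f -> {g : {linear N -> M} | cancel f g /\ cancel g f}.
Proof.
move=> fi fs; pose g y := sval (cid (fs y)).
have gK : cancel g f by move=> y; rewrite /g; case: cid.
have lg : linear g by move=> a x y; apply: fi; rewrite linearP !gK.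
exists (mklin lg); split=> // x.
by apply: fi; rewrite mklinE gK.
Qed.

Lemma lin_factor (M N L : lmodType R) (g : {linear M -> N}) (f : {linear M -> L}) :
  surj g -> (forall x, g x = 0 -> f x = 0) ->
  {h : {linear N -> L} | forall x, h (g x) = f x}.
Proof.
move=> gs gf; pose h y := f (sval (cid (gs y))).
have hg x : h (g x) = f x.
  rewrite /h; case: cid => y /= gy; apply/eqP; rewrite -subr_eq0 -linearB.
  by apply/eqP/gf; rewrite linearB gy subrr.
have lh : linear h.
  by move=> a x y; case: (gs x) (gs y) => [x' <-] [y' <-]; rewrite -linearP !hg linearP.
by exists (mklin lh).
Qed.

End Submodules.

(** * Projective dimension, retracts and short exact sequences *)

Section Retracts.
Variable R : pzRingType.
Implicit Types A B C F M N P Q X Y : lmodType R.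

Definition retract M X : Prop :=
  exists (i : {linear M -> X}) (p : {linear X -> M}), cancel i p.

Lemma retract_refl M : retract M M.
Proof. by exists idfun, idfun. Qed.

Lemma retract_iso M N (f : {linear M -> N}) : injective f -> surj f ->
  retract M N /\ retract N M.
Proof.
move=> fi fs; case: (lin_inv fi fs) => g [fK gK].
by split; [exists f, g | exists g, f].
Qed.

Lemma retract_projective M P : projective P -> retract M P -> projective M.
Proof.
move=> Pp [i [p ipK]] A B g f gs.
have [h hE] := Pp A B g (f \o p)%FUN gs.
by exists (h \o i)%FUN => x /=; rewrite hE /= ipK.
Qed.

Lemma projective0 M : (forall x : M, x = 0) -> projective M.
Proof.
move=> M0 A B g f gs; exists (\0 : {linear M -> A}) => x.
by rewrite (M0 x) !linear0.
Qed.

Lemma pair_projective (P Q : lmodType R) : projective P -> projective Q -> projective (P * Q)%type.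
Proof.
move=> Pp Qp A B g f gs.
have l1 : linear (fun x : P => (x, 0) : P * Q)
  by move=> a x y; congr pair; rewrite /= scaler0 addr0.
have l2 : linear (fun x : Q => (0, x) : P * Q)
  by move=> a x y; congr pair; rewrite /= scaler0 addr0.
have [h1 h1E] := Pp A B g (f \o mklin l1)%FUN gs.
have [h2 h2E] := Qp A B g (f \o mklin l2)%FUN gs.
have lh : linear (fun x : P * Q => h1 x.1 + h2 x.2).
  by move=> a x y /=; rewrite !linearP addrACA scalerDr.
exists (mklin lh) => -[x y] /=.
rewrite linearD h1E h2E /= -linearD; congr (f _).
by congr pair; rewrite /= ?addr0 ?add0r.
Qed.

(** A recursive form of resolutions of length at most n, so that inductions peel off one syzygy
    instead of handling a whole complex; [has_proj_resolutionP] returns to the definition. *)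
Fixpoint pdle (n : nat) M : Prop :=
  if n is m.+1 then
    exists (P : lmodType R) (g : {linear P -> M}),
      [/\ projective P, surj g & pdle m (submodule (ker g))]
  else projective M.

Lemma projective_pdle P n : projective P -> pdle n P.
Proof.
elim: n P => //= n IH P Pp; exists P, idfun; split=> //.
  by move=> y; exists y.
apply: IH; apply: projective0 => x; apply: subval_inj.
by have /in_ker := subvalP x; rewrite linear0.
Qed.

Lemma pdleS M n : pdle n M -> pdle n.+1 M.
Proof.
elim: n M => [|n IH] M; first exact: (@projective_pdle M 1).
by case=> P [g [Pp gs /IH kn]]; exists P, g.
Qed.

Lemma pdle_leq M m n : (m <= n)%N -> pdle m M -> pdle n M.
Proof.
move=> /subnK <-; elim: (n - m)%N => //= k IH /IH; exact: pdleS.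
Qed.

Let pair_ker (P Q X : lmodType R) (g : {linear P -> X}) : surj g ->
  exists h : {linear (P * Q)%type -> (X * Q)%type},
    surj h /\ retract (submodule (ker h)) (submodule (ker g)).
Proof.
move=> gs.
have lh : linear (fun x : P * Q => (g x.1, x.2) : X * Q).
  by move=> a x y; rewrite /= linearP.
exists (mklin lh); split.
  by move=> [x y]; have [x' <-] := gs x; exists (x', y).
have l1 : linear (fun x : P * Q => x.1) by [].
have l2 : linear (fun x : P => (x, 0) : P * Q).
  by move=> a x y; congr pair; rewrite /= scaler0 addr0.
have h1 : forall x : submodule (ker (mklin lh)),
    (mklin l1 \o subval (ker (mklin lh)))%FUN x \in ker g.
  by move=> x; apply/in_ker => /=; have /in_ker [-> _] := subvalP x.
have h2 : forall x : submodule (ker g),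
    (mklin l2 \o subval (ker g))%FUN x \in ker (mklin lh).
  move=> x; apply/in_ker => /=; congr pair.
  by have /in_ker := subvalP x.
exists (lift_sub h1), (lift_sub h2) => x; apply: subval_inj => /=.
have /in_ker [_] := subvalP x => /= E.
by rewrite [RHS]surjective_pairing; congr pair; rewrite -E.
Qed.

(** Lift [i \o h] to a : F -> P and [p \o g] to b : P -> F. Then y |-> (a y, y) is split by (k, f)
    |-> b k + (f - b (a f)), which lands in the kernel of h because p i = 1. *)
Let syzygy_retract X M P F (g : {linear P -> X}) (h : {linear F -> M}) :
  projective P -> projective F -> surj g -> surj h -> retract M X ->
  retract (submodule (ker h)) (submodule (ker g) * F)%type.
Proof.
move=> Pp Fp gs hs [i [p ipK]].
have [a aE] := Fp _ _ g (i \o h)%FUN gs.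
have [b bE] := Pp _ _ h (p \o g)%FUN hs.
have h1 : forall y : submodule (ker h), (a \o subval _)%FUN y \in ker g.
  by move=> y; apply/in_ker; rewrite /= aE /=; have /in_ker -> := subvalP y; rewrite linear0.
have lc : linear (fun y : submodule (ker h) =>
   (lift_sub h1 y, subval _ y) : (submodule (ker g) * F)%type).
  by move=> c x y; congr pair; rewrite linearP.
have ld : linear (fun x : submodule (ker g) * F =>
   b (subval _ x.1) + (x.2 - b (a x.2))).
  move=> c x y /=; rewrite !linearP /= !scalerDr.
  by rewrite (addrACA (c *: x.2)) (addrACA (c *: b _)).
have h2 : forall x, mklin ld x \in ker h.
  move=> [k f]; apply/in_ker; rewrite /= linearD linearB /= !bE /= aE /= ipK.
  by have /in_ker -> := subvalP k; rewrite linear0 subrr addr0.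
exists (mklin lc), (lift_sub h2) => y; apply: subval_inj => /=.
by rewrite addrC subrK.
Qed.

(* The syzygy of a retract is a retract of the syzygy plus a projective module,
   so that Schanuel's lemma is not needed. *)
Let pdle_retract_pair n :
  (forall X M, pdle n X -> retract M X -> pdle n M) /\
  (forall X F, projective F -> pdle n X -> pdle n (X * F)%type).
Proof.
elim: n => [|n [IHA IHB]] /=.
  by split=> [X M|X F Fp Xp]; [exact: retract_projective | exact: pair_projective].
split=> [X M [P [g [Pp gs kn]]] MX|X F Fp [P [g [Pp gs kn]]]].
  have [i [p ipK]] := MX.
  have ps : surj (p \o g)%FUN.
    by move=> y; have [x gx] := gs (i y); exists x; rewrite /= gx.
  exists P, (p \o g)%FUN; split=> //.
  exact: IHA (IHB _ _ Pp kn) (syzygy_retract Pp Pp gs ps MX).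
have [h [hs rh]] := @pair_ker P F X g gs.
exists (P * F)%type, h; split=> //; first exact: pair_projective.
exact: IHA kn rh.
Qed.

Lemma pdle_retract n X M : pdle n X -> retract M X -> pdle n M.
Proof. exact: (pdle_retract_pair n).1. Qed.

Lemma pdle_pair n X F : pdle n X -> projective F -> pdle n (X * F)%type.
Proof. by move=> Xn Fp; apply: (pdle_retract_pair n).2. Qed.

Lemma pdle_syzygy n M F (h : {linear F -> M}) : projective F -> surj h ->
  pdle n.+1 M -> pdle n (submodule (ker h)).
Proof.
move=> Fp hs [P [g [Pp gs kn]]].
exact: pdle_retract (pdle_pair kn Fp)
  (syzygy_retract Pp Fp gs hs (retract_refl M)).
Qed.

(** Horseshoe argument: for n = 0 the sequence splits, and otherwise covers of A and C assemble into
    a cover of B whose kernel is an extension of the two kernels. *)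
Lemma pdle_ext n A B C (i : {linear A -> B}) (g : {linear B -> C}) :
  injective i -> surj g -> (forall x, g x = 0 <-> exists y, i y = x) ->
  pdle n A -> pdle n C -> pdle n B.
Proof.
elim: n A B C i g => [|n IH] A B C i g ii gs ex.
  move=> Ap Cp; have [s sE] := Cp _ _ g idfun gs.
  have [r rK] : exists r : {linear submodule (ker g) -> A},
      forall x, i (r x) = subval _ x.
    have [x|r rE] := @choice _ _ (fun x y => i y = subval (ker g) x).
      by apply/ex; apply/in_ker; apply: subvalP.
    have lr : linear r by move=> a x y; apply: ii; rewrite linearP !rE linearP.
    by exists (mklin lr).
  have lp : linear (fun x => x - s (g x)).
    by move=> a x y; rewrite !linearP /= scalerDr addrACA.
  have hp : forall x, mklin lp x \in ker g.
    by move=> x; apply/in_ker; rewrite /= linearB sE subrr.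
  have l1 : linear (fun x => (r (lift_sub hp x), g x) : (A * C)%type).
    by move=> a x y; rewrite !linearP.
  have l2 : linear (fun x : A * C => i x.1 + s x.2).
    by move=> a x y; rewrite /= !linearP scalerDr addrACA.
  apply: (retract_projective (pair_projective Ap Cp)).
  exists (mklin l1), (mklin l2) => x.
  by rewrite /= rK /= subrK.
case=> P [f [Pp fs kf]] [Q [h [Qp hs kh]]].
have [k kE] := Qp _ _ g h gs.
have lt : linear (fun x : P * Q => i (f x.1) + k x.2).
  by move=> a x y; rewrite /= !linearP scalerDr addrACA.
exists (P * Q)%type, (mklin lt); split; first exact: pair_projective.
  move=> b; have [q hq] := hs (g b).
  have [|a ia] := (ex (b - k q)).1; first by rewrite linearB kE hq subrr.
  by have [p fp] := fs a; exists (p, q); rewrite /= fp ia subrK.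
have lj : linear (fun x : P => (x, 0) : P * Q).
  by move=> a x y; congr pair; rewrite /= scaler0 addr0.
have lq : linear (fun x : P * Q => x.2) by [].
have h1 : forall x, (mklin lj \o subval (ker f))%FUN x \in ker (mklin lt).
  by move=> x; apply/in_ker; rewrite /=; have /in_ker -> := subvalP x; rewrite !linear0 addr0.
have gi a : g (i a) = 0 by apply/ex; exists a.
have h2 : forall x, (mklin lq \o subval (ker (mklin lt)))%FUN x \in ker h.
  move=> x; apply/in_ker; have /in_ker /= := subvalP x.
  by move=> /(congr1 g); rewrite linearD gi kE linear0 add0r.
apply: (IH _ _ _ (lift_sub h1) (lift_sub h2)) => //.
- apply: lin_inj => x /(congr1 (subval _)) /= [x0].
  exact: subval_inj.
- move=> y; have /in_ker hy := subvalP y; move: (kE (subval _ y)); rewrite hy => /ex[a ia].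
  have [p fp] := fs (- a).
  have e : (p, subval _ y) \in ker (mklin lt).
    by apply/in_ker; rewrite /= fp linearN ia addNr.
  by exists (Submodule e); apply: subval_inj.
- move=> x; split=> [/(congr1 (subval _)) /= x2|[y <-]]; last exact: subval_inj.
  have /in_ker /= := subvalP x; rewrite x2 linear0 addr0 => ifp.
  have e : (subval _ x).1 \in ker f.
    by apply/in_ker; apply: ii; rewrite linear0.
  exists (Submodule e); apply: subval_inj => /=.
  by rewrite [RHS]surjective_pairing; congr pair; rewrite /= -x2.
Qed.

(** For a cover P -> B with kernel k, the kernel of the composite P -> C is an extension of A by k,
    to which [pdle_ext] applies. *)
Lemma pdle_coker n A B C (i : {linear A -> B}) (g : {linear B -> C}) :
  injective i -> surj g -> (forall x, g x = 0 <-> exists y, i y = x) ->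
  pdle n A -> pdle n.+1 B -> pdle n.+1 C.
Proof.
move=> ii gs ex An [P [f [Pp fs kf]]].
have gfs : surj (g \o f)%FUN.
  by move=> c; have [b <-] := gs c; have [p <-] := fs b; exists p.
exists P, (g \o f)%FUN; split=> //.
have h1 : forall x, subval (ker f) x \in ker (g \o f)%FUN.
  by move=> x; apply/in_ker; rewrite /=; have /in_ker -> := subvalP x; rewrite linear0.
have [x|r rE] :=
    @choice _ _ (fun x y => i y = f (subval (ker (g \o f)%FUN) x)).
  by apply/ex; have /in_ker := subvalP x.
have lr : linear r by move=> a x y; apply: ii; rewrite linearP !rE !linearP.
apply: (@pdle_ext n _ _ _ (lift_sub h1) (mklin lr)) => //.
- apply: lin_inj => x /(congr1 (subval _)) /= x0.
  exact: subval_inj.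
- move=> a; have [p fp] := fs (i a).
  have e : p \in ker (g \o f)%FUN by apply/in_ker; rewrite /= fp; apply/ex; exists a.
  by exists (Submodule e); apply: ii; rewrite /= rE.
- move=> x; rewrite /=; split=> [rx|[y <-]].
    have e : subval _ x \in ker f by apply/in_ker; rewrite -rE rx linear0.
    by exists (Submodule e); apply: subval_inj.
  apply: ii; rewrite rE linear0 /=.
  by have /in_ker := subvalP y.
Qed.

Lemma has_proj_resolutionP M n : has_proj_resolution M n <-> pdle n M.
Proof.
elim: n M => [|n IH] M; split.
- move=> [P [d [eps [Pp epss ex0 _ P0]]]].
  have ei : injective eps.
    by apply: lin_inj => x /ex0[y <-]; rewrite (P0 1%N y) // linear0.
  exact: retract_projective (Pp 0%N) (retract_iso ei epss).2.
- move=> Mp.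
  (* The kernel of the identity serves as the zero module. *)
  pose P i := if i is 0 then M else submodule (ker (idfun : {linear M -> M})) : lmodType R.
  have P0 i (x : P i) : (0 < i)%N -> x = 0.
    by case: i x => // i x _; apply: subval_inj; have /in_ker := subvalP x.
  exists P, (fun i => \0), idfun; split=> //.
  + by case=> //= i; apply: projective0 => x; apply: (P0 i.+1).
  + by move=> m; exists m.
  + by move=> x; split=> [/= x0 | [y <-] //]; exists 0; rewrite x0.
  + by move=> i x; split=> // _; exists 0; rewrite (P0 i.+1 x).
- move=> [P [d [eps [Pp epss ex0 ex P0]]]]; exists (P 0%N), eps; split=> //.
  apply/IH.
  have h0 : forall x, d 0%N x \in ker eps by move=> x; apply/in_ker/ex0; exists x.
  exists (fun i => P i.+1), (fun i => d i.+1), (lift_sub h0); split=> //.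
  + move=> m; have /in_ker /ex0[y dy] := subvalP m.
    by exists y; apply: subval_inj.
  + by move=> x; rewrite -ex; split=> [/(congr1 (subval _))|h] //; apply: subval_inj.
  + by move=> i x lt_ni; apply: P0.
- move=> [P [g [Pp gs /IH[P' [d' [eps' [Pp' es' ex0' ex' P0']]]]]]].
  pose Q i := if i is j.+1 then P' j else P : lmodType R.
  pose d i : {linear Q i.+1 -> Q i} :=
    match i with 0%N => (subval (ker g) \o eps')%FUN | j.+1 => d' j end.
  exists Q, d, g; split=> //.
  + by case.
  + move=> x; split=> [gx|[y <-]]; last first.
      by rewrite /=; have /in_ker := subvalP (eps' y).
    have e : x \in ker g by apply/in_ker.
    by have [y ey] := es' (Submodule e); exists y; rewrite /= ey.
  + case=> [|i] x /=; last exact: ex'.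
    rewrite -ex0'; split=> [h|->] //; exact: subval_inj.
  + by case=> // i x; apply: P0'.
Qed.

End Retracts.

Section DirectProduct.
Variables (R : pzRingType) (I : Type) (M : I -> lmodType R).

Definition dprod : Type := forall i, M i.

HB.instance Definition _ := gen_eqMixin dprod.
HB.instance Definition _ := gen_choiceMixin dprod.

Implicit Types f g h : dprod.

Let ext f g : (forall i, f i = g i) -> f = g.
Proof. exact: functional_extensionality_dep. Qed.

Let addA : associative (fun f g : dprod => (fun i => f i + g i) : dprod).
Proof. by move=> f g h; apply: ext => i; rewrite addrA. Qed.
Let addC : commutative (fun f g : dprod => (fun i => f i + g i) : dprod).
Proof. by move=> f g; apply: ext => i; rewrite addrC. Qed.
Let add0 : left_id ((fun i => 0) : dprod)
  (fun f g : dprod => (fun i => f i + g i) : dprod).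
Proof. by move=> f; apply: ext => i; rewrite add0r. Qed.
Let addN : left_inverse ((fun i => 0) : dprod)
  (fun f : dprod => (fun i => - f i) : dprod)
  (fun f g : dprod => (fun i => f i + g i) : dprod).
Proof. by move=> f; apply: ext => i; rewrite addNr. Qed.

HB.instance Definition _ := GRing.isZmodule.Build dprod addA addC add0 addN.

Let scale (a : R) f : dprod := fun i => a *: f i.
Let scaleA a b f : scale a (scale b f) = scale (a * b) f.
Proof. by apply: ext => i; rewrite /scale scalerA. Qed.
Let scale1 : left_id 1 scale.
Proof. by move=> f; apply: ext => i; rewrite /scale scale1r. Qed.
Let scaleDr : right_distributive scale +%R.
Proof. by move=> a f g; apply: ext => i; rewrite /scale scalerDr. Qed.
Let scaleDl f : {morph scale^~ f : a b / a + b}.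
Proof. by move=> a b; apply: ext => i; rewrite /scale scalerDl. Qed.

HB.instance Definition _ :=
  GRing.Zmodule_isLmodule.Build R dprod scaleA scale1 scaleDr scaleDl.

End DirectProduct.

(** * Direct sums of arbitrary families *)

Section DirectSum.
Variables (R : pzRingType) (I : eqType).
Implicit Types (M N : I -> lmodType R) (X : lmodType R).

Lemma fsupp_prop M : submod_prop
  (fun f : dprod M => exists s : seq I, forall i, i \notin s -> f i = 0).
Proof.
split=> [|a f g [s sf] [t tg]]; first by exists [::].
exists (s ++ t) => i; rewrite mem_cat negb_or => /andP[/sf fi /tg gi].
by change (a *: f i + g i = 0); rewrite fi gi scaler0 addr0.
Qed.

Definition dsum M : lmodType R := submodule (psub (fsupp_prop M)).

(* Opaque, so that [/=] does not unfold the coefficients. *)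
Lemma dcoef_subproof M i :
  {g : {linear dsum M -> M i} | forall f : dsum M, g f = submodule_val f i}.
Proof.
by exists (@mklin R (dsum M) (M i) (fun f => submodule_val f i)
             (fun a f g => erefl)).
Qed.
Definition dcoef M i := sval (@dcoef_subproof M i).
Lemma dcoefE M i (f : dsum M) : dcoef M i f = submodule_val f i.
Proof. exact: (svalP (dcoef_subproof M i)). Qed.

Lemma dsum_ext M (f g : dsum M) : (forall i, dcoef M i f = dcoef M i g) -> f = g.
Proof.
by move=> h; apply: val_inj; apply: functional_extensionality_dep => i; have := h i; rewrite !dcoefE.
Qed.

Lemma dsum_supp M (f : dsum M) :
  {s : seq I | uniq s & forall i, i \notin s -> dcoef M i f = 0}.
Proof.
have /in_psub /cid[s sf] := submodule_valP f.
exists (undup s); first exact: undup_uniq.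
by move=> i; rewrite mem_undup dcoefE; exact: sf.
Qed.

Lemma dsum_mk M (f : forall i, M i) (s : seq I) :
  (forall i, i \notin s -> f i = 0) -> {g : dsum M | forall i, dcoef M i g = f i}.
Proof.
move=> sf; have e : (f : dprod M) \in psub (fsupp_prop M).
  by apply/in_psub; exists s.
by exists (Submodule e) => i; rewrite dcoefE.
Qed.

Section Map.
Variables (M : I -> lmodType R) (X : lmodType R) (phi : forall i, {linear M i -> X}).

Definition dsum_fun (f : dsum M) : X :=
  \sum_(i <- s2val (dsum_supp f)) phi i (dcoef M i f).

(** The support list inside [dsum_fun] is an arbitrary choice; two lists outside which f vanishes
    differ only in zero terms. *)
Lemma dsum_funE (f : dsum M) (s : seq I) :
  uniq s -> (forall i, i \notin s -> dcoef M i f = 0) ->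
  dsum_fun f = \sum_(i <- s) phi i (dcoef M i f).
Proof.
move=> us sf; rewrite /dsum_fun; case: dsum_supp => t ut tf /=.
rewrite (bigID (mem s)) /= [X in _ + X]big1 ?addr0; last first.
  by move=> i /sf ->; rewrite linear0.
rewrite [RHS](bigID (mem t)) /= [X in _ = _ + X]big1 ?addr0; last first.
  by move=> i /tf ->; rewrite linear0.
rewrite -[LHS]big_filter -[RHS]big_filter; apply: perm_big; apply: uniq_perm.
- exact: filter_uniq.
- exact: filter_uniq.
- by move=> i; rewrite !mem_filter andbC.
Qed.

Lemma dsum_fun_linear : linear dsum_fun.
Proof.
move=> a f g; case: (dsum_supp f) (dsum_supp g) => [s us sf] [t ut tg].
have u : uniq (undup (s ++ t)) by apply: undup_uniq.
have mu i : i \notin undup (s ++ t) -> i \notin s /\ i \notin t.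
  by rewrite mem_undup mem_cat negb_or => /andP.
rewrite (dsum_funE u) => [|i /mu[/sf fi /tg gi]]; last first.
  by rewrite linearP fi gi scaler0 addr0.
rewrite (dsum_funE (f := f) u) => [|i /mu[/sf fi _]] //.
rewrite (dsum_funE (f := g) u) => [|i /mu[_ /tg gi]] //.
by rewrite scaler_sumr -big_split; apply: eq_bigr => i _; rewrite !linearP.
Qed.

Lemma dsum_map_subproof : {g : {linear dsum M -> X} | g =1 dsum_fun}.
Proof. by exists (mklin dsum_fun_linear). Qed.
Definition dsum_map := sval dsum_map_subproof.

Lemma dsum_mapE (f : dsum M) (s : seq I) :
  uniq s -> (forall i, i \notin s -> dcoef M i f = 0) ->
  dsum_map f = \sum_(i <- s) phi i (dcoef M i f).
Proof. by rewrite (svalP dsum_map_subproof); apply: dsum_funE. Qed.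

End Map.

Lemma dsum_in_subproof M i (x : M i) :
  (dfwith (fun j => 0 : M j) x : dprod M) \in psub (fsupp_prop M).
Proof.
apply/in_psub; exists [:: i] => j; rewrite inE eq_sym => ne.
by rewrite dfwith_out.
Qed.

Lemma dsum_in_linear M i :
  linear (fun x : M i => Submodule (dsum_in_subproof x) : dsum M).
Proof.
move=> a x y; apply: dsum_ext => j; rewrite linearP /= !dcoefE /=.
case: (eqVneq i j) => [{j}<-|ne]; first by rewrite !dfwith_in.
by rewrite !dfwith_out // scaler0 addr0.
Qed.

Lemma dsum_in_ex M i : {g : {linear M i -> dsum M} |
  forall x, dcoef M i (g x) = x /\ forall j, i != j -> dcoef M j (g x) = 0}.
Proof.
exists (mklin (@dsum_in_linear M i)) => x; split=> [|j ne]; rewrite dcoefE.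
  exact: dfwith_in.
exact: dfwith_out.
Qed.
Definition dsum_in M i := sval (dsum_in_ex M i).

Lemma dcoef_in M i (x : M i) : dcoef M i (dsum_in M i x) = x.
Proof. exact: (svalP (dsum_in_ex M i) x).1. Qed.

Lemma dcoef_in_neq M i j (x : M i) : i != j -> dcoef M j (dsum_in M i x) = 0.
Proof. by move=> ne; apply: (svalP (dsum_in_ex M i) x).2. Qed.

Lemma dsum_map_in M X (phi : forall i, {linear M i -> X}) i (x : M i) :
  dsum_map phi (dsum_in M i x) = phi i x.
Proof.
rewrite (@dsum_mapE _ _ _ _ [:: i]) //; last first.
  by move=> j; rewrite inE eq_sym => ne; apply: dcoef_in_neq.
by rewrite big_seq1 dcoef_in.
Qed.

Lemma dsum_linear_ext M X (f g : {linear dsum M -> X}) :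
  (forall i x, f (dsum_in M i x) = g (dsum_in M i x)) -> f =1 g.
Proof.
move=> fg x; case: (dsum_supp x) => s us sx.
have -> : x = \sum_(i <- s) dsum_in M i (dcoef M i x).
  apply: dsum_ext => j; rewrite linear_sum /=.
  case: (boolP (j \in s)) => js; last first.
    rewrite sx // big1_seq // => i /andP[_ is_]; apply: dcoef_in_neq.
    by apply: contraNneq js => <-.
  rewrite (big_rem j) //= dcoef_in big1_seq ?addr0 // => i /andP[_].
  rewrite mem_rem_uniq // inE => /andP[ne _]; exact: dcoef_in_neq.
by rewrite !linear_sum; apply: eq_bigr => i _.
Qed.

Lemma dsum_projective M : (forall i, projective (M i)) -> projective (dsum M).
Proof.
move=> Mp A B g f gs.
have hE i : exists h : {linear M i -> A}, forall x, g (h x) = f (dsum_in M i x).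
  by have [h hE] := Mp i A B g (f \o dsum_in M i)%FUN gs; exists h.
pose h i := sval (cid (hE i)).
exists (dsum_map h).
apply: (dsum_linear_ext (f := (g \o dsum_map h)%FUN)) => i x.
by rewrite /= dsum_map_in /h; case: cid.
Qed.

Definition dsum_mor M N (f : forall i, {linear M i -> N i}) : {linear dsum M -> dsum N} :=
  dsum_map (fun i => dsum_in N i \o f i)%FUN.

Lemma dcoef_mor M N (f : forall i, {linear M i -> N i}) i x :
  dcoef N i (dsum_mor f x) = f i (dcoef M i x).
Proof.
apply: (dsum_linear_ext (f := (dcoef N i \o dsum_mor f)%FUN)
   (g := (f i \o dcoef M i)%FUN)) => j y /=.
rewrite dsum_map_in /=; case: (eqVneq j i) => [{i}<-|ne]; first by rewrite !dcoef_in.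
by rewrite !dcoef_in_neq // linear0.
Qed.

Lemma dsum_pdle n M : (forall i, pdle n (M i)) -> pdle n (dsum M).
Proof.
elim: n M => [|n IH] M /= Mn; first exact: dsum_projective.
have [P PE] := @choice _ _ (fun i (P : lmodType R) => exists g : {linear P -> M i},
  [/\ projective P, surj g & pdle n (submodule (ker g))]) Mn.
pose g i := sval (cid (PE i)).
have [Pp gs kg] : [/\ forall i, projective (P i), forall i, surj (g i)
    & forall i, pdle n (submodule (ker (g i)))].
  by split=> i; have [] := svalP (cid (PE i)).
exists (dsum P), (dsum_mor g); split; first exact: dsum_projective.
  move=> y; case: (dsum_supp y) => s us sy.
  (* Outside the support of y the preimage 0 is taken, so that the family of preimages has finite
     support. *)
  have pre i : exists x, g i x = dcoef M i y /\ (i \notin s -> x = 0).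
    case: (boolP (i \in s)) => [_|/sy ->]; last by exists 0; rewrite linear0.
    by have [x gx] := gs i (dcoef M i y); exists x.
  have [x0 x0E] : {x0 : forall i, P i |
      forall i, g i (x0 i) = dcoef M i y /\ (i \notin s -> x0 i = 0)}.
    by exists (fun i => sval (cid (pre i))) => i; apply: (svalP (cid (pre i))).
  have [x xE] := dsum_mk (fun i => (x0E i).2).
  by exists x; apply: dsum_ext => i; rewrite dcoef_mor xE (x0E i).1.
apply: (pdle_retract (IH (fun i => submodule (ker (g i))) kg)).
set k := ker (dsum_mor g).
have h1 i x : (dcoef P i \o subval k)%FUN x \in ker (g i).
  by apply/in_ker; rewrite /= -dcoef_mor; have /in_ker -> := subvalP x; rewrite linear0.
have supp (x : submodule k) : exists z : dsum (fun i => submodule (ker (g i))),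
    forall i, dcoef _ i z = lift_sub (h1 i) x.
  case: (dsum_supp (subval k x)) => s us sx.
  have [i /sx xi|z zE] :=
    @dsum_mk (fun i => submodule (ker (g i))) (fun i => lift_sub (h1 i) x) s.
    by apply: subval_inj; rewrite /= in xi *.
  by exists z.
pose a x := sval (cid (supp x)).
have aE x i : dcoef _ i (a x) = lift_sub (h1 i) x by rewrite /a; case: cid.
have la : linear a.
  by move=> c x y; apply: dsum_ext => i; rewrite linearP !aE linearP.
pose b := dsum_mor (fun i => subval (ker (g i))).
have h2 x : b x \in k.
  apply/in_ker; apply: dsum_ext => i; rewrite !dcoef_mor linear0.
  by have /in_ker := subvalP (dcoef _ i x).
exists (mklin la), (lift_sub h2) => x; apply: subval_inj; apply: dsum_ext => i.
by rewrite /= dcoef_mor aE.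
Qed.

End DirectSum.

(** * Projective cyclic modules *)

Section Cyclic.
Variable R : pzRingType.

Lemma regular_projective : projective (R^o : lmodType R).
Proof.
move=> A B g f gs; have [a ga] := gs (f 1).
have la : linear (fun r : R^o => (r : R) *: a).
  by move=> c x y; rewrite scalerDl scalerA.
by exists (mklin la) => x; rewrite /= linearZ /= ga -linearZ /= [_ *: _]mulr1.
Qed.

Lemma principal_projective (e : R) : e * e = e ->
  projective (submodule (principal e) : lmodType R).
Proof.
move=> ee; apply: (retract_projective regular_projective).
have h (x : R^o) : (x * e : R^o) \in principal e by apply/asboolP; exists x.
have l : linear (fun x : R^o => Submodule (h x)).
  by move=> a x y; apply: val_inj; rewrite /= mulrDl -mulrA.
exists (subval (principal e)), (mklin l) => x; apply: val_inj => /=.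
by have /asboolP[a ->] := submodule_valP x; rewrite -mulrA ee.
Qed.

(* A projective cyclic module [Q = R q] splits off [R], so the annihilator of
   [q] in [R e] is generated by an idempotent. *)
Lemma cyclic_projective_ann (Q : lmodType R) (e : R) (q : Q) :
  e * e = e -> e *: q = q -> (forall x, exists a, a *: q = x) -> projective Q ->
  (forall u : R, u * u = u -> u * e = u -> u *: q = 0 -> u = 0) ->
  forall a, a * e = a -> a *: q = 0 -> a = 0.
Proof.
move=> ee eq gen Qp nil.
have lg : linear (fun r : R^o => (r : R) *: q).
  by move=> c x y; rewrite scalerDl scalerA.
have gs : surj (mklin lg) by move=> y; have [a <-] := gen y; exists a.
have [s sE] := Qp _ _ (mklin lg) idfun gs.
pose y : R := s q; have yq : y *: q = q := sE q.
have sZ a : s (a *: q) = a * y :> R by rewrite linearZ.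
have ann a : a *: q = 0 -> a * y = 0 by rewrite -sZ => ->; rewrite linear0.
have ey : e * y = y by rewrite -sZ eq.
have yee : y * e = e.
  pose u := e - y * e.
  have uq : u *: q = 0 by rewrite scalerBl -scalerA eq yq subrr.
  have ue : u * e = u by rewrite mulrBl -mulrA ee.
  apply/eqP; rewrite eq_sym -subr_eq0; apply/eqP/nil => //.
  by rewrite -/u {2}/u mulrBr ue mulrA ann // mul0r subr0.
by move=> a ae aq; rewrite -ae -yee mulrA ann ?mul0r.
Qed.

End Cyclic.

(** * Rings with a basis of paths *)

Section PathCombinatorics.
Variable G : quiver.
Implicit Types (p q r u w : qpath G) (a b : arrow G) (v : vertex G).

Lemma path_mul_defined p q : path_src p = path_tgt q -> exists r, path_mul p q = Some r.
Proof. by case: path_mulP => [r *|/eqP//]; exists r. Qed.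

Lemma path_mul_compat p q r : path_mul p q = Some r -> path_src p = path_tgt q.
Proof. by case: path_mulP. Qed.

Lemma path_mul_arrows p q r : path_mul p q = Some r ->
  path_arrows r = path_arrows q ++ path_arrows p.
Proof. by case: path_mulP => // x _ _ e _ [<-]. Qed.

Lemma path_mul_src p q r : path_mul p q = Some r -> path_src r = path_src q.
Proof. by case: path_mulP => // x _ e _ _ [<-]. Qed.

Lemma path_mul_tgt p q r : path_mul p q = Some r -> path_tgt r = path_tgt p.
Proof. by case: path_mulP => // x _ _ _ e [<-]. Qed.

Lemma path_mulI p q q' r : path_mul p q = Some r -> path_mul p q' = Some r -> q = q'.
Proof.
move=> e e'; apply: path_ext; first by rewrite -(path_mul_src e) (path_mul_src e').
have := path_mul_arrows e; rewrite (path_mul_arrows e').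
by move/eqP; rewrite eqseq_cat ?eqxx ?andbT => [/eqP//|]; have /eqP := congr1 size
  (path_mul_arrows e); rewrite (path_mul_arrows e') !size_cat eqn_add2r => /eqP.
Qed.

Lemma path_mulIr p p' q r : path_mul p q = Some r -> path_mul p' q = Some r -> p = p'.
Proof.
move=> e e'; apply: path_ext.
  by rewrite (path_mul_compat e) (path_mul_compat e').
have := path_mul_arrows e; rewrite (path_mul_arrows e').
by move/eqP; rewrite eqseq_cat ?eqxx //= => /eqP.
Qed.

Lemma path_mulA_some p q r pq qr x : path_mul p q = Some pq ->
  path_mul q r = Some qr -> path_mul pq r = Some x -> path_mul p qr = Some x.
Proof. by move=> e1 e2 e3; have := path_mulA p q r; rewrite e1 e2 /= e3. Qed.

Lemma path_trivialP p : path_trivial p -> p = vertex_path (path_src p).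
Proof. by move/nilP => e; apply: path_ext. Qed.

Lemma path_lastP p : ~~ path_trivial p ->
  exists a q, path_mul (arrow_path a) q = Some p.
Proof.
case: p => -[v s] /=; rewrite /path_trivial /path_arrows /=.
case/lastP: s => [//|s a] W _.
have : is_walk v (s ++ [:: a]) by rewrite cats1.
rewrite is_walk_cat => /andP[W1 /= /andP[/eqP sa _]].
exists a, (QPath (W1 : is_walk (v, s).1 (v, s).2)).
case: path_mulP => [r E e1 e2 _|]; last by rewrite {1}/path_src /= sa eqxx.
by congr Some; apply: path_ext; rewrite ?e1 ?e2 // /path_arrows /= cats1.
Qed.

Lemma path_firstP p : ~~ path_trivial p ->
  exists a q, path_mul q (arrow_path a) = Some p.
Proof.
case: p => -[v s] /=; rewrite /path_trivial /path_arrows /=.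
case: s => [//|a s] W _; have /= /andP[/eqP sa W1] := W.
exists a, (QPath (W1 : is_walk (tgt a, s).1 (tgt a, s).2)).
case: path_mulP => [r E e1 e2 _|]; last by rewrite /path_tgt /= eqxx.
by congr Some; apply: path_ext; rewrite ?e1 ?e2.
Qed.

Lemma path_prefixP q p : path_src q = path_src p ->
  prefix (path_arrows q) (path_arrows p) -> exists w, path_mul w q = Some p.
Proof.
case: q p => -[v s] W [[v' t] W']; rewrite /path_src /path_arrows /= => e.
subst v'; case/prefixP => x e; subst t.
have : is_walk v (s ++ x) := W'; rewrite is_walk_cat => /andP[W1 W2].
exists (QPath (W2 : is_walk (_, x).1 (_, x).2)).
case: path_mulP => [r E e1 e2 _|]; last by rewrite {1}/path_src /= /path_tgt eqxx.
by congr Some; apply: path_ext; rewrite ?e1 ?e2.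
Qed.

Lemma path_mul_prefix w q p : path_mul w q = Some p ->
  prefix (path_arrows q) (path_arrows p).
Proof. by move/path_mul_arrows ->; apply: prefix_prefix. Qed.

Definition paths_below (N : nat) : seq (qpath G) :=
  pmap insub [seq (v, s) | v <- enum (vertex G),
    s <- flatten [seq [seq tval t | t <- enum {: n.-tuple (arrow G)}] | n <- iota 0 N]].

Lemma mem_paths_below N p : (size (path_arrows p) < N)%N -> p \in paths_below N.
Proof.
move=> sz; rewrite mem_pmap; apply/mapP; exists (path_val p); last by rewrite valK.
apply/allpairsP; exists (path_val p); split; rewrite ?mem_enum //.
  apply/flattenP; exists [seq tval t | t <- enum {: (size (path_arrows p)).-tuple (arrow G)}].
    by apply/mapP; exists (size (path_arrows p)); rewrite // mem_iota add0n sz.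
  by apply/mapP; exists (in_tuple (path_arrows p)); rewrite ?mem_enum.
by rewrite -surjective_pairing.
Qed.

End PathCombinatorics.

Lemma malgZU (T : choiceType) (R : nzRingType) (c d : R) (t : T) :
  c *: << d *g t >> = << c * d *g t >> :> {malg R[T]}.
Proof. by apply/malgP => k; rewrite mcoeffZ !mcoeffU mulrnAr. Qed.

Section PathAlgebra.
Variables (K : fieldType) (G : quiver).
Implicit Types (p q r : qpath G) (f g : pathalg K G) (c d : K).

Lemma pathalg_mulUU c d p q : (<< c *g p >> : pathalg K G) * << d *g q >> =
  path_term (c * d) (path_mul p q).
Proof.
rewrite /GRing.mul /= /pathalg_mul.
rewrite (big_fset_incl _ msuppU_le) /=; last first.
  move=> x _ /mcoeff_outdom fp; rewrite big1 // => y _.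
  by rewrite fp mul0r; case: path_mul => //= ?; rewrite monalgU0.
rewrite big_seq_fset1 (big_fset_incl _ msuppU_le) /=; last first.
  move=> y _ /mcoeff_outdom ->; rewrite mulr0.
  by case: path_mul => //= ?; rewrite monalgU0.
by rewrite big_seq_fset1 !mcoeffUU.
Qed.

Lemma of_pathM p q : of_path K p * of_path K q =
  if path_mul p q is Some r then of_path K r else 0.
Proof. by rewrite pathalg_mulUU mulr1; case: path_mul. Qed.

Lemma pathalg1E : (1 : pathalg K G) = \sum_(v : vertex G) of_path K (vertex_path v).
Proof. by []. Qed.

Lemma scale_monalgU c d p : c *: (<< d *g p >> : pathalg K G) = << c * d *g p >>.
Proof. exact: malgZU. Qed.

Let scale1E c : c *: (1 : pathalg K G) = \sum_(v : vertex G) << c *g vertex_path v >>.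
Proof.
rewrite pathalg1E scaler_sumr; apply: eq_bigr => v _.
by rewrite scale_monalgU mulr1.
Qed.

Let scale1_mulU c d p :
  (c *: (1 : pathalg K G) : pathalg K G) * << d *g p >> = << c * d *g p >>.
Proof.
rewrite scale1E mulr_suml (bigD1 (path_tgt p)) //= big1 ?addr0 => [|v /negbTE ne];
  by rewrite pathalg_mulUU path_mul1p ?ne ?eqxx.
Qed.

Let mulU_scale1 c d p :
  (<< d *g p >> : pathalg K G) * (c *: (1 : pathalg K G) : pathalg K G) = << c * d *g p >>.
Proof.
rewrite scale1E mulr_sumr (bigD1 (path_src p)) //= big1 ?addr0 => [|v /negbTE ne];
  by rewrite pathalg_mulUU path_mulp1 ?ne ?eqxx 1?mulrC.
Qed.

Lemma scale1_mul c f : ((c *: (1 : pathalg K G) : pathalg K G) * f) = c *: f.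
Proof.
rewrite {2}[f]monalgE [f in LHS]monalgE mulr_sumr [RHS]scaler_sumr.
by apply: eq_bigr => p _; rewrite scale1_mulU scale_monalgU.
Qed.

Lemma mul_scale1 c f : f * (c *: (1 : pathalg K G) : pathalg K G) = c *: f.
Proof.
rewrite {2}[f]monalgE [f in LHS]monalgE mulr_suml [RHS]scaler_sumr.
by apply: eq_bigr => p _; rewrite mulU_scale1 scale_monalgU.
Qed.

Lemma monalgU_of_path c p : (<< c *g p >> : pathalg K G) = (c *: (1 : pathalg K G) : pathalg K G) * of_path K p.
Proof. by rewrite scale1_mul scale_monalgU mulr1. Qed.

End PathAlgebra.

(** Abstracts the quotient of the path algebra by a monomial ideal, so that its
    concrete representation never gets unfolded. *)
Record path_basis (K : fieldType) (G : quiver) (L : pzRingType) := PathBasis {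
  pb_scal : K -> L;
  pb_pi : qpath G -> L;
  pb_cf : qpath G -> L -> K;
  pb_paths : seq (qpath G);
  pb_scalD : {morph pb_scal : c d / c + d};
  pb_scalM : {morph pb_scal : c d / c * d};
  pb_scal1 : pb_scal 1 = 1;
  pb_scalC : forall c x, pb_scal c * x = x * pb_scal c;
  pb_piM : forall p q,
    pb_pi p * pb_pi q = if path_mul p q is Some r then pb_pi r else 0;
  pb_sum1 : \sum_(v : vertex G) pb_pi (vertex_path v) = 1;
  pb_uniq : uniq pb_paths;
  pb_pi_out : forall p, p \notin pb_paths -> pb_pi p = 0;
  pb_cfD : forall p, {morph pb_cf p : x y / x + y};
  pb_cf_scal : forall p c x, pb_cf p (pb_scal c * x) = c * pb_cf p x;
  pb_cf_pi : forall p q, pb_cf p (pb_pi q) = ((p \in pb_paths) && (q == p))%:R;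
  pb_cf_out : forall p x, p \notin pb_paths -> pb_cf p x = 0;
  pb_cf_ext : forall x, (forall p, p \in pb_paths -> pb_cf p x = 0) -> x = 0 }.

(** * The quotient of the path algebra by a monomial ideal *)

Section Lambda.
Variables (K : fieldType) (G : quiver) (I : tsideal (pathalg K G)).
Hypothesis hmono : generated_by_paths I.
Variable N : nat.
Hypothesis hnil : forall x, ideal_pow (@arrow_ideal K G) N x -> x \in I.

Implicit Types (p q r u w : qpath G) (f g : pathalg K G) (c d : K) (a b : arrow G).
Implicit Types (x y z : Lambda I).

(** The span of the paths lying in I. It is a two-sided ideal containing the generating paths, hence
    contains I; this is why every path occurring in an element of I lies in I. *)
Let mono_pred : pathalg K G -> bool :=
  fun f => `[< forall p, mcoeff p f != 0 -> of_path K p \in I >].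

Lemma idealMl f g : g \in I -> f * g \in I.
Proof. exact: (fun Ig => (@two_sided_subproof _ I f g Ig).1). Qed.
Lemma idealMr f g : g \in I -> g * f \in I.
Proof. exact: (fun Ig => (@two_sided_subproof _ I f g Ig).2). Qed.

Let mono_zmod : zmod_closed mono_pred.
Proof.
split=> [|f g /asboolP If /asboolP Ig]; apply/asboolP => p.
  by rewrite mcoeff0 eqxx.
rewrite mcoeffB => ne; case: (eqVneq (mcoeff p f) 0) => [f0|]; last exact: If.
by apply: Ig; apply: contraNneq ne => g0; rewrite f0 g0 subr0.
Qed.
HB.instance Definition _ := GRing.isZmodClosed.Build (pathalg K G) mono_pred mono_zmod.

Let mono_two f g : mono_pred g -> mono_pred (f * g) /\ mono_pred (g * f).
Proof.
move=> /asboolP Ig.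
have T c o r : mcoeff r (path_term c o : pathalg K G) != 0 -> o = Some r.
  case: o => [q|] /=; last by rewrite mcoeff0 eqxx.
  by rewrite mcoeffU; case: (eqVneq q r) => [->//|_]; rewrite mulr0n eqxx.
have S (J : Type) (s : seq J) (F : J -> pathalg K G) r :
    mcoeff r (\sum_(i <- s) F i) != 0 -> exists i, mcoeff r (F i) != 0.
  elim: s => [|i s IH]; first by rewrite big_nil mcoeff0 eqxx.
  rewrite big_cons mcoeffD; case: (eqVneq (mcoeff r (F i)) 0) => [->|ne _]; last by exists i.
  by rewrite add0r.
split; apply/asboolP => r; rewrite [f]monalgE [g]monalgE mulr_suml => /S[p];
  rewrite mulr_sumr => /S[q]; rewrite pathalg_mulUU => ne.
  have e := T _ _ _ ne.
  have : of_path K p * of_path K q \in I.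
    apply: idealMl; apply: Ig; apply: contraNneq ne => ->; rewrite mulr0 e /=.
    by rewrite monalgU0 mcoeff0.
  by rewrite of_pathM e.
have e := T _ _ _ ne.
have : of_path K p * of_path K q \in I.
  apply: idealMr; apply: Ig; apply: contraNneq ne => ->; rewrite mul0r e /=.
  by rewrite monalgU0 mcoeff0.
by rewrite of_pathM e.
Qed.
HB.instance Definition _ := isTwoSided.Build (pathalg K G) mono_pred mono_two.

Lemma ideal_monomial f p : f \in I -> mcoeff p f != 0 -> of_path K p \in I.
Proof.
have [S SE] := hmono => /SE /(_ (TwoSidedIdeal.clone _ mono_pred _)) h.
have /asboolP : f \in mono_pred.
  apply: h => _ [q Sq <-]; apply/asboolP => p'.
  rewrite mcoeffU; case: (eqVneq q p') => [<- _|_]; last by rewrite mulr0n eqxx.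
  by apply/SE => J; apply; exists q.
exact.
Qed.

Definition nzpath p : bool := of_path K p \notin I.

Lemma clsP f g : (cls I f = cls I g) <-> (f - g \in I).
Proof.
have R : reflect (cls I f = cls I g) (f - g \in I).
  by rewrite Quotient.idealrBE; apply: eqP.
by split=> /R.
Qed.

Lemma clsD f g : cls I (f + g) = cls I f + cls I g.
Proof. by rewrite /cls piE. Qed.

Lemma cls0 : cls I 0 = 0.
Proof. by have := clsD 0 0; rewrite addr0 -{1}[cls I 0]addr0 => /addrI. Qed.

Lemma clsK x : cls I (repr x) = x.
Proof. exact: reprK. Qed.

Lemma cls_eq0 f : (cls I f = 0) <-> (f \in I).
Proof. by rewrite -cls0 clsP subr0. Qed.

Lemma clsM f g : cls I (f * g) = cls I f * cls I g.
Proof.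
apply/clsP; set f' := repr _; set g' := repr _.
have hf : f - f' \in I by apply/clsP; rewrite clsK.
have hg : g - g' \in I by apply/clsP; rewrite clsK.
have -> : f * g - f' * g' = (f - f') * g + f' * (g - g').
  by rewrite mulrBl mulrBr addrA subrK.
by apply: rpredD; [apply: idealMr | apply: idealMl].
Qed.

Lemma cls_sum (J : Type) (s : seq J) (F : J -> pathalg K G) :
  cls I (\sum_(i <- s) F i) = \sum_(i <- s) cls I (F i).
Proof. exact: (big_morph (cls I) clsD cls0). Qed.

Let pi p : Lambda I := cls I (of_path K p).

Let piM p q : pi p * pi q = if path_mul p q is Some r then pi r else 0.
Proof. by rewrite -clsM of_pathM; case: path_mul => // ; rewrite cls0. Qed.

Let pi_eq0 p : (pi p == 0) = ~~ nzpath p.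
Proof. by rewrite negbK; apply/eqP/idP => /cls_eq0. Qed.

Let scalM c d : scal I (c * d) = scal I c * scal I d.
Proof. by rewrite -clsM scale1_mul scalerA. Qed.
Let scalD c d : scal I (c + d) = scal I c + scal I d.
Proof. by rewrite -clsD -scalerDl. Qed.
Let scal1 : scal I 1 = 1.
Proof. by rewrite /scal scale1r. Qed.
Let scalC c x : scal I c * x = x * scal I c.
Proof. by rewrite -[x]clsK -!clsM scale1_mul mul_scale1. Qed.

(** Independent of the representative, because by [ideal_monomial] no path outside I occurs in an
    element of I; at paths in I the value is set to 0. *)
Let cf p x : K := if nzpath p then mcoeff p (repr x) else 0.

Let cf_cls p f : nzpath p -> cf p (cls I f) = mcoeff p f.
Proof.
move=> nz; rewrite /cf nz; apply/eqP; rewrite -subr_eq0 -mcoeffB.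
apply: contraNT nz; apply: ideal_monomial; apply/clsP; exact: clsK.
Qed.

Let cfD p x y : cf p (x + y) = cf p x + cf p y.
Proof.
case nz: (nzpath p); last by rewrite /cf nz addr0.
by rewrite -[x]clsK -[y]clsK -clsD !cf_cls // mcoeffD.
Qed.
Let cf_scal p c x : cf p (scal I c * x) = c * cf p x.
Proof.
case nz: (nzpath p); last by rewrite /cf nz mulr0.
by rewrite -[x]clsK -clsM scale1_mul !cf_cls // mcoeffZ.
Qed.

Let cf_pi p q : cf p (pi q) = (nzpath p && (q == p))%:R.
Proof.
case nz: (nzpath p); last by rewrite /cf nz.
by rewrite cf_cls //= mcoeffU.
Qed.

Let cf_ext x : (forall p, nzpath p -> cf p x = 0) -> x = 0.
Proof.
move=> h; rewrite -[x]clsK; apply/cls_eq0.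
rewrite [repr x]monalgE; apply: rpred_sum => p _.
rewrite monalgU_of_path; case nz: (nzpath p).
  by have := h p nz; rewrite /cf nz => ->; rewrite scale0r mul0r rpred0.
by apply: idealMl; apply/negPn; rewrite -/(nzpath p) nz.
Qed.

Lemma arrow_in_ideal a : @arrow_ideal K G (of_arrow K a).
Proof. by move=> J; apply; exists a. Qed.

Lemma long_path_ideal p : (N <= size (path_arrows p))%N -> of_path K p \in I.
Proof.
(* The factors x i are the last N arrows of p, and q is what precedes them. *)
move=> le; suff [x [q [xA ->]]] : exists (x : nat -> pathalg K G) (q : qpath G),
    (forall i, (i < N)%N -> @arrow_ideal K G (x i)) /\
    of_path K p = (\prod_(i < N) x i) * of_path K q.
  by apply/idealMr/hnil => J; apply; exists (fun i => x i); split=> // i; apply: xA.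
elim: N p le => [|n IH] p le.
  by exists (fun=> 0), p; rewrite big_ord0 mul1r.
have [|a [q e]] := @path_lastP _ p; first by rewrite /path_trivial; case: (path_arrows p) le.
have [|x [q' [xA E]]] := IH q.
  by move: le; rewrite (path_mul_arrows e) size_cat addn1.
exists (fun i => if i is j.+1 then x j else of_arrow K a), q'; split.
  by case=> [_|i /xA //]; apply: arrow_in_ideal.
have H : of_arrow K a * of_path K q = of_path K p by rewrite of_pathM e.
rewrite big_ord_recl -(mulrA (of_arrow K a)).
by rewrite -[RHS]/(of_arrow K a * (\prod_(i < n) x i * of_path K q')) -E H.
Qed.

Lemma nz_size p : nzpath p -> (size (path_arrows p) < N)%N.
Proof. by rewrite ltnNge; apply: contra => /long_path_ideal. Qed.

Definition nzpaths : seq (qpath G) := [seq p <- undup (paths_below G N) | nzpath p].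

Lemma mem_nzpaths p : (p \in nzpaths) = nzpath p.
Proof.
rewrite mem_filter mem_undup andbC; case nz: (nzpath p); rewrite ?andbF //.
by rewrite andbT mem_paths_below // nz_size.
Qed.

Lemma uniq_nzpaths : uniq nzpaths.
Proof. exact/filter_uniq/undup_uniq. Qed.

Let cf_out p x : p \notin nzpaths -> cf p x = 0.
Proof. by rewrite mem_nzpaths /cf => /negbTE ->. Qed.

Let pi_out p : p \notin nzpaths -> pi p = 0.
Proof. by rewrite mem_nzpaths -pi_eq0 => /eqP. Qed.

Let sum_pi1 : \sum_(v : vertex G) pi (vertex_path v) = 1.
Proof. by rewrite -cls_sum. Qed.

Let cf_pi_mem p q : cf p (pi q) = ((p \in nzpaths) && (q == p))%:R.
Proof. by rewrite mem_nzpaths cf_pi. Qed.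

Let cf_ext_mem x : (forall p, p \in nzpaths -> cf p x = 0) -> x = 0.
Proof. by move=> h; apply: cf_ext => p; rewrite -mem_nzpaths; apply: h. Qed.

Definition Lambda_basis : path_basis K G (Lambda I) :=
  PathBasis scalD scalM scal1 scalC piM sum_pi1 uniq_nzpaths pi_out
    cfD cf_scal cf_pi_mem cf_out cf_ext_mem.

End Lambda.

(** * Calculus of coefficients in a ring with a path basis *)

Section PathBasis.
Variables (K : fieldType) (G : quiver) (L : pzRingType) (B : path_basis K G L).
Implicit Types (p q r u w : qpath G) (c d : K) (a b : arrow G) (v : vertex G).
Implicit Types (x y z : L).
Local Notation scal := (pb_scal B).
Local Notation pi := (pb_pi B).
Local Notation cf := (pb_cf B).
Local Notation nzpaths := (pb_paths B).

Definition nonzero_path p : bool := p \in nzpaths.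
Local Notation nz := nonzero_path.

Lemma scalD c d : scal (c + d) = scal c + scal d. Proof. exact: pb_scalD. Qed.
Lemma scalM c d : scal (c * d) = scal c * scal d. Proof. exact: pb_scalM. Qed.
Lemma scal1 : scal 1 = 1. Proof. exact: pb_scal1. Qed.
Lemma scalC c x : scal c * x = x * scal c. Proof. exact: pb_scalC. Qed.
Lemma piM p q : pi p * pi q = if path_mul p q is Some r then pi r else 0.
Proof. exact: pb_piM. Qed.
Lemma cfD p x y : cf p (x + y) = cf p x + cf p y. Proof. exact: pb_cfD. Qed.
Lemma cf_scal p c x : cf p (scal c * x) = c * cf p x. Proof. exact: pb_cf_scal. Qed.
Lemma cf_pi p q : cf p (pi q) = (nz p && (q == p))%:R. Proof. exact: pb_cf_pi. Qed.
Lemma cf_ext0 x : (forall p, nz p -> cf p x = 0) -> x = 0.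
Proof. exact: pb_cf_ext. Qed.

Lemma pi_eq0 p : (pi p == 0) = ~~ nz p.
Proof.
apply/eqP/idP => [e|]; last exact: pb_pi_out.
apply/negP => np; have := cf_pi p p; rewrite e np eqxx => h.
have := cf_scal p 0 0; rewrite mulr0 mul0r h => /eqP.
by rewrite oner_eq0.
Qed.

Lemma pi_neq0 p : (pi p != 0) = nz p.
Proof. by rewrite pi_eq0 negbK. Qed.

Lemma nz_mul p q r : path_mul p q = Some r -> nz r -> nz p /\ nz q.
Proof.
move=> e; rewrite -!pi_neq0 => nr.
have E : pi p * pi q = pi r by rewrite piM e.
by split; apply: contraNneq nr => h; rewrite -E h ?mul0r ?mulr0.
Qed.

Lemma cf_nz p x : cf p x != 0 -> nz p.
Proof. by apply: contraNT => /pb_cf_out ->. Qed.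

Lemma scal0 : scal 0 = 0.
Proof. by have := scalD 0 0; rewrite addr0 -{1}[scal 0]addr0 => /addrI. Qed.
Lemma scalN c : scal (- c) = - scal c.
Proof. by apply/eqP; rewrite -addr_eq0 -scalD addNr scal0. Qed.
Lemma cf0 p : cf p 0 = 0.
Proof. by have := cfD p 0 0; rewrite addr0 -{1}[cf p 0]addr0 => /addrI. Qed.
Lemma cfN p x : cf p (- x) = - cf p x.
Proof. by apply/eqP; rewrite -addr_eq0 -cfD addNr cf0. Qed.
Lemma cfB p x y : cf p (x - y) = cf p x - cf p y.
Proof. by rewrite cfD cfN. Qed.
Lemma cf_sum p (J : Type) (s : seq J) (F : J -> L) :
  cf p (\sum_(i <- s) F i) = \sum_(i <- s) cf p (F i).
Proof. exact: (big_morph (cf p) (cfD p) (cf0 p)). Qed.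

Lemma cf_ext x y : (forall p, nz p -> cf p x = cf p y) -> x = y.
Proof.
move=> h; apply/eqP; rewrite -subr_eq0; apply/eqP/cf_ext0 => p /h e.
by rewrite cfB e subrr.
Qed.

Lemma big_nz (V : nmodType) (F : qpath G -> V) p : nz p ->
  (forall q, nz q -> q != p -> F q = 0) -> \sum_(q <- nzpaths) F q = F p.
Proof.
move=> np F0; rewrite (big_rem p) //= big1_seq ?addr0 // => q /andP[_].
by rewrite mem_rem_uniq ?pb_uniq // inE => /andP[ne nq]; apply: F0.
Qed.

Lemma cf_sum_pi p (F : qpath G -> K) :
  cf p (\sum_(q <- nzpaths) scal (F q) * pi q) = if nz p then F p else 0.
Proof.
rewrite cf_sum; case: ifP => nz; last first.
  by rewrite big1 // => q _; rewrite cf_scal cf_pi nz mulr0.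
rewrite (big_nz nz) => [|q _ ne]; rewrite cf_scal cf_pi nz ?eqxx ?mulr1 //.
by rewrite (negbTE ne) mulr0.
Qed.

Lemma cf_expand x : x = \sum_(p <- nzpaths) scal (cf p x) * pi p.
Proof. by apply: cf_ext => p nz; rewrite cf_sum_pi nz. Qed.

(** Prolonging by w is injective on paths, so only the coefficient of x at p contributes at r. *)
Lemma cf_piM w p r x : path_mul w p = Some r -> nz r -> cf r (pi w * x) = cf p x.
Proof.
move=> e nr; have [nw np] := nz_mul e nr.
rewrite [in LHS](cf_expand x) mulr_sumr cf_sum (big_nz np) => [|q _ ne].
  by rewrite mulrA -scalC -mulrA cf_scal piM e cf_pi nr eqxx mulr1.
rewrite mulrA -scalC -mulrA cf_scal piM; case e': path_mul => [r'|]; last by rewrite cf0 mulr0.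
rewrite cf_pi; case: (eqVneq r' r) => [E|_]; last by rewrite andbF mulr0.
by move: ne; rewrite (path_mulI e (q' := q)) ?eqxx // e' E.
Qed.

Lemma cf_piM_neq0 w r x : cf r (pi w * x) != 0 ->
  exists2 p, path_mul w p = Some r & cf p x != 0.
Proof.
move=> ne; have nr := cf_nz ne; move: ne.
rewrite [in X in X -> _](cf_expand x) mulr_sumr cf_sum.
case: (pselect (exists2 p, path_mul w p = Some r & cf p x != 0)) => // no.
rewrite big1 ?eqxx // => p _; rewrite mulrA -scalC -mulrA cf_scal piM.
case: (eqVneq (cf p x) 0) => [->|ne]; first by rewrite mul0r.
case e: path_mul => [r'|]; last by rewrite cf0 mulr0.
rewrite cf_pi; case: (eqVneq r' r) => [E|_]; last by rewrite andbF mulr0.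
by case: no; exists p; rewrite ?e ?E.
Qed.

Lemma cf_Mpi u p r x : path_mul p u = Some r -> nz r -> cf r (x * pi u) = cf p x.
Proof.
move=> e nr; have [np nu] := nz_mul e nr.
rewrite [in LHS](cf_expand x) mulr_suml cf_sum (big_nz np) => [|q _ ne].
  by rewrite -mulrA cf_scal piM e cf_pi nr eqxx mulr1.
rewrite -mulrA cf_scal piM; case e': path_mul => [r'|]; last by rewrite cf0 mulr0.
rewrite cf_pi; case: (eqVneq r' r) => [E|_]; last by rewrite andbF mulr0.
by move: ne; rewrite (path_mulIr e (p' := q)) ?eqxx // e' E.
Qed.

Lemma cf_Mpi_neq0 u r x : cf r (x * pi u) != 0 ->
  exists2 p, path_mul p u = Some r & cf p x != 0.
Proof.
move=> ne; have nr := cf_nz ne; move: ne.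
rewrite [in X in X -> _](cf_expand x) mulr_suml cf_sum.
case: (pselect (exists2 p, path_mul p u = Some r & cf p x != 0)) => // no.
rewrite big1 ?eqxx // => p _; rewrite -mulrA cf_scal piM.
case: (eqVneq (cf p x) 0) => [->|ne]; first by rewrite mul0r.
case e: path_mul => [r'|]; last by rewrite cf0 mulr0.
rewrite cf_pi; case: (eqVneq r' r) => [E|_]; last by rewrite andbF mulr0.
by case: no; exists p; rewrite ?e ?E.
Qed.

(** A trivial path is a product of trivial paths only. The coefficient at v is thus a multiplicative
    functional on L; [jacobsonP] describes the Jacobson radical by these functionals. *)
Lemma cfM_vertex v x y :
  cf (vertex_path v) (x * y) = cf (vertex_path v) x * cf (vertex_path v) y.
Proof.
rewrite [in LHS](cf_expand x) mulr_suml cf_sum.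
have E p : nz p -> p != vertex_path v -> cf (vertex_path v) (pi p * y) = 0.
  move=> np ne; apply/eqP; apply: contraTT ne => /cf_piM_neq0[q e _].
  have := path_mul_arrows e => /esym/eqP; rewrite negbK.
  rewrite -size_eq0 size_cat addn_eq0 => /andP[/eqP/size0nil q0 /eqP/size0nil p0].
  have := path_mul_compat e; rewrite /path_tgt q0 /= -(path_mul_src e) => pv.
  by apply/eqP; apply: path_ext.
case nv: (nz (vertex_path v)); last first.
  have E0 z : cf (vertex_path v) z = 0 by apply: pb_cf_out; rewrite -/(nz _) nv.
  by rewrite !E0 mul0r big1 // => p _; rewrite E0.
rewrite (big_nz nv) => [|p np ne]; rewrite -mulrA cf_scal; last by rewrite E ?mulr0.
by rewrite (@cf_piM _ (vertex_path v)) // path_mul1p eqxx.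
Qed.

Definition vertex_unit v : L := pi (vertex_path v).
Definition arrow_elt a : L := pi (arrow_path a).
Local Notation ev := vertex_unit.
Local Notation ar := arrow_elt.

Lemma sum_ev : \sum_v ev v = 1.
Proof. exact: pb_sum1. Qed.

Lemma ev_pi v p : ev v * pi p = if v == path_tgt p then pi p else 0.
Proof. by rewrite piM path_mul1p; case: ifP. Qed.

Lemma pi_ev v p : pi p * ev v = if v == path_src p then pi p else 0.
Proof. by rewrite piM path_mulp1; case: ifP. Qed.

Lemma ev_ev v (w : vertex G) : ev v * ev w = if v == w then ev v else 0.
Proof. by rewrite ev_pi /path_tgt /=; case: eqVneq => [->|]. Qed.

Lemma ev_idem v : ev v * ev v = ev v.
Proof. by rewrite ev_ev eqxx. Qed.

Lemma ev_ar v a : ev v * ar a = if v == tgt a then ar a else 0.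
Proof. by rewrite ev_pi. Qed.

Lemma ar_ev v a : ar a * ev v = if v == src a then ar a else 0.
Proof. by rewrite pi_ev. Qed.

(** The element y for which [ar a * y] is the part of x carried by the paths whose last arrow is
    a. *)
Definition left_quotient a x : L :=
  \sum_(p <- nzpaths) scal (if path_mul (arrow_path a) p is Some r then cf r x else 0) * pi p.

Local Notation lquo := left_quotient.

Lemma cf_lquo a x p r : path_mul (arrow_path a) p = Some r -> nz r ->
  cf p (lquo a x) = cf r x.
Proof. by move=> e nr; rewrite cf_sum_pi (nz_mul e nr).2 e. Qed.

Lemma cf_lquo_neq0 a x p : cf p (lquo a x) != 0 ->
  exists2 r, path_mul (arrow_path a) p = Some r & cf r x != 0.
Proof.
rewrite cf_sum_pi; case: ifP => [_|]; rewrite ?eqxx //.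
by case: path_mul => [r|]; rewrite ?eqxx // => ne; exists r.
Qed.

Lemma lquo_expand x :
  x = \sum_v scal (cf (vertex_path v) x) * ev v + \sum_a ar a * lquo a x.
Proof.
apply: cf_ext => r nr; rewrite cfD !cf_sum.
case tr: (path_trivial r).
  have {tr} e := path_trivialP tr; rewrite e in nr *; move: (path_src r) nr => v nr {e r}.
  rewrite [X in _ = _ + X]big1 => [|a _]; last first.
    apply/eqP/contraT => /cf_piM_neq0[p /path_mul_arrows].
    by rewrite /path_arrows /= => /(congr1 size); rewrite size_cat addn1.
  rewrite addr0 (bigD1 v) //= cf_scal cf_pi nr eqxx mulr1 big1 ?addr0 // => w ne.
  rewrite cf_scal cf_pi; case: (eqVneq (vertex_path w) (vertex_path v)) => [e|_].
    by move: ne; rewrite (congr1 (@path_src G) e : w = v) eqxx.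
  by rewrite andbF mulr0.
have [a [p e]] := path_lastP (negbT tr).
rewrite big1 ?add0r => [|v _]; last first.
  rewrite cf_scal cf_pi; case: (eqVneq (vertex_path v) r) => [E|_].
    by rewrite -E in tr.
  by rewrite andbF mulr0.
rewrite (bigD1 a) //= (cf_piM _ e nr) (cf_lquo _ e nr) big1 ?addr0 // => b ne.
apply/eqP/contraT => /cf_piM_neq0[q e' _].
have := path_mul_arrows e; rewrite (path_mul_arrows e') /path_arrows /= !cats1.
by move/rcons_inj => [_ eab]; rewrite eab eqxx in ne.
Qed.

End PathBasis.

(** * Bases modulo a subspace, the radical of a module, Nakayama's lemma *)

Section Modules.
Variables (K : fieldType) (G : quiver) (L : pzRingType) (B : path_basis K G L).
Implicit Types (p q r u w : qpath G) (c d : K) (a b : arrow G) (v : vertex G).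
Local Notation scal := (pb_scal B).
Local Notation pi := (pb_pi B).
Local Notation cf := (pb_cf B).
Local Notation nzpaths := (pb_paths B).
Local Notation ev := (vertex_unit B).
Local Notation ar := (arrow_elt B).
Implicit Types (M : lmodType L).

Lemma act_expand M (l : L) (m : M) :
  l *: m = \sum_(p <- nzpaths) scal (cf p l) *: (pi p *: m).
Proof.
rewrite {1}(cf_expand B l) scaler_suml.
by apply: eq_bigr => p _; rewrite scalerA.
Qed.

Lemma scal_act M c (l : L) (m : M) : l *: (scal c *: m) = scal c *: (l *: m).
Proof. by rewrite !scalerA scalC. Qed.

Lemma sum_ev_act M (m : M) : m = \sum_v ev v *: m.
Proof. by rewrite -scaler_suml sum_ev scale1r. Qed.

Definition path_bound : nat := (\max_(p <- nzpaths) size (path_arrows p)).+1.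

Lemma nz_bound p : nonzero_path B p -> (size (path_arrows p) < path_bound)%N.
Proof. by move=> np; rewrite ltnS; apply: leq_bigmax_seq. Qed.

Definition ksubspace M (Z : M -> Prop) : Prop :=
  Z 0 /\ forall c x y, Z x -> Z y -> Z (scal c *: x + y).

Section Subspaces.
Variables (M : lmodType L) (Z : M -> Prop) (hZ : ksubspace Z).

Lemma ksub0 : Z 0. Proof. exact: hZ.1. Qed.
Lemma ksubD x y : Z x -> Z y -> Z (x + y).
Proof. by move=> Zx Zy; rewrite -[x]scale1r -(scal1 B); apply: hZ.2. Qed.
Lemma ksubZ c x : Z x -> Z (scal c *: x).
Proof. by move=> Zx; rewrite -[_ *: _]addr0; apply: hZ.2 => //; apply: ksub0. Qed.
Lemma ksubN x : Z x -> Z (- x).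
Proof. by move=> Zx; rewrite -scaleN1r -(scal1 B) -scalN; apply: ksubZ. Qed.
Lemma ksubB x y : Z x -> Z y -> Z (x - y).
Proof. by move=> Zx Zy; apply: ksubD => //; apply: ksubN. Qed.
Lemma ksub_sum (J : eqType) (s : seq J) (F : J -> M) :
  (forall i, i \in s -> Z (F i)) -> Z (\sum_(i <- s) F i).
Proof.
elim: s => [|i s IH] h; first by rewrite big_nil; apply: ksub0.
rewrite big_cons; apply: ksubD; first by apply: h; rewrite mem_head.
by apply: IH => j js; apply: h; rewrite inE js orbT.
Qed.
End Subspaces.

(** S is a maximal subset of Y independent modulo Z, obtained from Zorn's lemma because M may have
    infinite dimension. *)
Lemma basis_mod M (Y Z : M -> Prop) : ksubspace Z ->
  exists S : M -> Prop,
  [/\ forall x, S x -> Y x,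
      forall (s : seq M) (k : M -> K), uniq s -> (forall x, x \in s -> S x) ->
        Z (\sum_(x <- s) scal (k x) *: x) -> forall x, x \in s -> k x = 0
    & forall y, Y y -> exists (s : seq M) (k : M -> K),
        [/\ uniq s, forall x, x \in s -> S x
          & Z (y - \sum_(x <- s) scal (k x) *: x)]].
Proof.
move=> hZ.
pose P (S : set M) := (S `<=` Y)%classic /\
  forall (s : seq M) (k : M -> K), uniq s -> (forall x, x \in s -> S x) ->
    Z (\sum_(x <- s) scal (k x) *: x) -> forall x, x \in s -> k x = 0.
have [F FP tot|S [[SY Sind] Smax]] := @Zorn_bigcup M P.
  split=> [x [A FA Ax]|s k us sF Zs]; first exact: (FP A FA).1.
  case: (pselect (exists A, F A)) => [[A0 FA0]|noF]; last first.
    move=> x /sF[A FA _]; by case: noF; exists A.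
  (* A finite subset of the union of a chain lies in one member of the chain. *)
  have [A [FA sA]] : exists A, F A /\ forall x, x \in s -> A x.
    move: sF; rewrite {us Zs}; elim: s => [|y s IH] sF; first by exists A0.
    have [|A [FA sA]] := IH; first by move=> x xs; apply: sF; rewrite inE xs orbT.
    have [A' FA' A'y] := sF y (mem_head _ _).
    have [AA'|A'A] := tot A A' FA FA'; [exists A' | exists A]; split=> // x;
      rewrite inE => /orP[/eqP->|xs] //; first by apply/AA'/sA.
      exact: A'A.
    exact: sA.
  exact: (FP A FA).2 Zs.
exists S; split=> // y Yy; case: (pselect (S y)) => [Sy|nSy].
  exists [:: y], (fun=> 1); split=> [//|x|]; first by rewrite inE => /eqP->.
  by rewrite big_seq1 scal1 scale1r subrr; apply: ksub0.
case: (pselect (exists (s : seq M) (k : M -> K), [/\ uniq s, forall x, x \in s -> S x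
          & Z (y - \sum_(x <- s) scal (k x) *: x)])) => // nsp.
have /Smax[] : (S `<` (fun x => S x \/ x = y))%classic.
  split; first by move=> x Sx; left.
  by move=> /(_ y (or_intror erefl)).
split=> [x [/SY|->]//|s k us sS Zs].
have restS x : x \in rem y s -> S x.
  by rewrite mem_rem_uniq // inE => /andP[/eqP ne /sS[]].
case: (boolP (y \in s)) => ys; last first.
  apply: Sind => // x xs; case: (sS x xs) => // xy.
  by rewrite xy (negbTE ys) in xs.
have e := Zs; rewrite (big_rem y) //= in e.
case: (eqVneq (k y) 0) => [ky0|ky].
  rewrite ky0 scal0 scale0r add0r in e.
  move=> x xs; case: (eqVneq x y) => [xy|ne]; first by rewrite xy.
  by apply: (Sind _ _ (rem_uniq y us) restS e); rewrite mem_rem_uniq // inE ne.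
(* A relation in which y has a nonzero coefficient can be solved for y, which was assumed not to be
   spanned. *)
case: nsp; exists (rem y s), (fun x => - (k x / k y)); split=> //.
  exact: rem_uniq.
have := ksubZ hZ (k y)^-1 e; rewrite scalerDr scalerA -scalM mulVf // scal1 scale1r.
rewrite scaler_sumr -sumrN; congr (Z (_ + _)); apply: eq_bigr => x _.
by rewrite scalN scaleNr opprK scalerA -scalM mulrC.
Qed.

(** This is JM, since J is the sum of the right ideals generated by the arrows. *)
Definition jrad M (x : M) : Prop := exists w : arrow G -> M, x = \sum_a ar a *: w a.

Lemma jrad_ksub M : ksubspace (@jrad M).
Proof.
split; first by exists (fun=> 0); rewrite big1 // => a _; rewrite scaler0.
move=> c x y [w ->] [w' ->]; exists (fun a => scal c *: w a + w' a).
rewrite scaler_sumr -big_split; apply: eq_bigr => a _ /=.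
by rewrite scalerDr scal_act.
Qed.

(** Substituting the decomposition into itself moves the error term behind longer and longer paths,
    which are zero from length [path_bound] on. *)
Lemma nakayama M (U : submodClosed M) :
  (forall x : M, exists z y : M, [/\ z \in U, jrad y & x = z + y]) -> forall x, x \in U.
Proof.
move=> h; suff H k p m : (path_bound <= size (path_arrows p) + k)%N -> pi p *: m \in U.
  move=> x; rewrite (sum_ev_act x); apply: rpred_sum => v _.
  by apply: (H path_bound); rewrite addnC leq_addr.
elim: k p m => [|k IH] p m le.
  have -> : pi p = 0.
    apply/eqP; rewrite pi_eq0; apply/negP => /nz_bound; rewrite ltnNge.
    by rewrite -[X in (_ <= X)%N]addn0 le.
  by rewrite scale0r rpred0.
have [u [y [Uu [w ->] ->]]] := h m.
rewrite scalerDr; apply: rpredD; first exact: rpredZ.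
rewrite scaler_sumr; apply: rpred_sum => a _.
rewrite scalerA /arrow_elt piM; case e: path_mul => [r|]; last by rewrite scale0r rpred0.
by apply: IH; rewrite (path_mul_arrows e) size_cat addSnnS.
Qed.

End Modules.

Lemma seq_argmax (T : eqType) (s : seq T) (P : pred T) (f : T -> nat) x0 :
  x0 \in s -> P x0 ->
  exists x, [/\ x \in s, P x & forall y, y \in s -> P y -> (f y <= f x)%N].
Proof.
elim: s x0 => [|z s IH] x0 //; rewrite inE => xs Px.
case: (pselect (exists2 y, y \in s & P y)) => [[y ys Py]|no].
  have [x [xs' Px' xm]] := IH y ys Py.
  case: (boolP (P z && (f x < f z)%N)) => [/andP[Pz lt]|].
    exists z; split; rewrite ?mem_head // => t; rewrite inE => /orP[/eqP->//|ts Pt].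
    exact: leq_trans (xm t ts Pt) (ltnW lt).
  rewrite negb_and -leqNgt => h; exists x; split; rewrite ?inE ?xs' ?orbT // => t.
  rewrite inE => /orP[/eqP->|ts] Pt; last exact: xm.
  by move: h; rewrite Pt.
have xz : x0 = z by case/orP: xs => [/eqP//|xs]; case: no; exists x0.
exists z; split; rewrite ?mem_head -?xz // => t; rewrite inE => /orP[/eqP->|ts Pt].
  by rewrite xz.
by case: no; exists t.
Qed.

(** * Decomposition into string modules *)

Section Adapted.
Variables (K : fieldType) (G : quiver) (L : pzRingType) (B : path_basis K G L).
Local Notation scal := (pb_scal B).
Variables (M : lmodType L) (W : M -> Prop).
Hypothesis hW : ksubspace B W.
Implicit Types (F H : nat -> M -> Prop) (x y z : M).

Let mono F := forall i x, F i x -> F i.+1 x.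

Let mono_le F i j x : mono F -> (i <= j)%N -> F i x -> F j x.
Proof. by move=> mF /subnK <-; elim: (j - i)%N => //= n IH /IH; apply: mF. Qed.

Let lift F H := forall i j f h, F i f -> H j h -> W (f - h) ->
  exists g, [/\ F i g, H j g & W (f - g)].

Let indep F H (T : nat -> nat -> M -> Prop) := forall i j (s : seq M) (k : M -> K) f h w,
  uniq s -> (forall x, x \in s -> T i j x) ->
  F i f -> H j.+1 f -> F i.+1 h -> H j h -> W w ->
  \sum_(x <- s) scal (k x) *: x = f + h + w -> forall x, x \in s -> k x = 0.

(** Suppose some x with nonzero coefficient is not in F i. Among the terms with nonzero coefficient
    take those of largest first index i', and among these those of largest second index j'. Then i
    <= i', and [lift] writes their sum A as an element of F i' and H (j'+1), plus one of F (i'+1)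
    and H j', plus one of W, against the independence of [T i' j']. *)
Let adapted_core F H (T : nat -> nat -> M -> Prop) :
  (forall i, ksubspace B (F i)) -> (forall i, ksubspace B (H i)) ->
  mono F -> mono H -> lift F H ->
  (forall i j x, T i j x -> F i.+1 x /\ H j.+1 x) -> indep F H T ->
  forall i (s : seq M) (k : M -> K) z, uniq s ->
    (forall x, x \in s -> exists a b, T a b x) -> W z ->
    F i (\sum_(x <- s) scal (k x) *: x + z) ->
    forall x, x \in s -> k x != 0 -> F i x.
Proof.
move=> hF hH mF mH lFH TFH iT i s k z us sT Wz Fi x xs kx.
apply: contrapT => nFx.
pose idx y := xget (0%N, 0%N) [set ab | T ab.1 ab.2 y].
have idxP y : y \in s -> T (idx y).1 (idx y).2 y.
  by move=> /sT[a [b Tab]]; apply: (xgetPex (0%N, 0%N) (P := [set ab | T ab.1 ab.2 y]));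
     exists (a, b).
have [x1 [x1s kx1 x1m]] := @seq_argmax _ s (fun y => k y != 0) (fun y => (idx y).1) x xs kx.
set i' := (idx x1).1 in x1m.
have le_ii' : (i <= i')%N.
  rewrite leqNgt; apply/negP => lt; apply: nFx.
  apply: (mono_le mF (leq_ltn_trans (x1m x xs kx) lt)).
  exact: (TFH _ _ _ (idxP x xs)).1.
have [x2 [x2s /andP[kx2 /eqP x2i] x2m]] :=
  @seq_argmax _ s (fun y => (k y != 0) && ((idx y).1 == i')) (fun y => (idx y).2) x1 x1s
    (introT andP (conj kx1 (eqxx _))).
set j' := (idx x2).2 in x2m.
pose A := \sum_(y <- s | ((idx y).1 == i') && ((idx y).2 == j')) scal (k y) *: y.
pose R2 := \sum_(y <- s | ((idx y).1 == i') && ((idx y).2 != j')) scal (k y) *: y.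
pose R1 := \sum_(y <- s | (idx y).1 != i') scal (k y) *: y.
have tot : \sum_(y <- s) scal (k y) *: y = A + R2 + R1.
  by rewrite (bigID (fun y => (idx y).1 == i')) /= (bigID (fun y => (idx y).2 == j')).
have R1F : F i' R1.
  rewrite /R1 -big_filter; apply: (ksub_sum (hF i')) => y.
  rewrite mem_filter => /andP[ne ys].
  case: (eqVneq (k y) 0) => [->|ky]; first by rewrite scal0 scale0r; apply: (ksub0 (hF i')).
  apply: (ksubZ (hF i')); apply: (mono_le mF (i := (idx y).1.+1)).
    by rewrite ltn_neqAle ne x1m.
  exact: (TFH _ _ _ (idxP y ys)).1.
have R2FH : F i'.+1 R2 /\ H j' R2.
  rewrite /R2 -big_filter; split; [apply: (ksub_sum (hF i'.+1))|apply: (ksub_sum (hH j'))] => y;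
    rewrite mem_filter => /andP[/andP[/eqP yi yj] ys].
    by apply: (ksubZ (hF _)); rewrite -yi; apply: (TFH _ _ _ (idxP y ys)).1.
  case: (eqVneq (k y) 0) => [->|ky]; first by rewrite scal0 scale0r; apply: (ksub0 (hH j')).
  apply: (ksubZ (hH j')); apply: (mono_le mH (i := (idx y).2.+1)).
    by rewrite ltn_neqAle yj x2m // ky yi eqxx.
  exact: (TFH _ _ _ (idxP y ys)).2.
have AH : H j'.+1 (A + R2).
  apply: (ksubD (hH _)); last exact: mH R2FH.2.
  rewrite /A -big_filter; apply: (ksub_sum (hH _)) => y.
  rewrite mem_filter => /andP[/andP[_ /eqP <-] ys].
  by apply: (ksubZ (hH _)); apply: (TFH _ _ _ (idxP y ys)).2.
pose f := \sum_(y <- s) scal (k y) *: y + z - R1.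
have fF : F i' f by apply: (ksubB (hF i')) => //; apply: mono_le mF le_ii' Fi.
have fE : f - (A + R2) = z.
  by rewrite /f tot [_ + R1 + z]addrAC addrK [X in X - _]addrC addrK.
have [|g [Fg Hg Wg]] := lFH _ _ _ _ fF AH; first by rewrite fE.
have eA : A = g + (- R2) + (f - g - z).
  have -> : f = A + R2 + z by rewrite addrC -fE subrK.
  by rewrite [_ - g - z]addrAC addrK [RHS]addrC addrA subrK addrK.
have := @iT i' j' [seq y <- s | ((idx y).1 == i') && ((idx y).2 == j')] k g (- R2) (f - g - z).
rewrite big_filter => /(_ (filter_uniq _ us)) H1.
have kx0 : k x2 = 0.
  apply: H1 => //.
  - by move=> y; rewrite mem_filter => /andP[/andP[/eqP <- /eqP <-]]; apply: idxP.
  - exact: (ksubN (hF _)) R2FH.1.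
  - exact: (ksubN (hH _)) R2FH.2.
  - exact: (ksubB hW).
  - by rewrite mem_filter x2i !eqxx x2s.
by rewrite kx0 eqxx in kx2.
Qed.

(* Modulo [W], the two filtrations behave like two chains of subspaces, which
   always have a common adapted basis; [lift] lets one choose representatives
   respecting both filtrations at once. *)
Lemma adapted_basis F H :
  (forall i, ksubspace B (F i)) -> (forall i, ksubspace B (H i)) ->
  (forall i x, F i x -> F i.+1 x) -> (forall i x, H i x -> H i.+1 x) ->
  (forall x, F 0%N x -> W x) -> (forall x, H 0%N x -> W x) ->
  (forall i j f h, F i f -> H j h -> W (f - h) ->
    exists g, [/\ F i g, H j g & W (f - g)]) ->
  exists S : M -> Prop,
  [/\ forall x, S x -> ~ W x /\ exists i j, F i x /\ H j x,
      forall (s : seq M) (k : M -> K) z i, uniq s -> (forall x, x \in s -> S x) -> W z ->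
        F i (\sum_(x <- s) scal (k x) *: x + z) -> forall x, x \in s -> k x != 0 -> F i x,
      forall (s : seq M) (k : M -> K) z i, uniq s -> (forall x, x \in s -> S x) -> W z ->
        H i (\sum_(x <- s) scal (k x) *: x + z) -> forall x, x \in s -> k x != 0 -> H i x
    & forall i j y, F i y -> H j y -> exists l : seq (K * M),
        (forall p, p \in l -> S p.2) /\ W (y - \sum_(p <- l) scal p.1 *: p.2)].
Proof.
move=> hF hH mF mH F0 H0 lFH.
(* [T i j] will be a basis of the intersection of F (i+1) and H (j+1) modulo the two smaller
   intersections and W. Indices are shifted by one because F 0 and H 0 lie in W and need no basis
   elements. *)
pose Z i j x := exists f h w, [/\ F i f, H j.+1 f, F i.+1 h, H j h & W w /\ x = f + h + w].
have hZ i j : ksubspace B (Z i j).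
  split.
    exists 0, 0, 0; rewrite !addr0; split=> //; try exact: ksub0 (hF _); try exact: ksub0 (hH _).
    by split=> //; apply: (ksub0 hW).
  move=> c _ _ [f [h [w [Ff Hf Fh Hh [Ww ->]]]]] [f' [h' [w' [Ff' Hf' Fh' Hh' [Ww' ->]]]]].
  exists (scal c *: f + f'), (scal c *: h + h'), (scal c *: w + w').
  split; try exact: (hF _).2; try exact: (hH _).2; split; first exact: hW.2.
  by rewrite !scalerDr addrACA; congr (_ + _); rewrite addrACA.
pose T i j := sval (cid (@basis_mod _ _ _ B M (fun x => F i.+1 x /\ H j.+1 x) _ (hZ i j))).
have TP i j := svalP (cid (@basis_mod _ _ _ B M (fun x => F i.+1 x /\ H j.+1 x) _ (hZ i j))).
have TFH i j x : T i j x -> F i.+1 x /\ H j.+1 x by have [+ _ _] := TP i j; apply.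
have iT : indep F H T.
  move=> i j s k f h w us sT Ff Hf Fh Hh Ww e.
  have [_ + _] := TP i j; apply=> //.
  by exists f, h, w.
exists (fun x => exists i j, T i j x); split.
- move=> x [i [j Tx]]; split; last by have [Fx Hx] := TFH _ _ _ Tx; exists i.+1, j.+1.
  move=> Wx; have [_ /(_ [:: x] (fun=> 1)) h _] := TP i j.
  have /eqP : (1 : K) = 0; last by rewrite oner_eq0.
  apply: h (mem_head _ _) => //; first by move=> y; rewrite inE => /eqP->.
  rewrite big_seq1 scal1 scale1r; exists 0, 0, x; rewrite !add0r.
  by split=> //; try exact: (ksub0 (hF _)); exact: (ksub0 (hH _)).
- move=> s k z i us sS Wz; exact: (adapted_core hF hH mF mH lFH TFH iT us sS Wz).
- move=> s k z i us sS Wz.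
  (* The situation is symmetric in F and H once T is transposed. *)
  apply: (@adapted_core H F (fun i j => T j i) hH hF mH mF _ _ _ i s k z us _ Wz).
  + move=> i1 j1 f h Hf Fh Wfh.
    have [|g [Fg Hg Wg]] := lFH _ _ _ _ Fh Hf.
      by rewrite -opprB; apply: (ksubN hW).
    exists g; split=> //; rewrite -[f](subrK h) -addrA.
    exact: (ksubD hW).
  + by move=> i1 j1 x /TFH[].
  + move=> i1 j1 s1 k1 f h w us1 sT1 Hf Ff Hh Fh Ww e.
    by apply: (iT j1 i1 s1 k1 h f w) => //; rewrite e [h + f]addrC.
  + by move=> x /sS[a [b Tab]]; exists b, a.
(* Reducing y modulo [T i j] leaves two corrections, each in an intersection whose indices have a
   sum smaller by one. *)
suff H1 n i j y : (i + j <= n)%N -> F i y -> H j y -> exists l : seq (K * M),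
    (forall p, p \in l -> exists i j, T i j p.2) /\ W (y - \sum_(p <- l) scal p.1 *: p.2).
  by move=> i j y; apply: (H1 (i + j)%N).
have base t : W t -> exists l : seq (K * M),
    (forall p, p \in l -> exists i j, T i j p.2) /\ W (t - \sum_(p <- l) scal p.1 *: p.2).
  by move=> Wt; exists [::]; rewrite big_nil subr0.
elim: n i j y => [|n IH] [|i] [|j] y le Fy Hy //;
  try (by apply/base/F0); try by apply/base/H0.
have [_ _ /(_ y (conj Fy Hy)) [s [k [us sT [f [h [w [Ff Hf Fh Hh [Ww e]]]]]]]]] := TP i j.
have [|lf [lfS lfW]] := IH i j.+1 f _ Ff Hf; first by rewrite -ltnS -addSn.
have [|lh [lhS lhW]] := IH i.+1 j h _ Fh Hh; first by rewrite -ltnS -addnS.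
exists ([seq (k x, x) | x <- s] ++ lf ++ lh); split.
  move=> p; rewrite !mem_cat => /or3P[/mapP[x xs ->]|/lfS//|/lhS//].
  by exists i, j; apply: sT.
rewrite big_cat big_map /= big_cat /= opprD addrA e.
set Sf := \sum_(p <- lf) _; set Sh := \sum_(p <- lh) _.
have -> : f + h + w - (Sf + Sh) = (f - Sf) + (h - Sh) + w.
  by rewrite opprD addrAC; congr (_ + _); rewrite addrACA.
by apply: (ksubD hW) => //; apply: (ksubD hW).
Qed.

End Adapted.

(** * The two chains of kernels at a vertex *)

Section StringRing.
Variables (K : fieldType) (G : quiver) (L : pzRingType) (B : path_basis K G L).
Local Notation scal := (pb_scal B).
Local Notation pi := (pb_pi B).
Local Notation ev := (vertex_unit B).
Local Notation ar := (arrow_elt B).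
Local Notation jrad := (jrad B).
Implicit Types (p q r : qpath G) (c d : K) (a b : arrow G) (v : vertex G).
Hypothesis out_le2 : forall v, (#|[pred a : arrow G | src a == v]| <= 2)%N.
Hypothesis next_uniq : forall a b b', ar b * ar a != 0 -> ar b' * ar a != 0 -> b = b'.

(** After a given arrow at most one arrow yields a nonzero product, so multiplication by the sum of
    all arrows prolongs a nontrivial path by the only possible arrow. The products [sg ^+ j * ar b]
    thus run through the paths beginning with b without naming their arrows. *)
Definition arsum : L := \sum_a ar a.
Local Notation sg := arsum.

Lemma arsum_ar a b : ar b * ar a != 0 -> sg * ar a = ar b * ar a.
Proof.
move=> ne; rewrite mulr_suml (bigD1 b) //= big1 ?addr0 // => b' ne'.
by apply/eqP; apply: contraNT ne' => /(next_uniq ne) ->.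
Qed.

Lemma arsum_nil j p : (path_bound B <= j + size (path_arrows p))%N -> sg ^+ j * pi p = 0.
Proof.
elim: j p => [|j IH] p le.
  rewrite mul1r; apply/eqP; rewrite pi_eq0; apply: contraTN le => /nz_bound.
  by rewrite -ltnNge.
rewrite exprSr -mulrA mulr_suml mulr_sumr big1 // => a _.
rewrite /arrow_elt piM; case e: path_mul => [r|]; last by rewrite mulr0.
by apply: IH; rewrite (path_mul_arrows e) size_cat addn1 -addSnnS.
Qed.

Lemma out_arrows v : exists o1 o2 : option (arrow G),
  (forall a, src a = v <-> Some a = o1 \/ Some a = o2) /\
  (forall a b, o1 = Some a -> o2 = Some b -> a <> b).
Proof.
have := out_le2 v; rewrite cardE; set e := enum _ => se.
have ue : uniq e by apply: enum_uniq.
have me a : (a \in e) = (src a == v) by rewrite mem_enum.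
case: e ue se me => [|a [|b [|? ?]]] //= ue _ me.
- exists None, None; split=> // a; split=> [/eqP|[]//].
  by rewrite -me.
- exists (Some a), None; split=> // a'; split=> [/eqP|[[->]|//]].
    by rewrite -me inE => /eqP ->; left.
  by apply/eqP; rewrite -me inE.
- exists (Some a), (Some b); split=> [a'|a' b' [<-] [<-] ab].
    split=> [/eqP|h].
      by rewrite -me !inE => /orP[/eqP->|/eqP->]; [left|right].
    by apply/eqP; rewrite -me !inE; case: h => -[->]; rewrite eqxx ?orbT.
  by move: ue; rewrite inE ab eqxx.
Qed.

Section Module.
Variable X : lmodType L.

Lemma jrad_ev v (x : X) : jrad x -> jrad (ev v *: x).
Proof.
case=> w ->; exists (fun a => if v == tgt a then w a else 0).
rewrite scaler_sumr; apply: eq_bigr => a _; rewrite scalerA ev_ar.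
by case: ifP => _; rewrite ?scale0r ?scaler0.
Qed.

Let th (o : option (arrow G)) : L := if o is Some a then ar a else 0.

Let chain v (o : option (arrow G)) (i : nat) (x : X) : Prop :=
  if i is j.+1 then ev v *: x = x /\ (sg ^+ j * th o) *: x = 0 else x = 0.

Let chain_ksub v o i : ksubspace B (chain v o i).
Proof.
case: i => [|i]; first by split=> // c x y -> ->; rewrite scaler0 addr0.
split=> [|c x y [Vx x0] [Vy y0]]; first by split; rewrite scaler0.
by split; rewrite scalerDr scal_act ?Vx ?Vy ?x0 ?y0 // scaler0 addr0.
Qed.

Let chain_mono v o i x : chain v o i x -> chain v o i.+1 x.
Proof.
case: i => [->|i [Vx x0]] /=; first by rewrite !scaler0.
by split=> //; rewrite exprS -mulrA -scalerA x0 scaler0.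
Qed.

Let chain_kill v o i x : ev v *: x = x -> th o *: x = 0 -> chain v o i.+1 x.
Proof. by move=> Vx x0; split=> //; rewrite -scalerA x0 scaler0. Qed.

Let chain_lift v o1 o2 : (forall a b, o1 = Some a -> o2 = Some b -> a <> b) ->
  forall i j f h, chain v o1 i f -> chain v o2 j h -> jrad (f - h) ->
  exists g, [/\ chain v o1 i g, chain v o2 j g & jrad (f - g)].
Proof.
move=> ne [|i] j f h.
  by move=> -> Hh _; exists 0; rewrite subr0; split=> //; [exact: ksub0 (chain_ksub _ _ _)
    | exact: ksub0 (jrad_ksub B X)].
case: j => [|j] Ff.
  move=> ->; rewrite subr0 => Jf; exists 0; rewrite subr0; split=> //.
  exact: ksub0 (chain_ksub v o1 i.+1).
move=> Hh [w e].
(* An arrow a that is not killed by the first outgoing arrow is killed by the second. Hence f - h =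
   z1 + z2 with z1 invisible to the first chain and z2 to the second, and g = f - z1 = h + z2 lies
   in both. *)
pose C a := (th o1 * ar a == 0).
pose z1 := ev v *: \sum_(a | C a) ar a *: w a.
pose z2 := ev v *: \sum_(a | ~~ C a) ar a *: w a.
have Vz1 : ev v *: z1 = z1 by rewrite scalerA ev_idem.
have Vz2 : ev v *: z2 = z2 by rewrite scalerA ev_idem.
have fh : f = h + z2 + z1.
  have : ev v *: (f - h) = f - h by rewrite scalerBr Ff.1 Hh.1.
  rewrite {1}e (bigID C) /= scalerDr -/z1 -/z2 => E.
  by rewrite -addrA [z2 + z1]addrC E addrC subrK.
have thev o : (o = o1 \/ o = o2) -> th o * ev v = th o \/ th o * ev v = 0.
  by case: o => [a|] _ /=; rewrite ?mul0r ?ar_ev; [case: ifP => _; [left|right] | left].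
have k1 : th o1 *: z1 = 0.
  rewrite scalerA; have [->|->] := thev o1 (or_introl erefl); last by rewrite scale0r.
  rewrite scaler_sumr big1 // => a /eqP Ca; by rewrite scalerA Ca scale0r.
have k2 : th o2 *: z2 = 0.
  rewrite scalerA; have [->|->] := thev o2 (or_intror erefl); last by rewrite scale0r.
  rewrite scaler_sumr big1 // => a nC; rewrite scalerA.
  case: (eqVneq (th o2 * ar a) 0) => [->|n2]; first by rewrite scale0r.
  move: nC n2; rewrite /C; case e1: o1 => [a1|]; case e2: o2 => [a2|] /=;
    rewrite ?mul0r ?eqxx // => n1 n2.
  by case: (ne a1 a2 e1 e2); apply: (next_uniq n1 n2).
exists (f - z1); split.
- exact: (ksubB (chain_ksub v o1 i.+1)) Ff (chain_kill i Vz1 k1).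
- rewrite fh addrK; exact: (ksubD (chain_ksub v o2 j.+1)) Hh (chain_kill j Vz2 k2).
- rewrite opprB addrC subrK; apply: jrad_ev.
  exists (fun a => if C a then w a else 0); rewrite big_mkcond; apply: eq_bigr => a _.
  by case: ifP => _; rewrite ?scaler0.
Qed.

(** [adapted_basis] for the two chains modulo JX. The third clause is what adaptation buys: a path
    that kills a combination, up to a radical term, kills each generator occurring in it. *)
Lemma adapted_vertex v : exists S : X -> Prop,
  [/\ forall x, S x -> ev v *: x = x,
      forall (s : seq X) (k : X -> K), uniq s -> (forall x, x \in s -> S x) ->
        jrad (\sum_(x <- s) scal (k x) *: x) -> forall x, x \in s -> k x = 0,
      forall b j (s : seq X) (k : X -> K) z, src b = v -> uniq s ->
        (forall x, x \in s -> S x) -> jrad z ->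
        (sg ^+ j * ar b) *: (\sum_(x <- s) scal (k x) *: x + z) = 0 ->
        forall x, x \in s -> k x != 0 -> (sg ^+ j * ar b) *: x = 0
    & forall y, ev v *: y = y -> exists l : seq (K * X),
        (forall t, t \in l -> S t.2) /\ jrad (y - \sum_(t <- l) scal t.1 *: t.2)].
Proof.
have [o1 [o2 [oE ne]]] := out_arrows v.
have c0 o x : chain v o 0 x -> jrad x by move=> ->; apply: ksub0 (jrad_ksub B X).
have [S [S1 SF SH Ssp]] := adapted_basis (jrad_ksub B X) (chain_ksub v o1)
  (chain_ksub v o2) (@chain_mono v o1) (@chain_mono v o2) (c0 o1) (c0 o2) (chain_lift ne).
have SV x : S x -> ev v *: x = x.
  by move=> /S1[_ [i [j [+ _]]]]; case: i => [->|i []//]; rewrite scaler0.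
exists S; split=> //.
- move=> s k us sS Js x xs; apply/eqP/negPn/negP => kx.
  have := SF s k (- \sum_(x <- s) scal (k x) *: x) 0%N us sS (ksubN (jrad_ksub B X) Js).
  rewrite subrr => /(_ erefl x xs kx) /= x0.
  by have [+ _] := S1 x (sS x xs); apply; rewrite x0; apply: ksub0 (jrad_ksub B X).
- move=> b j s k z sb us sS Jz e x xs kx.
  have bev : ar b * ev v = ar b by rewrite ar_ev sb eqxx.
  (* The chains consist of elements fixed by [ev v], so z is cut down to its part at v; [ar b] does
     not see the difference. *)
  pose y := \sum_(x <- s) scal (k x) *: x + ev v *: z.
  have Vy : ev v *: y = y.
    rewrite scalerDr scalerA ev_idem scaler_sumr; congr (_ + _).
    by rewrite big_seq [RHS]big_seq; apply: eq_bigr => x' /sS /SV Vx; rewrite scal_act Vx.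
  have y0 : (sg ^+ j * ar b) *: y = 0.
    by rewrite -e !scalerDr [(_ * _) *: (ev v *: z)]scalerA -mulrA bev.
  have [ob|ob] := (oE b).1 sb.
    by have [] := SF s k _ j.+1 us sS (jrad_ev v Jz) _ x xs kx; rewrite /= -ob.
  by have [] := SH s k _ j.+1 us sS (jrad_ev v Jz) _ x xs kx; rewrite /= -ob.
- move=> y Vy.
  (* At this stage both chains fill the whole part at v. *)
  have top o : chain v o (path_bound B).+1 y.
    split=> //; case: o => [a|] /=; last by rewrite mulr0 scale0r.
    by rewrite /arrow_elt arsum_nil ?scale0r // leq_addr.
  exact: Ssp (top o1) (top o2).
Qed.

End Module.

End StringRing.

(** * Independence of the adapted generators over the ring *)

Section Decomposition.
Variables (K : fieldType) (G : quiver) (L : pzRingType) (B : path_basis K G L).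
Local Notation scal := (pb_scal B).
Local Notation pi := (pb_pi B).
Local Notation cf := (pb_cf B).
Local Notation ev := (vertex_unit B).
Local Notation ar := (arrow_elt B).
Local Notation lquo := (left_quotient B).
Local Notation jrad := (jrad B).
Local Notation sg := (arsum B).
Implicit Types (p q r : qpath G) (c d : K) (a b : arrow G) (v : vertex G).
Hypothesis out_le2 : forall v, (#|[pred a : arrow G | src a == v]| <= 2)%N.
Hypothesis next_uniq : forall a b b', ar b * ar a != 0 -> ar b' * ar a != 0 -> b = b'.
Hypothesis prev_uniq : forall a b b', ar a * ar b != 0 -> ar a * ar b' != 0 -> b = b'.
Variable X : lmodType L.
Implicit Types (x y z : X).
Hypothesis arrow_direct : forall w : arrow G -> X,
  \sum_a ar a *: w a = 0 -> forall a, ar a *: w a = 0.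

Let S v : X -> Prop := sval (cid (adapted_vertex out_le2 next_uniq X v)).
Let SP v := svalP (cid (adapted_vertex out_le2 next_uniq X v)).

Let SV v x : S v x -> ev v *: x = x. Proof. by have [+ _ _ _] := SP v; apply. Qed.

Let Sout v x : (exists w, S w x) -> ~ S v x -> ev v *: x = 0.
Proof.
move=> [w Swx] nS; rewrite -(SV Swx) scalerA ev_ev.
by case: eqVneq => [e|]; [case: nS; rewrite e | rewrite scale0r].
Qed.

(** What stands behind the arrow a in the combination of s with coefficients f, as in
    [lquo_expand]. *)
Let yq (f : X -> L) (s : seq X) a : X := \sum_(x <- s) lquo a (f x) *: x.

Let split_vertex (f : X -> L) (s : seq X) v : (forall x, x \in s -> exists w, S w x) ->
  ev v *: (\sum_(x <- s) f x *: x) =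
  \sum_(x <- [seq x <- s | `[< S v x >]]) scal (cf (vertex_path v) (f x)) *: x
  + ev v *: \sum_a ar a *: yq f s a.
Proof.
move=> sS; rewrite big_filter.
have -> : \sum_a ar a *: yq f s a = \sum_(x <- s) \sum_a (ar a * lquo a (f x)) *: x.
  rewrite exchange_big; apply: eq_bigr => a _; rewrite scaler_sumr.
  by apply: eq_bigr => x _; rewrite scalerA.
rewrite !scaler_sumr [in RHS]big_mkcond -big_split big_seq [RHS]big_seq.
apply: eq_bigr => x xs /=.
rewrite -scaler_suml {1}(lquo_expand B (f x)) scalerDl scalerDr; congr (_ + _).
rewrite scaler_suml scaler_sumr (bigD1 v) //= big1 ?addr0 => [|w ne]; last first.
  by rewrite scalerA mulrA -scalC -mulrA ev_ev eq_sym (negbTE ne) mulr0 scale0r.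
rewrite scalerA mulrA -scalC -mulrA ev_idem -scalerA.
by case: asboolP => [/SV->//|nS]; rewrite Sout ?scaler0 //; apply: sS.
Qed.

(* Linear independence is propagated along arrows by induction on the length of
   the paths involved: at the last arrow, [adapted_vertex] separates the
   generators from the part coming from shorter paths. *)
Let chain_separated n (f : X -> L) (s : seq X) b j : uniq s ->
  (forall x, x \in s -> exists w, S w x) ->
  (forall x p, x \in s -> cf p (f x) != 0 -> (size (path_arrows p) < n)%N) ->
  (sg ^+ j * ar b) *: (\sum_(x <- s) f x *: x) = 0 ->
  forall x p, x \in s -> cf p (f x) != 0 -> (sg ^+ j * ar b) *: (pi p *: x) = 0.
Proof.
move=> us sS; elim: n f b j => [|n IH] f b j deg e x p xs fp.
  by have := deg x p xs fp.
set w := src b.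
have bev : ar b * ev w = ar b by rewrite ar_ev eqxx.
have bevX t : (sg ^+ j * ar b) *: (ev w *: t) = (sg ^+ j * ar b) *: t.
  by rewrite scalerA -mulrA bev.
have e' := e; rewrite -bevX split_vertex // in e'.
set s' := [seq x <- s | _] in e'.
have us' : uniq s' by apply: filter_uniq.
have sS' t : t \in s' -> S w t by rewrite mem_filter => /andP[/asboolP].
have Jz : jrad (ev w *: \sum_a ar a *: yq f s a).
  by apply: jrad_ev; exists (yq f s).
have [_ _ Ad _] := SP w.
have k0 := Ad b j s' _ _ erefl us' sS' Jz e'.
have z0 : (sg ^+ j * ar b) *: \sum_a ar a *: yq f s a = 0.
  move: e'; rewrite scalerDr bevX scaler_sumr big1_seq ?add0r // => t /andP[_ ts].
  case: (eqVneq (cf (vertex_path w) (f t)) 0) => [->|k1]; first by rewrite scal0 scale0r scaler0.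
  by rewrite scal_act k0 ?scaler0.
case tp: (path_trivial p).
  have ep := path_trivialP tp; case: (eqVneq w (path_src p)) => [ws|ne]; last first.
    by rewrite scalerA -mulrA ep ar_ev eq_sym (negbTE ne) mulr0 scale0r.
  rewrite ep -ws -/(ev w); rewrite ep -ws in fp.
  case: (pselect (S w x)) => [Sx|nS]; last by rewrite Sout ?scaler0 //; apply: sS.
  by rewrite bevX k0 // mem_filter xs andbT; apply/asboolP.
have [a [p' ap]] := path_lastP (negbT tp).
have pE : pi p = ar a * pi p' by rewrite piM ap.
case: (eqVneq (ar b * ar a) 0) => [ba0|ba].
  by rewrite scalerA pE mulrA -[_ * ar b * ar a]mulrA ba0 mulr0 mul0r scale0r.
(* Since b is the arrow that can follow a, the path beginning with b becomes, behind a, the path one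
   step longer beginning with a. *)
have baE : sg ^+ j * ar b * ar a = sg ^+ j.+1 * ar a.
  by rewrite exprSr -!mulrA (arsum_ar next_uniq ba).
have ya0 : (sg ^+ j.+1 * ar a) *: yq f s a = 0.
  (* Here uniqueness of the preceding arrow enters: no arrow other than a survives below b. *)
  have r0 : (sg ^+ j * ar b) *: \sum_(a' | a' != a) ar a' *: yq f s a' = 0.
    rewrite scaler_sumr; apply: big1 => a' ne.
    rewrite scalerA -mulrA; case: (eqVneq (ar b * ar a') 0) => [->|ba'].
      by rewrite mulr0 scale0r.
    by case/eqP: ne; apply: (prev_uniq ba' ba).
  by move: z0; rewrite (bigD1 a) //= scalerDr r0 addr0 scalerA baE.
have np := cf_nz fp.
have := IH (fun t => lquo a (f t)) a j.+1 _ ya0 x p' xs.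
rewrite (cf_lquo _ ap np) => /(_ _ fp) H.
rewrite pE -[(ar a * _) *: x]scalerA scalerA baE; apply: H => t q ts /cf_lquo_neq0[r er fr].
by have := deg t r ts fr; rewrite (path_mul_arrows er) size_cat addn1.
Qed.

(** Independence is stated path by path: each path occurring in a coefficient kills the
    corresponding generator. For a single generator this says that its annihilator is spanned by
    paths, as [exists_type] requires. *)
Lemma string_decomposition : exists S : X -> Prop,
  [/\ forall x, S x -> x != 0 /\ exists v, ev v *: x = x,
      forall (f : X -> L) (s : seq X), uniq s -> (forall x, x \in s -> S x) ->
        \sum_(x <- s) f x *: x = 0 ->
        forall x p, x \in s -> cf p (f x) != 0 -> pi p *: x = 0
    & forall U : submodClosed X, (forall x, S x -> x \in U) -> forall x, x \in U].
Proof.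
exists (fun x => exists v, S v x); split.
- move=> x [v Sx]; split; last by exists v; apply: SV.
  apply/eqP => x0; have [_ ind _ _] := SP v.
  have /eqP : (1 : K) = 0; last by rewrite oner_eq0.
  apply: (ind [:: x] (fun=> 1) _ _ _ x (mem_head _ _)) => //.
    by move=> y; rewrite inE => /eqP->.
  by rewrite big_seq1 x0 scaler0; apply: ksub0 (jrad_ksub B X).
- move=> f s us sS e x p xs fp.
  have ev0 v : (forall t, t \in s -> S v t -> cf (vertex_path v) (f t) = 0) /\
      ev v *: \sum_a ar a *: yq f s a = 0.
    have := split_vertex f v sS; rewrite e scaler0 => /esym e'.
    set s' := [seq x <- s | _] in e'.
    have us' : uniq s' by apply: filter_uniq.
    have sS' t : t \in s' -> S v t by rewrite mem_filter => /andP[/asboolP].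
    have [_ ind _ _] := SP v.
    have Jz : jrad (ev v *: \sum_a ar a *: yq f s a).
      by apply: jrad_ev; exists (yq f s).
    have k0 t : t \in s' -> cf (vertex_path v) (f t) = 0.
      apply: (ind s' (fun x => cf (vertex_path v) (f x)) us' sS' _ t).
      by move/eqP: e'; rewrite addr_eq0 => /eqP ->; apply: (ksubN (jrad_ksub B X)).
    split=> [t ts St|]; first by apply: k0; rewrite mem_filter ts andbT; apply/asboolP.
    move: e'; rewrite big1_seq ?add0r // => t /andP[_ /k0 ->].
    by rewrite scal0 scale0r.
  case tp: (path_trivial p).
    have ep := path_trivialP tp; set v := path_src p in ep.
    rewrite ep in fp *; case: (pselect (S v x)) => [Sx|nS]; last by apply: Sout nS; apply: sS.
    by rewrite ((ev0 v).1 x xs Sx) eqxx in fp.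
  have [a [p' ap]] := path_lastP (negbT tp).
  have pE : pi p = ar a * pi p' by rewrite piM ap.
  (* The relation is known vertex by vertex, so [arrow_direct] is applied with zero vectors at the
     arrows ending elsewhere. *)
  have ya : ar a *: yq f s a = 0.
    have := (ev0 (tgt a)).2; rewrite scaler_sumr => E.
    have := @arrow_direct (fun a' => if tgt a == tgt a' then yq f s a' else 0).
    have -> : \sum_a' ar a' *: (if tgt a == tgt a' then yq f s a' else 0) = 0.
      apply: etrans E; apply: eq_bigr => a' _; rewrite scalerA ev_ar.
      by case: ifP => _; rewrite ?scale0r ?scaler0.
    by move=> /(_ erefl a); rewrite eqxx.
  have np := cf_nz fp.
  have := @chain_separated (path_bound B) (fun t => lquo a (f t)) s a 0 us sS _ _ x p' xs.
  rewrite !expr0 !mul1r (cf_lquo _ ap np) => H.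
  by rewrite pE -scalerA H // => t q _ /cf_nz /nz_bound.
- move=> U SU; apply: (@nakayama _ _ _ B) => x.
  have HS v : exists l : seq (K * X), (forall t, t \in l -> S v t.2) /\
      jrad (ev v *: x - \sum_(t <- l) scal t.1 *: t.2).
    by have [_ _ _ +] := SP v; apply; rewrite scalerA ev_idem.
  have [l lP] := choice HS.
  exists (\sum_v \sum_(t <- l v) scal t.1 *: t.2).
  exists (\sum_v (ev v *: x - \sum_(t <- l v) scal t.1 *: t.2)); split.
  + apply: rpred_sum => v _; rewrite big_seq; apply: rpred_sum => t tl; apply: rpredZ.
    by apply: SU; exists v; apply: (lP v).1.
  + by apply: (ksub_sum (jrad_ksub B X)) => v _; apply: (lP v).2.
  + by rewrite -big_split {1}(sum_ev_act B x); apply: eq_bigr => v _ /=; rewrite addrC subrK.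
Qed.

End Decomposition.

Section Orbit.
Variables (L : pzRingType).

Lemma orb_linear (M : lmodType L) (x : M) : linear (fun l : L^o => (l : L) *: x).
Proof. by move=> c l l'; rewrite scalerDl scalerA. Qed.
Definition orb (M : lmodType L) (x : M) : {linear L^o -> M} := mklin (orb_linear x).
Lemma orbE (M : lmodType L) (x : M) (l : L) : orb x l = l *: x.
Proof. by []. Qed.

Definition cyc (M : lmodType L) (x : M) : lmodType L := submodule (img (orb x)).

Lemma cyc_gen_subproof (M : lmodType L) (x : M) : x \in img (orb x).
Proof. by apply/in_img; exists 1; rewrite orbE scale1r. Qed.
Definition cyc_gen (M : lmodType L) (x : M) : cyc x := Submodule (cyc_gen_subproof x).

Definition generated (M : lmodType L) (x : M) : Prop := surj (orb x).

Lemma cyc_generated (M : lmodType L) (x : M) : generated (cyc_gen x).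
Proof.
move=> y; have /in_img[l lx] := subvalP y.
by exists l; apply: subval_inj; rewrite -lx.
Qed.

End Orbit.

(** * String types *)

Section Types.
Variables (K : fieldType) (G : quiver) (L : pzRingType) (B : path_basis K G L).
Local Notation pi := (pb_pi B).
Local Notation cf := (pb_cf B).
Local Notation nzpaths := (pb_paths B).
Local Notation nz := (nonzero_path B).
Local Notation ev := (vertex_unit B).
Local Notation ar := (arrow_elt B).
Implicit Types (p q r u w t : qpath G) (c d : K) (a b : arrow G) (v : vertex G) (l : L).
Hypothesis out_le2 : forall v, (#|[pred a : arrow G | src a == v]| <= 2)%N.
Hypothesis next_uniq : forall a b b', ar b * ar a != 0 -> ar b' * ar a != 0 -> b = b'.

Definition initial r p q : bool :=
  prefix (path_arrows r) (path_arrows p) || prefix (path_arrows r) (path_arrows q).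

(** [x] has string type (p, q) if its annihilator is that of the generator of
    [St p q]. *)
Definition has_type (M : lmodType L) p q (x : M) : Prop :=
  ev (path_src p) *: x = x /\
  forall l, l *: x = 0 <->
    forall r, path_src r = path_src p -> initial r p q -> cf r l = 0.

Definition words p q : Prop :=
  [/\ nz p, nz q, path_src p = path_src q
    & match path_arrows p, path_arrows q with
      | a :: _, b :: _ => a != b
      | _, _ => true
      end].

Lemma wordsC p q : words p q -> words q p.
Proof.
case=> np nq e h; split=> //.
by move: h; case: (path_arrows p) => [|a s]; case: (path_arrows q) => [|b s'] //;
  rewrite eq_sym.
Qed.

Lemma initialC r p q : initial r p q = initial r q p.
Proof. exact: orbC. Qed.

Lemma has_typeC (M : lmodType L) p q (x : M) : path_src p = path_src q ->
  has_type p q x -> has_type q p x.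
Proof.
move=> e [ex h]; split=> [|l]; rewrite -e //.
by rewrite h; split=> H r sr ir; apply: H; rewrite // initialC.
Qed.

Lemma has_type_inj (M N : lmodType L) (f : {linear M -> N}) p q x :
  injective f -> has_type p q (f x) <-> has_type p q x.
Proof.
move=> fi; rewrite /has_type -linearZ; split=> -[ex h]; split; try exact: fi; try by rewrite ex.
  by move=> l; rewrite -h -linearZ; split=> [->|/esym]; [rewrite linear0|rewrite -(linear0 f) => /fi].
by move=> l; rewrite -h -linearZ; split=> [/eqP|->]; [rewrite -(linear0 f) => /eqP/fi|rewrite linear0].
Qed.

Lemma nz_initial r p q : path_src p = path_src q -> nz p -> nz q -> path_src r = path_src p ->
  initial r p q -> nz r.
Proof.
move=> e np nq er /orP[] pr.
  by have [w ew] := path_prefixP er pr; have [] := nz_mul ew np.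
by rewrite e in er; have [w ew] := path_prefixP er pr; have [] := nz_mul ew nq.
Qed.

Lemma pi_act_src (M : lmodType L) v (x : M) r : ev v *: x = x -> path_src r != v ->
  pi r *: x = 0.
Proof. by move=> <- ne; rewrite scalerA pi_ev eq_sym (negbTE ne) scale0r. Qed.

Lemma has_type_pi (M : lmodType L) p q (x : M) r : words p q -> has_type p q x ->
  path_src r = path_src p -> (pi r *: x != 0) = initial r p q.
Proof.
move=> [np nq e _] [ex h] sr; apply/idP/idP => [ne|ir].
  apply: contraNT ne => nir; apply/eqP/h => r' sr' ir'; rewrite cf_pi.
  by case: (eqVneq r r') => [E|]; [move: nir; rewrite E ir' | rewrite andbF].
apply/eqP => /h /(_ r sr ir) /eqP; rewrite cf_pi eqxx (nz_initial e np nq sr ir).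
by rewrite oner_eq0.
Qed.

Lemma has_type_intro (M : lmodType L) p q (x : M) : words p q ->
  ev (path_src p) *: x = x ->
  (forall l r, l *: x = 0 -> cf r l != 0 -> pi r *: x = 0) ->
  (forall r, path_src r = path_src p -> (pi r *: x != 0) = initial r p q) ->
  has_type p q x.
Proof.
move=> [np nq e _] ex ind H; split=> // l; split=> [lx r sr ir|h].
  apply/eqP; move: ir; rewrite -H //; apply: contraR => /(ind l r lx) ->.
  by rewrite eqxx.
rewrite (act_expand B) big1 // => r _; case: (eqVneq (path_src r) (path_src p)) => [sr|ne].
  case ir: (initial r p q); first by rewrite h // scal0 scale0r.
  by move/negbT: ir; rewrite -H // negbK => /eqP ->; rewrite scaler0.
by rewrite (pi_act_src ex ne) scaler0.
Qed.

Lemma type_iso (M N : lmodType L) p q (x : M) (y : N) :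
  generated x -> generated y -> has_type p q x -> has_type p q y ->
  exists f : {linear M -> N}, [/\ f x = y, injective f & surj f].
Proof.
move=> gx gy [ex hx] [ey hy].
have [f fE] : {f : {linear M -> N} | forall l, f (orb x l) = orb y l}.
  by apply: lin_factor gx _ => l; rewrite !orbE => /hx /hy.
exists f; split.
- by have := fE 1; rewrite !orbE !scale1r.
- by apply: lin_inj => z; have [l <-] := gx z; rewrite fE !orbE => /hy /hx.
- by move=> z; have [l <-] := gy z; exists (orb x l).
Qed.

Lemma nz_next a b s r : nz r -> path_arrows r = [:: a, b & s] -> ar b * ar a != 0.
Proof.
move=> nr e; have [|a' [r1 e1]] := @path_firstP _ r; first by rewrite /path_trivial e.
have := path_mul_arrows e1; rewrite e /= => -[aa' er1].
have [|b' [r2 e2]] := @path_firstP _ r1; first by rewrite /path_trivial -er1.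
have := path_mul_arrows e2; rewrite -er1 /= => -[bb' _].
have E : pi r = pi r2 * (ar b * ar a) by rewrite mulrA bb' piM e2 aa' piM e1.
by move: nr; rewrite -pi_neq0 E; apply: contraNneq => ->; rewrite mulr0.
Qed.

(** Once its first arrow is fixed, a nonzero path has no choice in how to continue. *)
Lemma nz_chain a s s' r r' : nz r -> nz r' -> path_arrows r = a :: s ->
  path_arrows r' = a :: s' -> (size s <= size s')%N -> prefix (a :: s) (a :: s').
Proof.
rewrite prefix_cons eqxx /=.
elim: s a s' r r' => [|c t IH] a [|c' t'] r r' nr nr' e e' //= le.
have cc' : c = c' by apply: (next_uniq (nz_next nr e) (nz_next nr' e')).
subst c'; rewrite eqxx /=.
have [|a1 [r1 e1]] := @path_firstP _ r; first by rewrite /path_trivial e.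
have [|a2 [r2 e2]] := @path_firstP _ r'; first by rewrite /path_trivial e'.
have := path_mul_arrows e1; rewrite e /= => -[_ er1].
have := path_mul_arrows e2; rewrite e' /= => -[_ er2].
exact: (IH c t' r1 r2 (nz_mul e1 nr).1 (nz_mul e2 nr').1).
Qed.

Lemma nz_chain_total a r r' : nz r -> nz r' -> ohead (path_arrows r) = Some a ->
  ohead (path_arrows r') = Some a ->
  (size (path_arrows r) <= size (path_arrows r'))%N -> prefix (path_arrows r) (path_arrows r').
Proof.
move=> nr nr'; case E: (path_arrows r) => [//|a1 s] [e1].
case E': (path_arrows r') => [//|a2 s'] [e2] le; subst a1 a2.
exact: (nz_chain nr nr' E E').
Qed.

Lemma longest_path (M : lmodType L) v (x : M) (o : option (arrow G)) :
  x != 0 -> ev v *: x = x -> (forall a, o = Some a -> src a = v) ->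
  exists p, [/\ path_src p = v, pi p *: x != 0,
    forall a s, path_arrows p = a :: s -> o = Some a &
    forall a r, o = Some a -> path_src r = v -> ohead (path_arrows r) = Some a ->
      pi r *: x != 0 -> prefix (path_arrows r) (path_arrows p)].
Proof.
move=> x0 ex sa.
case: (pselect (exists a r, [/\ o = Some a, path_src r = v, ohead (path_arrows r) = Some a
   & pi r *: x != 0])) => [[a [r [oa sr hr nr]]]|no]; last first.
  (* No path beginning with o survives on x, and the trivial path takes over. *)
  exists (vertex_path v); split=> //; first by rewrite -/(ev v) ex.
  by move=> a r oa sr hr nr; case: no; exists a, r.
pose P r := [&& path_src r == v, ohead (path_arrows r) == Some a & pi r *: x != 0].
have nzx r' : pi r' *: x != 0 -> nz r'.
  by rewrite -pi_neq0; apply: contraNneq => ->; rewrite scale0r.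
have [|p [pn /and3P[/eqP sp /eqP hp np] pm]] :=
  @seq_argmax _ nzpaths P (fun r => size (path_arrows r)) r (nzx _ nr).
  by rewrite /P sr hr !eqxx nr.
exists p; split=> //.
  by move=> a' s e; rewrite oa -hp e.
move=> a' r'; rewrite oa => -[<-] sr' hr' nr'.
apply: (nz_chain_total (nzx _ nr') pn hr' hp); apply: pm; first exact: nzx.
by rewrite /P sr' hr' nr' !eqxx.
Qed.

(** p and q are the longest paths through one and the other outgoing arrow that do not kill x. They
    determine the annihilator because it is spanned by paths. *)
Lemma exists_type (M : lmodType L) v (x : M) : x != 0 -> ev v *: x = x ->
  (forall l r, l *: x = 0 -> cf r l != 0 -> pi r *: x = 0) ->
  exists p q, words p q /\ has_type p q x.
Proof.
move=> x0 ex ind; have [o1 [o2 [oE ne]]] := out_arrows out_le2 v.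
have [a oa|p [sp np hp mp]] := @longest_path M v x o1 x0 ex; first by apply/oE; left.
have [a oa|q [sq nq hq mq]] := @longest_path M v x o2 x0 ex; first by apply/oE; right.
have nzx r' : pi r' *: x != 0 -> nz r'.
  by rewrite -pi_neq0; apply: contraNneq => ->; rewrite scale0r.
have W : words p q.
  split; rewrite ?sp ?sq //; try exact: nzx.
  case Ep: (path_arrows p) => [//|a s]; case Eq: (path_arrows q) => [//|b s'].
  by apply/eqP/ne; [apply: hp Ep | apply: hq Eq].
exists p, q; split=> //; apply: has_type_intro => //; first by rewrite sp.
move=> r; rewrite sp => sr; apply/idP/idP => [nr|/orP[] pr].
- case Er: (path_arrows r) => [|a s]; first by rewrite /initial Er prefix0s.
  have sa : src a = v.
    have := path_valP r; rewrite -/(path_src r) -/(path_arrows r) sr Er /=.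
    by case/andP => /eqP.
  have [oa|oa] := (oE a).1 sa; apply/orP; [left; apply: mp (esym oa) sr _ nr|right; apply: mq (esym oa) sr _ nr];
    by rewrite Er.
- have [w ew] := path_prefixP (etrans sr (esym sp)) pr.
  apply: contraNneq np => h; have := piM B w r; rewrite ew => <-.
  by rewrite -scalerA h scaler0.
- have [w ew] := path_prefixP (etrans sr (esym sq)) pr.
  apply: contraNneq nq => h; have := piM B w r; rewrite ew => <-.
  by rewrite -scalerA h scaler0.
Qed.

End Types.

(** * Idempotents in the radical and syzygies of strings *)

Section Enlarge.
Variables (K : fieldType) (G : quiver) (L : pzRingType) (B : path_basis K G L).
Local Notation scal := (pb_scal B).
Local Notation pi := (pb_pi B).
Local Notation cf := (pb_cf B).
Local Notation nzpaths := (pb_paths B).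
Local Notation nz := (nonzero_path B).
Local Notation ev := (vertex_unit B).
Local Notation ar := (arrow_elt B).
Local Notation has_type := (has_type B).
Local Notation words := (words B).
Implicit Types (p q r u w t : qpath G) (c d : K) (a b : arrow G) (v : vertex G) (l : L).
Hypothesis next_uniq : forall a b b', ar b * ar a != 0 -> ar b' * ar a != 0 -> b = b'.

Definition radical l : Prop := forall v, cf (vertex_path v) l = 0.

Lemma radicalMl l l' : radical l -> radical (l' * l).
Proof. by move=> h v; rewrite cfM_vertex h mulr0. Qed.

(** A path occurring in l = l * l prolongs, by a nontrivial path, one occurring in l; so lengths of
    occurring paths exceed every bound. *)
Lemma radical_idem l : radical l -> l * l = l -> l = 0.
Proof.
move=> rl ll; suff H n : forall r, cf r l != 0 -> (n <= size (path_arrows r))%N.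
  apply: (cf_ext (B := B)) => r _; rewrite cf0; apply/eqP/negPn/negP => ne.
  by have := H (path_bound B) r ne; rewrite leqNgt nz_bound // (cf_nz ne).
elim: n => // n IH r; rewrite -{1}ll {1}(cf_expand B l) mulr_suml cf_sum => ne.
have [w [nw]] : exists w, cf w l != 0 /\ cf r (pi w * l) != 0.
  apply: contrapT => no; case/negP: ne; apply/eqP; apply: big1 => w _.
  rewrite -mulrA cf_scal; case: (eqVneq (cf w l) 0) => [->|nw]; first by rewrite mul0r.
  case: (eqVneq (cf r (pi w * l)) 0) => [->|nr]; first by rewrite mulr0.
  by case: no; exists w.
case/cf_piM_neq0 => u eu nu; rewrite (path_mul_arrows eu) size_cat.
have [a [w' /path_mul_arrows ->]] : exists a w', path_mul (arrow_path a) w' = Some w.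
  apply: path_lastP; apply: contraNN nw => tw.
  by rewrite (path_trivialP tw) rl.
by rewrite size_cat addn1 addnS ltnS (leq_trans (IH u nu)) // leq_addr.
Qed.

(** The projection onto the paths with first arrow a. On radical elements it commutes with left
    multiplication, since a nontrivial path keeps its first arrow when prolonged; a trivial one
    would take it from the left factor. *)
Definition first_part a l : L := \sum_(r <- nzpaths)
  scal (if ohead (path_arrows r) == Some a then cf r l else 0) * pi r.

Lemma cf_first_part a r l :
  cf r (first_part a l) = if ohead (path_arrows r) == Some a then cf r l else 0.
Proof.
rewrite cf_sum_pi; case: ifP => // nr; rewrite pb_cf_out ?if_same //.
by rewrite -/(nz r) nr.
Qed.

Lemma first_partD a l l' : first_part a (l + l') = first_part a l + first_part a l'.
Proof.
apply: (cf_ext (B := B)) => r _; rewrite cfD !cf_first_part cfD.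
by case: ifP => _; rewrite ?addr0.
Qed.

Lemma first_part0 a : first_part a 0 = 0.
Proof. by apply: (cf_ext (B := B)) => r _; rewrite cf_first_part !cf0 if_same. Qed.

Lemma first_part_scal a c l : first_part a (scal c * l) = scal c * first_part a l.
Proof.
apply: (cf_ext (B := B)) => r _; rewrite cf_scal !cf_first_part cf_scal.
by case: ifP => _; rewrite ?mulr0.
Qed.

Lemma first_part_pi a w l : radical l -> first_part a (pi w * l) = pi w * first_part a l.
Proof.
move=> rl; apply: (cf_ext (B := B)) => r nr; rewrite cf_first_part.
case: (pselect (exists u, path_mul w u = Some r)) => [[u eu]|no].
  rewrite !(cf_piM _ eu nr) cf_first_part (path_mul_arrows eu).
  case E: (path_arrows u) => [|b s] //=.
  have tu : path_trivial u by rewrite /path_trivial E.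
  by rewrite (path_trivialP tu) rl if_same.
have z l' : cf r (pi w * l') = 0.
  by apply/eqP/contraT => /cf_piM_neq0[u eu _]; case: no; exists u.
by rewrite !z if_same.
Qed.

Lemma first_partM a l' l : radical l -> first_part a (l' * l) = l' * first_part a l.
Proof.
move=> rl; rewrite (cf_expand B l') !mulr_suml.
rewrite (big_morph (first_part a) (first_partD a) (first_part0 a)).
apply: eq_bigr => w _.
by rewrite -!mulrA first_part_scal first_part_pi.
Qed.

Lemma first_part_path a r : ohead (path_arrows r) = Some a -> first_part a (pi r) = pi r.
Proof.
move=> h; apply: (cf_ext (B := B)) => w nw; rewrite cf_first_part cf_pi nw /=.
by case: (eqVneq r w) => [<-|_]; rewrite ?h ?eqxx ?if_same.
Qed.

Section Syzygy.
Variables (M : lmodType L) (p q : qpath G) (x : M).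
Hypotheses (W : words p q) (gx : generated x) (hx : has_type p q x).
Local Notation P := (submodule (principal (ev (path_src p))) : lmodType L).

Definition cover : {linear P -> M} := (orb x \o subval _)%FUN.

Lemma coverE (l : P) : cover l = (subval _ l : L) *: x.
Proof. by []. Qed.

Lemma cover_projective : projective P.
Proof. exact: principal_projective (ev_idem B _). Qed.

Lemma cover_surj : surj cover.
Proof.
move=> y; have [l <-] := gx y.
have e : (l * ev (path_src p) : L^o) \in principal (ev (path_src p)) by apply/asboolP; exists l.
by exists (Submodule e); rewrite coverE /= -scalerA hx.1.
Qed.

Lemma type_ann_radical l : l * ev (path_src p) = l -> l *: x = 0 -> radical l.
Proof.
move=> le lx v; case: (eqVneq v (path_src p)) => [->|ne].
  by apply: ((hx.2 l).1 lx) => //; rewrite /initial prefix0s.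
rewrite -le cfM_vertex cf_pi; case: eqVneq => [e|_]; last by rewrite andbF mulr0.
by case/eqP: ne; have := congr1 (@path_src G) e.
Qed.

(** If M were projective, [cyclic_projective_ann] would make the annihilator of x in L e zero: it is
    radical, hence without nonzero idempotents. But it contains [pi r]. *)
Lemma type_not_projective r : nz r -> path_src r = path_src p -> ~~ initial r p q ->
  ~ projective M.
Proof.
move=> nr sr ir Mp.
have rx : pi r *: x = 0 by apply/eqP; rewrite -[_ == 0]negbK (has_type_pi W hx sr).
have re : pi r * ev (path_src p) = pi r by rewrite pi_ev sr eqxx.
have nil (u : L) : u * u = u -> u * ev (path_src p) = u -> u *: x = 0 -> u = 0.
  by move=> uu ue ux; apply: radical_idem (type_ann_radical ue ux) uu.
move: nr; rewrite -pi_neq0 => /eqP; apply.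
exact: cyclic_projective_ann (ev_idem B (path_src p)) hx.1 gx Mp nil _ re rx.
Qed.

(* [t] is [p] prolonged by one arrow; the kernel of [cover] is the direct sum
   of [L (pi t)] and of the analogous module for [q]. *)
Lemma syzygy_arm_retract a b t : ohead (path_arrows p) = Some a ->
  path_mul (arrow_path b) p = Some t -> nz t ->
  retract (cyc (pi t : L^o)) (submodule (ker cover)).
Proof.
move=> hp et nt.
have st : path_src t = path_src p := path_mul_src et.
have ht : ohead (path_arrows t) = Some a.
  by rewrite (path_mul_arrows et); case: (path_arrows p) hp.
have it : ~~ initial t p q.
  rewrite /initial (path_mul_arrows et) negb_or; apply/andP; split.
    by apply/negP => /size_prefix; rewrite size_cat addn1 ltnn.
  have [_ _ _] := W; move: hp; case: (path_arrows p) => [//|a' s] _ /=.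
  by case: (path_arrows q) => [|b' s'] //= ne; rewrite (negbTE ne).
have te : pi t * ev (path_src p) = pi t by rewrite pi_ev st eqxx.
have tx : pi t *: x = 0 by apply/eqP; rewrite -[_ == 0]negbK (has_type_pi W hx st).
have h1 : forall y : cyc (pi t : L^o), subval _ y \in principal (ev (path_src p)).
  move=> y; have /in_img[l <-] := subvalP y; apply/asboolP; exists (l * pi t).
  by rewrite -mulrA te.
have h2 : forall y : cyc (pi t : L^o), lift_sub h1 y \in ker cover.
  move=> y; apply/in_ker; have /in_img[l el] := subvalP y.
  by rewrite coverE -[subval _ _]/(subval _ y) -el orbE -scalerA tx scaler0.
have kerP (y : submodule (ker cover)) :
    (subval _ (subval _ y) : L) * ev (path_src p) = subval _ (subval _ y) /\
    (subval _ (subval _ y) : L) *: x = 0.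
  split; last by have /in_ker := subvalP y.
  by have /asboolP[l ->] := subvalP (subval _ y); rewrite -mulrA ev_idem.
have h3 (y : submodule (ker cover)) :
    (first_part a (subval _ (subval _ y)) : L^o) \in img (orb (pi t : L^o)).
  have [le lx] := kerP y; rewrite /first_part; apply: rpred_sum => r _.
  case: ifP => [/eqP hr|_]; last by rewrite scal0 mul0r rpred0.
  case: (eqVneq (cf r (subval _ (subval _ y))) 0) => [->|nr]; first by rewrite scal0 mul0r rpred0.
  have nzr := cf_nz nr.
  have sr : path_src r = path_src p.
    apply/eqP; apply: contraNT nr => ne; rewrite -le.
    apply: contraT => /cf_Mpi_neq0[r' er' _].
    by rewrite (path_mul_src er') eqxx in ne.
  have nir : ~~ initial r p q.
    by apply: contraNN nr => ir; rewrite ((hx.2 _).1 lx).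
  have np : nz p := let: And4 h _ _ _ := W in h.
  have lt : (size (path_arrows p) < size (path_arrows r))%N.
    rewrite ltnNge; apply: contraNN nir => le'.
    by rewrite /initial (nz_chain_total next_uniq nzr np hr hp le').
  have [||w ew] := @path_prefixP _ t r; first by rewrite st sr.
    apply: (nz_chain_total next_uniq nt nzr ht hr).
    by rewrite (path_mul_arrows et) size_cat addn1.
  apply/in_img; exists (scal (cf r (subval _ (subval _ y))) * pi w).
  by rewrite orbE -[LHS]mulrA piM ew.
have l3 : linear (fun y : submodule (ker cover) => Submodule (h3 y)).
  move=> c y z; apply: subval_inj.
  change (first_part a (c * subval _ (subval _ y) + subval _ (subval _ z)) =
          c * first_part a (subval _ (subval _ y)) + first_part a (subval _ (subval _ z))).
  rewrite first_partD first_partM //; have [le lx] := kerP y.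
  exact: type_ann_radical le lx.
exists (lift_sub h2), (mklin l3) => y; apply: subval_inj.
have /in_img[l el] := subvalP y.
change (first_part a (subval _ y) = subval _ y); rewrite -el orbE.
change (first_part a (l * pi t) = l * pi t).
rewrite first_partM ?first_part_path //.
exact: type_ann_radical te tx.
Qed.

End Syzygy.

End Enlarge.

Lemma prefix_comparable (T : eqType) (s1 s2 s : seq T) : prefix s1 s -> prefix s2 s ->
  (size s1 <= size s2)%N -> prefix s1 s2.
Proof.
rewrite !prefixE => /eqP e1 /eqP e2 le.
by rewrite -e2 take_takel ?e1.
Qed.

(** * Strings embedding in the radical *)

Section Embedding.
Variables (K : fieldType) (G : quiver) (L : pzRingType) (B : path_basis K G L).
Local Notation scal := (pb_scal B).
Local Notation pi := (pb_pi B).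
Local Notation cf := (pb_cf B).
Local Notation nz := (nonzero_path B).
Local Notation ar := (arrow_elt B).
Local Notation has_type := (has_type B).
Local Notation words := (words B).
Implicit Types (p q r s u w t : qpath G) (c d : K) (a b h : arrow G) (v : vertex G) (l : L).
Hypothesis next_uniq : forall a b b', ar b * ar a != 0 -> ar b' * ar a != 0 -> b = b'.

Lemma piM_some w s r : path_mul w s = Some r -> pi w * pi s = pi r.
Proof. by move=> e; rewrite piM e. Qed.

Lemma piM_neq0 w s : pi w * pi s != 0 ->
  exists2 r, path_mul w s = Some r & nz r.
Proof.
rewrite piM; case: path_mul => [r|]; last by rewrite eqxx.
by rewrite pi_neq0; exists r.
Qed.

(** The kernel of N -> M is a copy of L t, where t = b p. For n = 0 neither module is projective, as
    t is nonzero and not an initial segment. A bound n+1 on either module bounds L t, a retract of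
    its syzygy, by n; then [pdle_ext] passes from M to N and [pdle_coker] from N to M. *)
Lemma pdle_enlarge (M N : lmodType L) p q q' q1 r a b (x : M) (y : N) :
  words p q -> words p q' -> generated x -> generated y ->
  has_type p q x -> has_type p q' y ->
  path_mul q r = Some p -> path_mul (arrow_path b) q = Some q1 ->
  prefix (path_arrows q1) (path_arrows q') ->
  pi q' * pi r != 0 ->
  (forall w, path_src w = path_src p -> pi w * pi r != 0 ->
     prefix (path_arrows w) (path_arrows q')) ->
  ohead (path_arrows p) = Some a ->
  forall n, pdle n M <-> pdle n N.
Proof.
move=> W W' gx gy hx hy ep eq1 pq1 nq'r max hp.
have [np nq spq _] := W; have [_ nq' spq' _] := W'.
have sq1 : path_src q1 = path_src p by rewrite (path_mul_src eq1).
have [|w2 ew2] := path_prefixP _ pq1; first by rewrite sq1.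
have [q1r eq1r nq1r] : exists2 q1r, path_mul q1 r = Some q1r & nz q1r.
  apply: piM_neq0; apply: contraNneq nq'r => z.
  by rewrite -(piM_some ew2) -mulrA z mulr0.
have et : path_mul (arrow_path b) p = Some q1r.
  exact: path_mulA_some eq1 ep eq1r.
set t := q1r in eq1r nq1r et.
have q1x : pi q1 *: x = 0.
  apply/eqP; rewrite -[_ == 0]negbK (has_type_pi W hx sq1) /initial negb_or.
  have q1E : path_arrows q1 = path_arrows q ++ [:: b] := path_mul_arrows eq1.
  apply/andP; split; last by apply/negP => /size_prefix; rewrite q1E size_cat addn1 ltnn.
  have [_ _ _] := W'; move: pq1; rewrite q1E.
  case: (path_arrows q) => [|h s].
    case: (path_arrows p) hp => [//|a' s'] _ /=; case: (path_arrows q') => [//|h' s''] /=.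
    by move=> /andP[/eqP <- _]; rewrite eq_sym => /negbTE ->.
  case: (path_arrows p) hp => [//|a' s'] _ /=; case: (path_arrows q') => [//|h' s''] /=.
  by move=> /andP[/eqP <- _]; rewrite eq_sym => /negbTE ->.
pose z := pi q1 *: y.
have zE l : l *: z = 0 <-> l * pi t = 0.
  (* If w q1 is an initial segment of q', then w t is nonzero because q' r is; the converse is the
     maximality of q'. An initial segment of p is impossible, as q1 and p begin with different
     arrows. *)
  have tE w : path_src w = path_tgt q1 -> exists wq, path_mul w q1 = Some wq /\
     (initial wq p q' <-> pi w * pi t != 0).
    move=> sw; have [wq ewq] := path_mul_defined sw; exists wq; split=> //.
    have swq : path_src wq = path_src p by rewrite (path_mul_src ewq).
    have E : pi w * pi t = pi wq * pi r by rewrite -(piM_some eq1r) mulrA (piM_some ewq).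
    rewrite E; split=> [/orP[pr|pr]|nwq].
    - exfalso; have [_ _ _] := W'; move: (prefix_trans (path_mul_prefix ewq) pr) pq1 hp.
      rewrite (path_mul_arrows eq1) /path_arrows /=; case: (path_val q).2 => [|h s] /=;
      case: (path_val p).2 => [//|a' s'] /= /andP[/eqP <- _];
      by case: (path_val q').2 => [//|h' s''] /= /andP[/eqP <- _]; rewrite eqxx.
    - have [|w3 ew3] := path_prefixP _ pr; first by rewrite swq.
      by apply: contraNneq nq'r => h0; rewrite -(piM_some ew3) -mulrA h0 mulr0.
    - by apply/orP; right; apply: max.
  rewrite scalerA hy.2; split=> [H|H r0 sr0 ir0].
    rewrite (cf_expand B l) mulr_suml big1 // => w _.
    case: (eqVneq (path_src w) (path_tgt q1)) => [sw|ne]; last first.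
      rewrite -(piM_some eq1r) -!mulrA [pi w * _]mulrA piM.
      case e: path_mul => [w'|]; last by rewrite mul0r mulr0.
      by rewrite (path_mul_compat e) eqxx in ne.
    have [wq [ewq iE]] := tE w sw.
    case: (eqVneq (pi w * pi t) 0) => [z0|nzt]; first by rewrite -mulrA z0 mulr0.
    have iwq := iE.2 nzt; have swq : path_src wq = path_src p by rewrite (path_mul_src ewq).
    have nwq : nz wq := nz_initial spq' np nq' swq iwq.
    by rewrite -(cf_Mpi l ewq nwq) H // scal0 !mul0r.
  apply/eqP/contraT => ne; have [w ew cw] := cf_Mpi_neq0 ne.
  have [wq [ewq iE]] := tE w (path_mul_compat ew).
  have Ewq : wq = r0 by move: ewq; rewrite ew => -[].
  move: iE; rewrite Ewq => /iffLR /(_ ir0) nwt.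
  have [wt ewt nwt'] := piM_neq0 nwt.
  by rewrite -(cf_Mpi l ewt nwt') H cf0 eqxx in cw.
have [i iE] : {i : {linear cyc (pi t : L^o) -> N} |
    forall l, i (orb (cyc_gen (pi t : L^o)) l) = orb z l}.
  apply: lin_factor (@cyc_generated _ _ _) _ => l /(congr1 (subval _)) e.
  by apply/zE; rewrite -[RHS]e.
have [g gE] : {g : {linear N -> M} | forall l, g (orb y l) = orb x l}.
  apply: lin_factor gy _ => l /hy.2 H; apply/hx.2 => r0 sr0 /orP[] ir0; apply: H => //.
    by rewrite /initial ir0.
  apply/orP; right; apply: prefix_trans ir0 _.
  exact: prefix_trans (path_mul_prefix eq1) pq1.
have ii : injective i.
  apply: lin_inj => k; have [l <-] := cyc_generated k; rewrite iE orbE => /zE lt.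
  by apply: subval_inj; rewrite -[RHS]lt.
have gs : surj g by move=> m; have [l <-] := gx m; exists (orb y l).
have ex : forall m, g m = 0 <-> exists k, i k = m.
  move=> m; split=> [|[k <-]]; last first.
    have [l <-] := cyc_generated k; rewrite iE orbE scalerA -orbE gE orbE.
    by rewrite -scalerA q1x scaler0.
  have [l <-] := gy m; rewrite gE !orbE => lx.
  apply/in_img; rewrite (act_expand B l y); apply: rpred_sum => r0 _.
  case: (eqVneq (pi r0 *: y) 0) => [->|nr0]; first by rewrite scaler0 rpred0.
  case: (eqVneq (cf r0 l) 0) => [->|cr0]; first by rewrite scal0 scale0r rpred0.
  have sr0 : path_src r0 = path_src p.
    by apply/eqP; apply: contraNT nr0 => ne; rewrite (pi_act_src hy.1 ne).
  have ir0 : ~~ initial r0 p q by apply: contraNN cr0 => ir0; rewrite ((hx.2 l).1 lx).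
  have := nr0; rewrite (has_type_pi W' hy sr0) => ir0'.
  move: ir0 ir0'; rewrite /initial negb_or => /andP[/negbTE -> nr0q] /= r0q'.
  have [||w3 ew3] := @path_prefixP _ q1 r0; first by rewrite sq1.
    apply: (prefix_comparable pq1 r0q').
    rewrite (path_mul_arrows eq1) size_cat addn1 ltnNge; apply: contraNN nr0q.
    by apply: prefix_comparable r0q' _; apply: prefix_trans (path_mul_prefix eq1) pq1.
  apply/in_img; exists (orb (cyc_gen (pi t : L^o)) (scal (cf r0 l) * pi w3)).
  by rewrite iE orbE /z !scalerA -mulrA (piM_some ew3).
have tn : nz t by [].
have st : path_src t = path_src p := path_mul_src et.
have tini q0 : words p q0 -> ~~ initial t p q0.
  case=> _ _ _ hd; rewrite /initial (path_mul_arrows et) negb_or; apply/andP; split.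
    by apply/negP => /size_prefix; rewrite size_cat addn1 ltnn.
  move: hp hd; case: (path_arrows p) => [//|a' s] _ /=.
  by case: (path_arrows q0) => [|b' s'] //= ne; rewrite (negbTE ne).
case=> [|n]; first split=> /=.
- by move/(type_not_projective W gx hx tn st (tini _ W)).
- by move/(type_not_projective W' gy hy tn st (tini _ W')).
have key (M' : lmodType L) q0 (x' : M') : words p q0 -> generated x' -> has_type p q0 x' ->
    pdle n.+1 M' -> pdle n (cyc (pi t : L^o)).
  move=> W0 g0 h0 Mn.
  have := pdle_syzygy (@cover_projective _ _ _ B p) (cover_surj g0 h0) Mn.
  by move/pdle_retract; apply; apply: (syzygy_arm_retract next_uniq W0 h0 hp et tn).
split=> [Mn|Nn].
  exact: pdle_ext ii gs ex (pdleS (key _ _ _ W gx hx Mn)) Mn.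
exact: pdle_coker ii gs ex (key _ _ _ W' gy hy Nn) Nn.
Qed.

End Embedding.

(** * Realizing types by elements of the radical *)

Section Realization.
Variables (K : fieldType) (G : quiver) (L : pzRingType) (B : path_basis K G L).
Local Notation pi := (pb_pi B).
Local Notation cf := (pb_cf B).
Local Notation nzpaths := (pb_paths B).
Local Notation nz := (nonzero_path B).
Local Notation ev := (vertex_unit B).
Local Notation ar := (arrow_elt B).
Local Notation has_type := (has_type B).
Local Notation words := (words B).
Local Notation radical := (radical B).
Implicit Types (p q r s u v w t : qpath G) (c d : K) (a b h : arrow G) (l : L).
Hypothesis next_uniq : forall a b b', ar b * ar a != 0 -> ar b' * ar a != 0 -> b = b'.

(** [u] realizes [p]: the paths [r] starting where [u] ends with [r u] nonzero
    are exactly the initial segments of [p]. *)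
Definition realizes p u : Prop :=
  [/\ ~~ path_trivial u, path_tgt u = path_src p, pi p * pi u != 0
    & forall r, path_src r = path_src p -> pi r * pi u != 0 ->
        prefix (path_arrows r) (path_arrows p)].

Definition in_radical p q : Prop :=
  exists z : L, radical z /\ has_type p q (z : L^o).

Lemma piM_inj w u s t r : path_mul w u = Some r -> nz r -> pi w * pi u = pi s * pi t ->
  path_mul s t = Some r.
Proof.
move=> e nr; rewrite !piM e; case: path_mul => [r'|] E; last first.
  by move: nr; rewrite -pi_neq0 E eqxx.
congr Some; have := cf_pi B r r; rewrite E cf_pi nr eqxx /=.
by case: eqVneq => // _ /eqP; rewrite eq_sym oner_eq0.
Qed.

Lemma realizes_prefix p u r : realizes p u -> path_src r = path_src p ->
  (pi r * pi u != 0) = prefix (path_arrows r) (path_arrows p).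
Proof.
move=> [_ _ ne mx] sr; apply/idP/idP => [/(mx r sr)//|pr].
have [|w ew] := path_prefixP _ pr => //.
by apply: contraNneq ne => z; rewrite -(piM_some B ew) -mulrA z mulr0.
Qed.

(* The paths in [us] have pairwise disjoint sets of nonzero left multiples, so
   these multiples are independent. *)
Lemma has_type_sum p q (us : seq (qpath G)) : words p q -> uniq us ->
  (forall u, u \in us -> path_tgt u = path_src p) ->
  (forall u v r r', u \in us -> v \in us -> pi r * pi u != 0 ->
     pi r * pi u = pi r' * pi v -> u = v) ->
  (forall r, path_src r = path_src p ->
     initial r p q <-> exists2 u, u \in us & pi r * pi u != 0) ->
  has_type p q ((\sum_(u <- us) pi u : L) : L^o).
Proof.
move=> W uus tu sep init; set z : L := \sum_(u <- us) pi u.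
have ind l r u : l * z = 0 -> u \in us -> pi r * pi u != 0 -> cf r l = 0.
  move=> lz uu /[dup] nru /piM_neq0[w ew nw].
  have := cf0 B w; rewrite -lz mulr_sumr cf_sum (big_rem u) //=.
  rewrite (cf_Mpi l ew nw) big1_seq ?addr0 // => v /andP[_].
  rewrite mem_rem_uniq // inE => /andP[ne vu].
  apply/eqP; apply: contraNT ne => /cf_Mpi_neq0[r' er' _].
  apply/eqP/esym/(sep u v r r') => //.
  by rewrite (piM_some B ew) (piM_some B er').
have rz r : (forall u, u \in us -> pi r * pi u = 0) -> pi r * z = 0.
  by move=> h; rewrite mulr_sumr big1_seq // => u /andP[_ /h].
split.
  change (ev (path_src p) * z = z).
  rewrite /z mulr_sumr big_seq [RHS]big_seq; apply: eq_bigr => u uu.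
  by rewrite ev_pi tu // eqxx.
move=> l; change (l * z = 0 <-> forall r, path_src r = path_src p -> initial r p q -> cf r l = 0).
split=> [lz r sr /(init r sr)[u uu nr]|h]; first exact: ind lz uu nr.
rewrite (cf_expand B l) mulr_suml big1 // => r _.
case: (eqVneq (cf r l) 0) => [->|cr]; first by rewrite scal0 !mul0r.
rewrite -mulrA rz ?mulr0 // => u uu; apply/eqP; apply: contraNT cr => nr.
have [w ew _] := piM_neq0 nr.
have sr : path_src r = path_src p by rewrite (path_mul_compat ew) tu.
by apply/eqP/h => //; apply/(init r sr); exists u.
Qed.

Lemma radical_pi u : ~~ path_trivial u -> radical (pi u).
Proof.
move=> tu v; rewrite cf_pi; case: eqVneq => [e|]; rewrite ?andbF //.
by move: tu; rewrite e.
Qed.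

Lemma initial_trivial r p (x : vertex G) : initial r p (vertex_path x) = prefix (path_arrows r) (path_arrows p).
Proof. by rewrite /initial; case: (path_arrows r) => [|a s]; rewrite ?prefix0s ?orbF. Qed.

Lemma realizes_type p u : nz p -> realizes p u ->
  has_type p (vertex_path (path_src p)) ((pi u : L) : L^o).
Proof.
move=> np ru; have -> : pi u = \sum_(w <- [:: u]) pi w by rewrite big_seq1.
apply: has_type_sum => //.
- split=> //; last by case: (path_arrows p).
  have e : path_mul p (vertex_path (path_src p)) = Some p by rewrite path_mulp1 eqxx.
  by have [] := nz_mul e np.
- by move=> w; rewrite inE => /eqP ->; case: ru.
- by move=> u1 u2 r r'; rewrite !inE => /eqP -> /eqP ->.
move=> r sr; rewrite initial_trivial -(realizes_prefix ru sr).
split=> [h|[w]]; first by exists u; rewrite ?mem_head.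
by rewrite inE => /eqP ->.
Qed.

(** Unlike a sum inside L, a pair is subject to no condition on common multiples. It supplies a
    module of the enlarged type before any embedding in the radical of L itself is known. *)
Lemma has_type_pair (M N : lmodType L) p q (x : M) (y : N) : path_src p = path_src q ->
  has_type p (vertex_path (path_src p)) x -> has_type q (vertex_path (path_src q)) y ->
  has_type p q ((x, y) : (M * N)%type).
Proof.
move=> e [ex hx] [ey hy]; split=> [|l]; first by congr pair; rewrite //= e.
split=> [[/hx lx /hy ly] r sr /orP[] ir|h].
- by apply: lx; rewrite // initial_trivial.
- by apply: ly; rewrite ?initial_trivial // -e.
- congr pair; [apply/hx | apply/hy] => r sr; rewrite initial_trivial => ir; apply: h;
    by rewrite /initial ?ir ?orbT // e.
Qed.

Lemma in_radical_single p q u : words p q -> path_trivial q -> realizes p u -> in_radical p q.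
Proof.
move=> [np _ e _] tq ru; exists (pi u); split; first by apply: radical_pi; case: ru.
by rewrite (path_trivialP tq) -e; apply: realizes_type.
Qed.

Lemma in_radical_pair p q u v : words p q -> realizes p u -> realizes q v -> u != v ->
  (forall r r', pi r * pi u != 0 -> pi r * pi u <> pi r' * pi v) -> in_radical p q.
Proof.
move=> W ru rv uv sep; exists (\sum_(u' <- [:: u; v]) pi u'); split.
  move=> x; rewrite big_cons big_seq1 cfD (radical_pi _) ?(radical_pi _) ?addr0 //.
    by case: rv.
  by case: ru.
have spq : path_src p = path_src q by case: W.
apply: has_type_sum => //.
- by rewrite /= inE uv.
- by move=> u'; rewrite !inE => /orP[] /eqP ->; [case: ru | rewrite spq; case: rv].
- move=> u1 u2 r r'; rewrite !inE => /orP[] /eqP -> /orP[] /eqP -> // ne e.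
    by case: (sep r r' ne).
  by case: (sep r' r); rewrite -?e.
move=> r sr; have sr' : path_src r = path_src q by rewrite sr.
rewrite /initial -(realizes_prefix ru sr) -(realizes_prefix rv sr'); split.
  by case/orP => h; [exists u | exists v]; rewrite // !inE eqxx ?orbT.
by case=> u'; rewrite !inE => /orP[] /eqP -> ->; rewrite ?orbT.
Qed.

Lemma head_after h h' u w w' : ~~ path_trivial u ->
  pi w * pi u != 0 -> pi w' * pi u != 0 ->
  ohead (path_arrows w) = Some h -> ohead (path_arrows w') = Some h' -> h = h'.
Proof.
move=> /path_lastP[c [u' eu]] nw nw' hw hw'.
have aux k x : pi x * pi u != 0 -> ohead (path_arrows x) = Some k -> ar k * ar c != 0.
  move=> nx hx; have [|k' [x' ex]] := @path_firstP _ x.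
    by rewrite /path_trivial; case: (path_arrows x) hx.
  have : ohead (path_arrows x) = Some k' by rewrite (path_mul_arrows ex).
  rewrite hx => -[kk']; subst k'; apply: contraNneq nx => z.
  rewrite -(piM_some B ex) -(piM_some B eu) -/(ar k) -/(ar c).
  by rewrite -mulrA [ar k * _]mulrA z mul0r mulr0.
exact: next_uniq (aux _ _ nw hw) (aux _ _ nw' hw').
Qed.

Definition same_pdim p q p' q' : Prop :=
  forall (M N : lmodType L) (x : M) (y : N), generated x -> generated y ->
    has_type p q x -> has_type p' q' y -> forall n, pdle n M <-> pdle n N.

Definition replaceable p q : Prop := exists p' q',
  [/\ words p' q', in_radical p' q' & same_pdim p q p' q'].

Lemma replaceable_refl p q : words p q -> in_radical p q -> replaceable p q.
Proof.
move=> W h; exists p, q; split=> // M N x y gx gy hx hy n.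
have [f [_ fi fs]] := type_iso gx gy hx hy.
by split=> /pdle_retract; apply; case: (retract_iso fi fs).
Qed.

Lemma replaceableC p q : words p q -> replaceable q p -> replaceable p q.
Proof.
move=> [_ _ e _] [p' [q' [W' h sp]]]; exists p', q'; split=> // M N x y gx gy hx.
by apply: sp => //; apply: has_typeC.
Qed.

Let step k p q u v :
  (forall q' s, words p q' -> ~~ path_trivial q' -> realizes q' s ->
     (size (path_arrows q) < size (path_arrows q'))%N -> replaceable p q') ->
  (forall s, realizes q s -> (size (path_arrows s) < size (path_arrows v))%N ->
     (size (path_arrows u) + size (path_arrows s) < k)%N -> replaceable p q) ->
  words p q -> ~~ path_trivial p -> ~~ path_trivial q ->
  realizes p u -> realizes q v -> (size (path_arrows u) + size (path_arrows v) <= k)%N ->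
  path_src u = path_src v -> prefix (path_arrows u) (path_arrows v) ->
  replaceable p q.
Proof.
move=> grow shrink W tp tq ru rv le suv puv.
have [np nq spq hd] := W.
have [s es] := path_prefixP suv puv.
have nqp : ~~ prefix (path_arrows q) (path_arrows p).
  move: tp tq hd; rewrite /path_trivial; case: (path_arrows p) => [//|a ?] _.
  by case: (path_arrows q) => [//|b ?] _ /= ab; rewrite eq_sym (negbTE ab).
have [tu uE npu mxu] := ru; have [tv vE nqv mxv] := rv.
have ss : path_src s = path_src p by rewrite (path_mul_compat es).
have ts : path_tgt s = path_src p by rewrite -(path_mul_tgt es) vE.
have vE' : pi v = pi s * pi u by rewrite (piM_some B es).
have nv : pi v != 0 by apply: contraNneq nqv => ->; rewrite mulr0.
have psp : prefix (path_arrows s) (path_arrows p) by apply: mxu; rewrite // -vE'.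
(* Write p = p2 s. As p2 v = p u is nonzero, p2 is an initial segment of q; as q s u = q v is
   nonzero, q s is an initial segment of p. Comparing lengths gives p2 = q. *)
have [p2 ep2] := path_prefixP ss psp.
have sp2 : path_src p2 = path_src p by rewrite (path_mul_compat ep2).
have pp2q : prefix (path_arrows p2) (path_arrows q).
  by apply: mxv; rewrite ?sp2 // vE' mulrA (piM_some B ep2).
have [qs eqs] : exists qs, path_mul q s = Some qs by apply: path_mul_defined; rewrite ts.
have pqsp : prefix (path_arrows qs) (path_arrows p).
  apply: mxu; first by rewrite (path_mul_src eqs).
  by rewrite -(piM_some B eqs) -mulrA -vE'.
have p2q : p2 = q.
  apply: path_ext; first by rewrite sp2.
  have le2 : (size (path_arrows q) <= size (path_arrows p2))%N.
    have := size_prefix pqsp.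
    by rewrite (path_mul_arrows eqs) (path_mul_arrows ep2) !size_cat leq_add2l.
  by move: pp2q; rewrite prefixE take_oversize // => /eqP.
subst p2; have nqs : pi q * pi s != 0 by rewrite (piM_some B ep2) pi_neq0.
have ntu : (0 < size (path_arrows u))%N by rewrite lt0n; exact: tu.
have nts : ~~ path_trivial s.
  apply: contraNN nqp => ts'; have := path_mul_arrows ep2.
  by rewrite (nilP ts') /= => ->; apply: prefix_refl.
have sq : path_src q = path_src p by [].
case: (pselect (forall w, path_src w = path_src q -> pi w * pi s != 0 ->
   prefix (path_arrows w) (path_arrows q))) => [mx|nmx].
  have lt : (size (path_arrows s) < size (path_arrows v))%N.
    by rewrite (path_mul_arrows es) size_cat -[X in (X < _)%N]add0n ltn_add2r.
  apply: (shrink s) => //; first by split; rewrite ?ts.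
  by apply: leq_trans le; rewrite ltn_add2l.
have [w [sw nws nwq]] : exists w, [/\ path_src w = path_src q, pi w * pi s != 0
    & ~~ prefix (path_arrows w) (path_arrows q)].
  apply: contrapT => no; case: nmx => w sw nws; apply: contrapT => /negP h.
  by case: no; exists w.
pose P r := (path_src r == path_src q) && (pi r * pi s != 0).
have nzs r : pi r * pi s != 0 -> r \in nzpaths.
  by move=> /piM_neq0[x ex nx]; have [] := nz_mul ex nx.
have [|q' [q'n /andP[/eqP sq' nq's] q'm]] :=
  @seq_argmax _ nzpaths P (fun r => size (path_arrows r)) w (nzs _ nws).
  by rewrite /P sw nws eqxx.
have mx r : path_src r = path_src p -> pi r * pi s != 0 ->
    prefix (path_arrows r) (path_arrows q').
  move=> sr nr; have le' : (size (path_arrows r) <= size (path_arrows q'))%N.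
    by apply: q'm; [exact: nzs | rewrite /P sr nr spq eqxx].
  case Er: (ohead (path_arrows r)) => [c|]; last by case: (path_arrows r) Er => // *; rewrite prefix0s.
  case Eq: (ohead (path_arrows q')) => [c'|]; last first.
    by move: Eq le'; case: (path_arrows q') => // _; case: (path_arrows r) Er.
  have cc := head_after nts nr nq's Er Eq; subst c'.
  exact: (nz_chain_total next_uniq (nzs _ nr) q'n Er Eq le').
have pqq' : prefix (path_arrows q) (path_arrows q') by apply: mx.
have lt : (size (path_arrows q) < size (path_arrows q'))%N.
  rewrite ltnNge; apply: contraNN nwq => le'.
  have -> : path_arrows q = path_arrows q'.
    by move: pqq'; rewrite prefixE take_oversize // => /eqP.
  by apply: mx; rewrite ?sw.
have rq' : realizes q' s by split; rewrite ?ts ?sq' // => r; rewrite -spq; apply: mx.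
have tq' : ~~ path_trivial q' by rewrite /path_trivial /nilp -lt0n (leq_ltn_trans _ lt).
have W' : words p q'.
  split=> //; first by rewrite sq'.
  move: hd pqq' tq; rewrite /path_trivial; case: (path_arrows p) => [//|c ?].
  case: (path_arrows q) => [//|c' ?]; case: (path_arrows q') => [//|c2 ?] /=.
  by move=> ? /andP[/eqP <- _].
have [p1 [q2 [W1 R1 S1]]] := grow q' s W' tq' rq' lt.
exists p1, q2; split=> // M N x y gx gy hx hy n.
have [w2 ew2] : exists w2, path_mul w2 q = Some q' by apply: path_prefixP; rewrite ?sq'.
have tw2 : ~~ path_trivial w2.
  by move: lt; rewrite (path_mul_arrows ew2) size_cat /path_trivial /nilp; case: (path_arrows w2) => //=; rewrite addn0 ltnn.
have [b [w3 ew3]] := path_firstP tw2.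
have [q1 eq1] : exists q1, path_mul (arrow_path b) q = Some q1.
  apply: path_mul_defined; rewrite -(path_mul_compat ew2) -(path_mul_src ew3).
  by [].
have ew4 := path_mulA_some ew3 eq1 ew2.
have [c hc] : exists c : arrow G, ohead (path_arrows p) = Some c.
  by move: tp; rewrite /path_trivial; case: (path_arrows p) => [//|c ?] _; exists c.
(* The pair (u, s) generates, inside L^2, a module of type (p, q'). It links M to the module
   attached to (p, q') by the induction. *)
have hz := has_type_pair (etrans spq (esym sq')) (realizes_type np ru) (realizes_type q'n rq').
set z : (L^o * L^o)%type := (_, _) in hz.
have hz' : has_type p q' (cyc_gen z) by apply/(has_type_inj B p q' (cyc_gen z) (@subval_inj _ _ _)).
have := S1 _ _ (cyc_gen z) y (@cyc_generated _ _ z) gy hz' hy n.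
move=> <-; apply: (pdle_enlarge next_uniq W W' gx (@cyc_generated _ _ z) hx hz' ep2 eq1) => //.
- exact: path_mul_prefix ew4.
- exact: hc.
Qed.

Lemma realized_replaceable p q u v : words p q -> ~~ path_trivial p -> ~~ path_trivial q ->
  realizes p u -> realizes q v -> replaceable p q.
Proof.
(* Nested inductions: n bounds the room left for p and q to grow, since each is shorter than
   [path_bound B]; k bounds the lengths of u and v. An enlargement lowers n and lets k start afresh,
   while replacing u or v by s keeps p and q and lowers k. *)
suff H n : forall k p q u v,
    (path_bound B + path_bound B <= n + (size (path_arrows p) + size (path_arrows q)))%N ->
    (size (path_arrows u) + size (path_arrows v) <= k)%N -> words p q ->
    ~~ path_trivial p -> ~~ path_trivial q -> realizes p u -> realizes q v -> replaceable p q.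
  exact: (H (path_bound B + path_bound B)%N _ p q u v (leq_addr _ _) (leqnn _)).
elim: n => [|n IHn] k {}p {}q {}u {}v.
  rewrite add0n leqNgt => /negP le _ [np nq _ _]; case: le.
  rewrite -addSn; apply: leq_add; last exact: ltnW (nz_bound nq).
  exact: nz_bound np.
elim: k p q u v => [|k IHk] p q u v le1 le2 W tp tq ru rv.
  by case: ru => tu _ _ _; case/negP: tu; move: le2; rewrite leqn0 addn_eq0 => /andP[].
(* Without a common nonzero multiple, u + v is the required element. Otherwise u and v are initial
   segments of one path w, so the shorter is an initial segment of the longer. *)
case: (pselect (exists r r', pi r * pi u != 0 /\ pi r * pi u = pi r' * pi v)); last first.
  move=> no; apply: replaceable_refl => //; apply: (in_radical_pair W ru rv).
    by case: ru => _ _ npu _; apply/negP => /eqP uv; case: no; exists p, p; rewrite npu uv.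
  by move=> r r' nr e; case: no; exists r, r'.
case=> r [r' [nr e]]; have [w ew nw] := piM_neq0 nr.
have ew' := piM_inj ew nw e.
have suv : path_src u = path_src v by rewrite -(path_mul_src ew) (path_mul_src ew').
have grow (p1 q1 u1 v1 : qpath G) : (path_bound B + path_bound B <=
       n.+1 + (size (path_arrows p1) + size (path_arrows q1)))%N ->
    ~~ path_trivial p1 -> realizes p1 u1 ->
    forall q' s, words p1 q' -> ~~ path_trivial q' -> realizes q' s ->
     (size (path_arrows q1) < size (path_arrows q'))%N -> replaceable p1 q'.
  move=> le tp1 ru1 q' s W' tq' rs lt; apply: (IHn _ p1 q' u1 s _ (leqnn _)) => //.
  by apply: leq_trans le _; rewrite addSnnS leq_add2l ltn_add2l.
case: (leqP (size (path_arrows u)) (size (path_arrows v))) => [luv|/ltnW lvu].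
  apply: (step (grow p q u v le1 tp ru) _ W tp tq ru rv le2 suv).
    move=> s rs _ lt; exact: (IHk p q u s).
  exact: prefix_comparable (path_mul_prefix ew) (path_mul_prefix ew') luv.
apply: replaceableC => //.
have W' := wordsC W; rewrite addnC in le2; rewrite [X in (_ <= _ + X)%N]addnC in le1.
apply: (step (grow q p v u le1 tq rv) _ W' tq tp rv ru le2 (esym suv)).
  by move=> s rs _ lt; apply: (IHk q p v s).
exact: prefix_comparable (path_mul_prefix ew') (path_mul_prefix ew) lvu.
Qed.

Section Coordinates.
Variables (X : lmodType L) (J : Type) (phi : J -> {linear X -> L^o}).
Hypothesis phi_inj : forall y, (forall i, phi i y = 0) -> y = 0.
Hypothesis phi_rad : forall i y, radical (phi i y).

(** Some coordinate of p x is nonzero; a path occurring there has the form p u with u occurring in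
    that coordinate of x. Coordinates are radical, so u is nontrivial, and r u nonzero forces r x
    nonzero. *)
Let realize p q (x : X) : words p q -> has_type p q x -> exists u,
  [/\ ~~ path_trivial u, path_tgt u = path_src p, pi p * pi u != 0
    & forall r, path_src r = path_src p -> pi r * pi u != 0 -> initial r p q].
Proof.
move=> W hx; have : pi p *: x != 0.
  by rewrite (has_type_pi W hx) // /initial prefix_refl.
move=> npx; have [i npi] : exists i, pi p * phi i x != 0.
  apply: contrapT => no; case/eqP: npx; apply: phi_inj => i.
  rewrite linearZ; apply: contrapT => ne; case: no; exists i; exact/eqP.
have [w] : exists w, cf w (pi p * phi i x) != 0.
  apply: contrapT => no; case/eqP: npi; apply: (cf_ext (B := B)) => w _; rewrite cf0.
  by apply/eqP/negPn/negP => ne; case: no; exists w.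
move=> /[dup] /cf_nz nw /cf_piM_neq0[u eu cu]; exists u; split.
- by apply: contraNN cu => tu; rewrite (path_trivialP tu) phi_rad.
- exact: esym (path_mul_compat eu).
- by rewrite (piM_some B eu) pi_neq0.
move=> r sr /piM_neq0[w' ew' nw'].
rewrite -(has_type_pi W hx sr); apply: contraNneq cu => z.
by rewrite -(cf_piM _ ew' nw') -[_ * _]/(pi r *: (phi i x : L^o)) -linearZ z linear0 cf0.
Qed.

(** Only one arrow can follow the nontrivial path u, namely the first arrow of p, and this excludes
    nontrivial segments of q. *)
Let realize_nontrivial p q (x : X) : words p q -> has_type p q x -> ~~ path_trivial p ->
  exists u, realizes p u.
Proof.
move=> W hx tp; have [u [tu uE npu mx]] := realize W hx; exists u; split=> // r sr nr.
case/orP: (mx r sr nr) => // prq; case Er: (path_arrows r) => [|h s]; first exact: prefix0s.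
case Ep: (path_arrows p) tp => [|h' s']; rewrite /path_trivial Ep // => _.
have hh : h = h' by apply: (head_after tu nr npu); rewrite ?Er ?Ep.
case: W => _ _ _; move: prq; rewrite Er Ep; case: (path_arrows q) => [//|h2 ?] /=.
by case/andP => /eqP <- _; rewrite hh eqxx.
Qed.

Lemma coord_replaceable p q (x : X) : words p q -> has_type p q x -> replaceable p q.
Proof.
move=> W hx; have W' := wordsC W.
have spq : path_src p = path_src q by case: W.
have hx' := has_typeC spq hx.
case tp: (path_trivial p); case tq: (path_trivial q).
- have [u [tu uE npu mx]] := realize W hx.
  apply: replaceable_refl => //; apply: (@in_radical_single p q u) => //; split=> // r sr nr.
  by have := mx r sr nr; rewrite /initial (nilP tp) (nilP tq) orbb.
- have [v rv] := realize_nontrivial W' hx' (negbT tq).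
  by apply: replaceableC => //; apply: replaceable_refl => //; apply: in_radical_single rv.
- have [u ru] := realize_nontrivial W hx (negbT tp).
  by apply: replaceable_refl => //; apply: in_radical_single ru.
have [u ru] := realize_nontrivial W hx (negbT tp).
have [v rv] := realize_nontrivial W' hx' (negbT tq).
exact: realized_replaceable W (negbT tp) (negbT tq) ru rv.
Qed.

End Coordinates.

End Realization.

(** * Minimal covers and the strings in a first syzygy *)

Section Syzygies.
Variables (K : fieldType) (G : quiver) (L : pzRingType) (B : path_basis K G L).
Local Notation scal := (pb_scal B).
Local Notation pi := (pb_pi B).
Local Notation cf := (pb_cf B).
Local Notation ev := (vertex_unit B).
Local Notation ar := (arrow_elt B).
Local Notation lquo := (left_quotient B).
Local Notation jrad := (jrad B).
Local Notation has_type := (has_type B).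
Local Notation words := (words B).
Local Notation radical := (radical B).
Local Notation in_radical := (in_radical B).
Local Notation replaceable := (replaceable B).
Implicit Types (p q r : qpath G) (a b : arrow G) (v : vertex G) (l : L).
Hypothesis out_le2 : forall v, (#|[pred a : arrow G | src a == v]| <= 2)%N.
Hypothesis next_uniq : forall a b b', ar b * ar a != 0 -> ar b' * ar a != 0 -> b = b'.
Hypothesis prev_uniq : forall a b b', ar a * ar b != 0 -> ar a * ar b' != 0 -> b = b'.

Definition proj_vertex v : lmodType L := submodule (principal (ev v)).

Lemma proj_vertex_projective v : projective (proj_vertex v).
Proof. exact: principal_projective (ev_idem B v). Qed.

Lemma proj_vertexP v (l : proj_vertex v) : (subval _ l : L) * ev v = subval _ l.
Proof. by have /asboolP[l' ->] := subvalP l; rewrite -mulrA ev_idem. Qed.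

Lemma cf_ev_neq v w l : w != v -> l * ev v = l -> cf (vertex_path w) l = 0.
Proof.
move=> ne <-; rewrite cfM_vertex cf_pi; case: eqVneq => [e|_]; last by rewrite andbF mulr0.
by case/eqP: ne; have := congr1 (@path_src G) e.
Qed.

Lemma ev_act_split M v l (x : M : lmodType L) : jrad (ev v *: (l *: x) -
  scal (cf (vertex_path v) l) *: (ev v *: x)).
Proof.
have E : ev v *: ((\sum_w scal (cf (vertex_path w) l) * ev w) *: x) =
    scal (cf (vertex_path v) l) *: (ev v *: x).
  rewrite scaler_suml scaler_sumr (bigD1 v) //= big1 ?addr0 => [|w ne].
    by rewrite scalerA mulrA -scalC -mulrA ev_idem -scalerA.
  by rewrite scalerA mulrA -scalC -mulrA ev_ev eq_sym (negbTE ne) mulr0 scale0r.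
rewrite {1}(lquo_expand B l) scalerDl scalerDr E addrC addKr.
apply: jrad_ev; exists (fun a => lquo a l *: x); rewrite scaler_suml.
by apply: eq_bigr => a _; rewrite scalerA.
Qed.

(** Generators are bases of the parts of M at the vertices, modulo JM: Nakayama's lemma gives
    surjectivity, and independence modulo JM puts the kernel in the radical. This stands in for a
    projective cover in any dimension. *)
Lemma minimal_cover (M : lmodType L) : exists (J : eqType) (v : J -> vertex G)
    (g : {linear dsum (fun j => proj_vertex (v j)) -> M}),
  surj g /\ forall f, g f = 0 -> forall j, radical (subval _ (dcoef _ j f)).
Proof.
pose Y v := fun x : M => ev v *: x = x.
pose S v := sval (cid (basis_mod (Y v) (jrad_ksub B M))).
have SP v := svalP (cid (basis_mod (Y v) (jrad_ksub B M))).
have SY v x : S v x -> ev v *: x = x by have [+ _ _] := SP v; apply.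
pose J : eqType := {t : vertex G * M | `[< S t.1 t.2 >]}.
pose vx (j : J) := (val j).1; pose el (j : J) := (val j).2.
have elS j : S (vx j) (el j) by have := valP j => /asboolP.
pose psi j : {linear proj_vertex (vx j) -> M} := (orb (el j) \o subval _)%FUN.
pose g := dsum_map psi.
have psiE j (l : proj_vertex (vx j)) : psi j l = (subval _ l : L) *: el j by [].
exists J, vx, g; split=> [y|f gf j v].
  apply/in_img; apply: (nakayama (B := B)) => x.
  have HS v : exists l : seq (K * M), (forall t, t \in l -> S v t.2) /\
      jrad (ev v *: x - \sum_(t <- l) scal t.1 *: t.2).
    have [_ _ /(_ (ev v *: x))[|s [k [us sS Js]]]] := SP v.
      by rewrite /Y scalerA ev_idem.
    exists [seq (k t, t) | t <- s]; rewrite big_map; split=> // t /mapP[t' t's ->].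
    exact: sS.
  have [l lP] := choice HS.
  exists (\sum_v \sum_(t <- l v) scal t.1 *: t.2).
  exists (\sum_v (ev v *: x - \sum_(t <- l v) scal t.1 *: t.2)); split.
  - apply: rpred_sum => v _; rewrite big_seq; apply: rpred_sum => t tl; apply: rpredZ.
    have St : `[< S (v, t.2).1 (v, t.2).2 >] by apply/asboolP; apply: (lP v).1.
    pose j : J := exist _ (v, t.2) St.
    have e : (ev v : L^o) \in principal (ev (vx j)) by apply/asboolP; exists 1; rewrite mul1r.
    apply/in_img; exists (dsum_in _ j (Submodule e)); rewrite dsum_map_in psiE.
    by apply: SY; apply/asboolP.
  - by apply: (ksub_sum (jrad_ksub B M)) => v _; apply: (lP v).2.
  - by rewrite -big_split {1}(sum_ev_act B x); apply: eq_bigr => v _ /=; rewrite addrC subrK.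
case: (eqVneq v (vx j)) => [->|ne]; last exact: cf_ev_neq ne (proj_vertexP _).
case: (dsum_supp f) => s us sf; have := gf; rewrite /g (dsum_mapE psi us sf) => e0.
case: (boolP (j \in s)) => js; last by rewrite sf // linear0 cf0.
pose u := vx j; have jv : vx j = u by [].
pose c j' : K := cf (vertex_path u) (subval _ (dcoef _ j' f)).
have [_ ind _] := SP u.
(* [basis_mod] takes coefficients as functions on M, so those indexed by J are carried over to
   elements. *)
pose k x : K := if insub (u, x) is Some j' then c j' else 0.
pose s' := [seq el j' | j' <- s & vx j' == u].
have kE j' : vx j' = u -> k (el j') = c j'.
  move=> e; rewrite /k; have -> : (u, el j') = val j' by rewrite -e -surjective_pairing.
  by rewrite valK.
rewrite -/(c j) -kE //; apply: (ind s' k).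
- rewrite map_inj_in_uniq ?filter_uniq // => j1 j2.
  rewrite !mem_filter => /andP[/eqP e1 _] /andP[/eqP e2 _] e.
  by apply: val_inj; apply: injective_projections => //; apply: etrans e1 (esym e2).
- move=> x /mapP[j' + ->]; rewrite mem_filter => /andP[/eqP eu _].
  by have := elS j'; rewrite eu.
- rewrite /s' big_map big_filter.
  have -> : \sum_(j' <- s | vx j' == u) scal (k (el j')) *: el j' =
      - \sum_(j' <- s) (ev u *: psi j' (dcoef _ j' f) - scal (c j') *: (ev u *: el j')).
    rewrite big_mkcond sumrB -scaler_sumr e0 scaler0 sub0r opprK; apply: eq_bigr => j' _.
    case: eqVneq => [e|ne]; first by rewrite kE // SY // -e; apply: elS.
    by rewrite /c (cf_ev_neq _ (proj_vertexP _)) ?scal0 ?scale0r // eq_sym.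
  apply: (ksubN (jrad_ksub B M)); apply: (ksub_sum (jrad_ksub B M)) => j' _.
  exact: ev_act_split.
- by apply/mapP; exists j; rewrite // mem_filter jv eqxx.
Qed.

(** The coordinates of [ar a *: w a] involve only paths with last arrow a, so different arrows
    cannot cancel. *)
Lemma arrow_direct_coord (X : lmodType L) (J : Type) (phi : J -> {linear X -> L^o}) :
  (forall y, (forall i, phi i y = 0) -> y = 0) ->
  forall w : arrow G -> X, \sum_a ar a *: w a = 0 -> forall a, ar a *: w a = 0.
Proof.
move=> phi_inj w e a; apply: phi_inj => i; rewrite linearZ.
apply: (cf_ext (B := B)) => r nr; rewrite cf0; apply/eqP/negPn/negP => ne.
have [p ep cp] := cf_piM_neq0 ne.
have := congr1 (fun y => cf r (phi i y)) e; rewrite linear0 cf0 linear_sum cf_sum.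
rewrite (bigD1 a) //= big1 => [|b nb]; last first.
  rewrite linearZ; apply/eqP/negPn/negP => /cf_piM_neq0[p' ep' _].
  have := path_mul_arrows ep; rewrite (path_mul_arrows ep') !cats1 => /rcons_inj[_ ab].
  by rewrite ab eqxx in nb.
by rewrite addr0 linearZ => /eqP; rewrite (negbTE ne).
Qed.

(** Retracts go both ways: one bounds the syzygy by its summands, the other makes the summands
    inherit finite projective dimension. *)
Lemma string_syzygy (M : lmodType L) : exists (P : lmodType L) (g : {linear P -> M})
    (J : eqType) (N : J -> lmodType L),
  [/\ projective P, surj g, retract (submodule (ker g)) (dsum N),
      forall j, retract (N j) (submodule (ker g))
    & forall j, exists p q (y : N j),
        [/\ words p q, generated y, has_type p q y & replaceable p q]].
Proof.
have [J0 [v [g [gs grad]]]] := minimal_cover M.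
exists (dsum (fun j => proj_vertex (v j))), g; set X : lmodType L := submodule (ker g).
pose phi j : {linear X -> L^o} := (subval _ \o dcoef _ j \o subval (ker g))%FUN.
have phi_inj y : (forall i, phi i y = 0) -> y = 0.
  move=> h; apply: subval_inj; apply: dsum_ext => j; rewrite !linear0.
  by apply: subval_inj; rewrite linear0; apply: h.
have phi_rad i y : radical (phi i y) by apply: grad; apply/in_ker; apply: subvalP.
have [S [S1 SD Sgen]] := string_decomposition out_le2 next_uniq prev_uniq
  (arrow_direct_coord phi_inj).
pose J : eqType := {x : X | `[< S x >]}.
have JS (j : J) : S (val j) by have /asboolP := valP j.
pose N (j : J) : lmodType L := cyc (val j).
pose F : {linear dsum N -> X} := dsum_map (fun j => subval (img (orb (val j)))).
have Fi : injective F.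
  apply: lin_inj => f; case: (dsum_supp f) => s us sf.
  rewrite /F (dsum_mapE _ us sf) => e0.
  have lE (j : J) : exists l, orb (cyc_gen (val j)) l = dcoef N j f by apply: cyc_generated.
  pose l j := sval (cid (lE j)).
  have lP j : subval _ (dcoef N j f) = (l j : L) *: val j.
    by rewrite -(svalP (cid (lE j))).
  pose c x : L := if insub x is Some j then l j else 0.
  have cE j : c (val j) = l j by rewrite /c valK.
  apply: dsum_ext => j; rewrite linear0; case: (boolP (j \in s)) => js; last exact: sf.
  apply: subval_inj; rewrite linear0 lP (act_expand B) big1 // => r _.
  case: (eqVneq (cf r (l j)) 0) => [->|cr]; first by rewrite scal0 scale0r.
  have := SD c (map val s) _ _ _ (val j) r; rewrite cE => -> //; rewrite ?scaler0 //.
  - by rewrite map_inj_uniq //; apply: val_inj.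
  - by move=> x /mapP[j' _ ->].
  - by rewrite big_map -[RHS]e0; apply: eq_bigr => j' _; rewrite cE lP.
  - exact: map_f.
have Fs : surj F.
  move=> y; apply/in_img; apply: Sgen => x Sx.
  have Sx' : `[< S x >] by apply/asboolP.
  pose j : J := exist _ x Sx'; apply/in_img; exists (dsum_in N j (cyc_gen (val j))).
  by rewrite /F dsum_map_in.
exists J, N; split=> //.
- by apply: dsum_projective => j; apply: proj_vertex_projective.
- by have [] := retract_iso Fi Fs.
- move=> j; have [F' [F'K _]] := lin_inv Fi Fs.
  exists (F \o dsum_in N j)%FUN, (dcoef N j \o F')%FUN => x.
  by rewrite /= F'K dcoef_in.
move=> j; have [x0 [w ex]] := S1 _ (JS j).
(* Independence for this one generator: its annihilator is spanned by paths. *)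
have ind l r : l *: val j = 0 -> cf r l != 0 -> pi r *: val j = 0.
  move=> lx cr; apply: (SD (fun=> l) [:: val j] _ _ _ (val j) r (mem_head _ _) cr) => //.
    by move=> y; rewrite inE => /eqP ->.
  by rewrite big_seq1.
have [p [q [W hx]]] := exists_type out_le2 next_uniq x0 ex ind.
exists p, q, (cyc_gen (val j)); split=> //.
- exact: cyc_generated.
- by apply/(has_type_inj B p q (cyc_gen (val j)) (@subval_inj _ _ _)).
- exact: (coord_replaceable next_uniq phi_inj phi_rad W hx).
Qed.

Definition string_class (N : lmodType L) : Prop :=
  exists p q (y : N), [/\ words p q, generated y, has_type p q y & in_radical p q].

Lemma replaced_module (N : lmodType L) p q (y : N) :
  generated y -> has_type p q y -> replaceable p q ->
  exists N' : lmodType L, string_class N' /\ forall n, pdle n N <-> pdle n N'.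
Proof.
move=> gy hy [p' [q' [W' [z [rz hz]] sp]]].
have hz' : has_type p' q' (cyc_gen (z : L^o)).
  by apply/(has_type_inj B p' q' (cyc_gen (z : L^o)) (@subval_inj _ _ _)).
exists (cyc (z : L^o)); split; last exact: sp gy (@cyc_generated _ _ _) hy hz'.
exists p', q', (cyc_gen (z : L^o)); split=> //; first exact: cyc_generated.
by exists z.
Qed.

(** The bound n on M ensures that the summands of its syzygy have finite projective dimension; the
    uniform k then replaces it. *)
Lemma pdle_bound k n (M : lmodType L) :
  (forall N, string_class N -> forall m, pdle m N -> pdle k N) -> pdle n M -> pdle k.+1 M.
Proof.
move=> hk Mn; have [P [g [J [N [Pp gs rX rN NP]]]]] := string_syzygy M.
exists P, g; split=> //; apply: pdle_retract rX; apply: dsum_pdle => j.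
have [p [q [y [W gy hy rpl]]]] := NP j.
have [N' [cN' eN']] := replaced_module gy hy rpl.
apply/eN'; apply: (hk _ cN' n); apply/eN'; apply: pdle_retract (rN j).
exact: pdle_syzygy Pp gs (pdleS Mn).
Qed.

(** A summand of the syzygy would be a string of finite projective dimension, so there is none and
    the cover of M is injective. *)
Lemma projective_of_no_string n (M : lmodType L) :
  (forall N, string_class N -> forall m, ~ pdle m N) -> pdle n M -> projective M.
Proof.
move=> h Mn; have [P [g [J [N [Pp gs rX rN NP]]]]] := string_syzygy M.
have noJ (j : J) : False.
  have [p [q [y [W gy hy rpl]]]] := NP j.
  have [N' [cN' eN']] := replaced_module gy hy rpl.
  apply: (h _ cN' n); apply/eN'; apply: pdle_retract (rN j).
  exact: pdle_syzygy Pp gs (pdleS Mn).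
have [i [p ipK]] := rX.
have gi : injective g.
  apply: lin_inj => x gx; have e : x \in ker g by apply/in_ker.
  rewrite -[x]/(subval _ (Submodule e)) -(ipK (Submodule e)).
  have -> : i (Submodule e) = 0 by apply: dsum_ext => j; case: (noJ j).
  by rewrite !linear0.
exact: retract_projective Pp (retract_iso gi gs).2.
Qed.

End Syzygies.

Lemma quotmod_proj (R : pzRingType) (M : lmodType R) (U : submodClosed M) :
  {g : {linear M -> quotmod U} | surj g /\ forall x, g x = 0 <-> x \in U}.
Proof.
pose f x : quotmod U := \pi_(quotmod U) x.
have fE x y : (f x = f y) <-> (x - y \in U).
  have R' : reflect (f x = f y) (x - y \in U).
    by rewrite -[_ \in U]/(_ \in as_zmodClosed U) Quotient.idealrBE; apply: eqP.
  by split=> /R'.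
have lf : linear f.
  move=> a x y; have -> : a *: f x = f (a *: x).
    apply/fE; rewrite -scalerBr rpredZ //; apply/fE; exact: reprK.
  by rewrite /f [RHS]piE.
exists (mklin lf); split=> [y|x]; first by exists (repr y); apply: reprK.
by rewrite -[x in x \in U]subr0 -fE -[f 0]/(mklin lf 0) linear0.
Qed.

(** * Raising projective dimension by one *)

Section StringQuotient.
Variables (K : fieldType) (G : quiver) (L : pzRingType) (B : path_basis K G L).
Local Notation scal := (pb_scal B).
Local Notation pi := (pb_pi B).
Local Notation cf := (pb_cf B).

Lemma generated_span (M : lmodType L) (y : M) : generated y ->
  exists (n : nat) (b : 'I_n -> M),
    forall m : M, exists c : 'I_n -> K, m = \sum_(i < n) scal (c i) *: b i.
Proof.
move=> gy; case E: (pb_paths B) => [|p0 s].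
  exists 0%N, (fun=> 0) => m; exists (fun=> 0); rewrite big_ord0.
  by have [l <-] := gy m; rewrite orbE (act_expand B) E big_nil.
exists (size (pb_paths B)), (fun i => pi (nth p0 (pb_paths B) i) *: y) => m.
have [l <-] := gy m; exists (fun i => cf (nth p0 (pb_paths B) i) l).
by rewrite orbE (act_expand B) (big_nth p0) big_mkord.
Qed.

(** Q is L / L z, where z generates a copy of N in the radical, so N is its syzygy up to retracts. Q
    is not projective: L z is radical, so [cyclic_projective_ann] with idempotent 1 would give z =
    0. *)
Lemma string_quotient (N : lmodType L) : string_class B N ->
  exists (Q : lmodType L) (y : Q), [/\ generated y,
    forall n, pdle n N -> pdle n.+1 Q
  & forall n, pdle n Q -> exists2 m, n = m.+1 & pdle m N].
Proof.
case=> p [q [x [W gx hx [z [rz hz]]]]].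
have hz' : has_type B p q (cyc_gen (z : L^o)).
  by apply/(has_type_inj B p q (cyc_gen (z : L^o)) (@subval_inj _ _ _)).
have [f [_ fi fs]] := type_iso gx (@cyc_generated _ _ (z : L^o)) hx hz'.
have [rN rz'] := retract_iso fi fs.
have [g [gs gE]] := quotmod_proj (img (orb (z : L^o))).
have h1 y : subval (img (orb (z : L^o))) y \in ker g.
  by apply/in_ker/gE; apply: subvalP.
have h2 y : subval (ker g) y \in img (orb (z : L^o)).
  by apply/gE/in_ker; apply: subvalP.
have r1 : retract (submodule (ker g)) (cyc (z : L^o)).
  by exists (lift_sub h2), (lift_sub h1) => y; apply: subval_inj.
have r2 : retract (cyc (z : L^o)) (submodule (ker g)).
  by exists (lift_sub h1), (lift_sub h2) => y; apply: subval_inj.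
have g1 : generated (g (1 : L)).
  move=> y; have [l <-] := gs y; exists l.
  by rewrite orbE -linearZ /= [_ *: _]mulr1.
exists (quotmod (img (orb (z : L^o)))), (g (1 : L)); split=> //.
  move=> n Nn; exists (L^o), g; split=> //; first exact: regular_projective.
  exact: pdle_retract (pdle_retract Nn rz') r1.
case=> [|m] Qm; last first.
  exists m => //; apply: pdle_retract rN; apply: pdle_retract r2.
  exact: pdle_syzygy (@regular_projective L) gs Qm.
have actE (l : L) : l *: g (1 : L) = g (l : L^o) by rewrite -linearZ /= [_ *: _]mulr1.
have nil (u : L) : u * u = u -> u * 1 = u -> u *: g (1 : L) = 0 -> u = 0.
  move=> uu _; rewrite actE => /gE/in_img[l lu]; apply: (@radical_idem _ _ _ B) uu.
  by rewrite -lu; apply: radicalMl.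
have := cyclic_projective_ann (mulr1 1) (scale1r _) g1 Qm nil (mulr1 z).
rewrite actE => z0; have {z0} z0 : z = 0 by apply/z0/gE/in_img; exists 1; rewrite orbE scale1r.
have [np _ _ _] := W.
have : pi (vertex_path (path_src p)) *: (z : L^o) != 0.
  by rewrite (has_type_pi W hz) // /initial prefix0s.
by rewrite z0 scaler0 eqxx.
Qed.

End StringQuotient.

(** * The Jacobson radical in coordinates *)

Section Jacobson.
Variables (K : fieldType) (G : quiver) (L : pzRingType) (B : path_basis K G L).
Local Notation scal := (pb_scal B).
Local Notation cf := (pb_cf B).
Local Notation radical := (radical B).

Let vertex_prop v : submod_prop (fun l : L^o => cf (vertex_path v) l = 0).
Proof.
split=> [|a x y hx hy]; first exact: cf0.
by rewrite cfD cfM_vertex hx hy mulr0 addr0.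
Qed.

Lemma radical_jrad (l : L) : radical l -> jrad B (l : L^o).
Proof.
move=> rl; exists (fun a => left_quotient B a l : L^o); rewrite [LHS](lquo_expand B l).
by rewrite big1 ?add0r // => v _; rewrite rl scal0 mul0r.
Qed.

(** The coefficient at a nonzero vertex has a maximal left ideal as kernel, which gives one
    inclusion. Conversely a maximal U without x satisfies U + L x = L, and for radical x Nakayama's
    lemma yields U = L. *)
Lemma jacobsonP (x : L) : (x \in jacobson L) <-> radical x.
Proof.
split=> [/asboolP Jx v|rx].
  case nv: (nonzero_path B (vertex_path v)); last by apply: pb_cf_out; rewrite -/(nonzero_path B _) nv.
  have c1 : cf (vertex_path v) 1 = 1.
    rewrite -(sum_ev B) cf_sum (bigD1 v) //= cf_pi nv eqxx big1 ?addr0 // => w ne.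
    rewrite cf_pi; case: eqVneq => [e|_]; last by rewrite andbF.
    by case/eqP: ne; have := congr1 (@path_src G) e.
  apply/(in_psub (vertex_prop v)); apply: Jx; split.
    by exists (1 : L); apply/negP => /in_psub /eqP; rewrite c1 oner_eq0.
  move=> W UW; case: (pselect (exists2 y, y \in W & cf (vertex_path v) y != 0)); last first.
    move=> no; left=> y Wy; apply/in_psub/eqP/negPn/negP => ne.
    by case: no; exists y.
  case=> y Wy cy; right=> z.
  pose c := cf (vertex_path v) z / cf (vertex_path v) y.
  have -> : z = scal c *: (y : L^o) + (z - scal c * y) by rewrite addrC subrK.
  apply: rpredD; first exact: rpredZ.
  apply/UW/in_psub; rewrite cfB cf_scal /c -mulrA mulVf // mulr1.
  exact: subrr.
apply/asboolP => U [[y0 nUy0] mU]; apply/negPn/negP => nUx.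
have subU : {subset U <= addsub U (principal x)}.
  by move=> u Uu; apply/asboolP; exists u, 0; rewrite addr0 Uu rpred0.
have px : x \in principal x by apply/asboolP; exists 1; rewrite mul1r.
have [sub|all] := mU _ subU.
  case/negP: nUx; apply: sub; apply/asboolP; exists 0, x.
  by rewrite add0r rpred0 px.
case/negP: nUy0; apply: (nakayama (B := B)) => y.
have /asboolP[u [w [Uu /asboolP[l ->] ->]]] := all y.
exists u, (l * x); split=> //.
exact/radical_jrad/radicalMl.
Qed.

End Jacobson.

(** * The modules St(p^-1 q) *)

Section StringModule.
Variables (K : fieldType) (G : quiver) (L : pzRingType) (B : path_basis K G L).
Local Notation scal := (pb_scal B).
Local Notation pi := (pb_pi B).
Local Notation cf := (pb_cf B).
Local Notation nz := (nonzero_path B).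
Local Notation ev := (vertex_unit B).
Local Notation ar := (arrow_elt B).
Local Notation has_type := (has_type B).
Local Notation words := (words B).
Implicit Types (p q r w : qpath G) (a b h : arrow G) (v : vertex G) (l : L).
Hypothesis out_le2 : forall v, (#|[pred a : arrow G | src a == v]| <= 2)%N.
Hypothesis next_uniq : forall a b b', ar b * ar a != 0 -> ar b' * ar a != 0 -> b = b'.

Lemma subquot_type p q (W : submodClosed L^o) : words p q ->
  (forall l, (l * ev (path_src p) : L^o) \in W <->
     forall r, path_src r = path_src p -> initial r p q -> cf r l = 0) ->
  exists y : subquot (principal (ev (path_src p))) W, generated y /\ has_type p q y.
Proof.
move=> _ hW; set e := ev (path_src p).
have ee : e * e = e := ev_idem B _.
have ein : (e : L^o) \in principal e by apply/asboolP; exists 1; rewrite mul1r.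
have [g [gs gE]] := quotmod_proj (in_submodule (principal e) W).
pose e1 : submodule (principal e) := Submodule ein.
have actE l : l *: g e1 = g (l *: e1) by rewrite linearZ.
exists (g e1); split.
  move=> y; have [x <-] := gs y; have /asboolP[l xl] := submodule_valP x.
  by exists l; rewrite orbE actE; congr (g _); apply: subval_inj.
split; first by rewrite actE; congr (g _); apply: subval_inj; apply: ee.
by move=> l; rewrite actE gE -hW.
Qed.

Lemma cf_mul_ev l v r : path_src r = v -> cf r (l * ev v) = cf r l.
Proof.
move=> <-; case nr: (nz r); last by rewrite !pb_cf_out // -/(nonzero_path B r) nr.
by apply: cf_Mpi nr; rewrite path_mulp1 eqxx.
Qed.

Lemma cf_mul_ev_neq0 l v r : cf r (l * ev v) != 0 -> path_src r = v.
Proof. by case/cf_Mpi_neq0 => p ep _; rewrite (path_mul_src ep). Qed.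

Lemma jacobson_mul_type p q : path_trivial p -> path_trivial q -> forall l,
  (l * ev (path_src p) : L^o) \in jacobson_mul (ev (path_src p)) <->
  forall r, path_src r = path_src p -> initial r p q -> cf r l = 0.
Proof.
move=> tp tq l; set v := path_src p; split=> [/asboolP[x /(jacobsonP B) rx e] r sr|H].
  rewrite /initial (nilP tp) (nilP tq) orbb prefixs0 => /eqP r0.
  have -> : r = vertex_path v by apply: path_ext.
  have sv : path_src (vertex_path v) = v by [].
  by rewrite -(cf_mul_ev l sv) e (cf_mul_ev x sv).
apply/asboolP; exists (l * ev v); last by rewrite -mulrA ev_idem.
apply/(jacobsonP B) => w; case: (eqVneq v w) => [<-|ne].
  by rewrite cf_mul_ev // H // /initial prefix0s.
by rewrite eq_sym in ne; apply: cf_ev_neq ne _; rewrite -mulrA ev_idem.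
Qed.

Definition prolongs p q a : Prop :=
  exists2 ap, path_mul (arrow_path a) p = Some ap & words ap q.

(** The common form of [C_left] and [C_right], with the picked arrow as a parameter, so that one
    argument serves both sides. *)
Definition arm (o : option (arrow G)) p : submodClosed L^o :=
  if o is Some a then principal (ar a * pi p) else principal (0 : L).

Definition arm_choice (o : option (arrow G)) p q : Prop :=
  (forall a, o = Some a -> prolongs p q a) /\ (o = None -> forall a, ~ prolongs p q a).

Lemma arm_type o p q x r : words p q -> arm_choice o p q -> x \in arm o p ->
  path_src r = path_src p -> initial r p q -> cf r x = 0.
Proof.
case=> np nq spq hd [ho _]; case: o ho => [a|] ho /asboolP[l ->] sr ir; last first.
  by rewrite mulr0 cf0.
have [ap eap [nap _ _ hd']] := ho a erefl.
rewrite (piM_some B eap); apply/eqP/contraT => /cf_Mpi_neq0[w /path_mul_prefix par _].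
have sz : (size (path_arrows p) < size (path_arrows ap))%N.
  by rewrite (path_mul_arrows eap) size_cat addn1.
case/orP: ir => pr; have par' := prefix_trans par pr.
  by have := size_prefix par'; rewrite leqNgt sz.
move: hd' par'; case: (path_arrows ap) sz => [//|h s] _.
by case: (path_arrows q) => [//|h' s'] /= /negbTE ->.
Qed.

Lemma arm_long o p q r h : words p q -> arm_choice o p q -> nz r ->
  path_src r = path_src p -> ohead (path_arrows r) = Some h ->
  ohead (path_arrows p) = Some h -> ~~ initial r p q -> (pi r : L^o) \in arm o p.
Proof.
move=> [np nq spq hd] [ho hn] nr sr hr hp nir.
have lt : (size (path_arrows p) < size (path_arrows r))%N.
  rewrite ltnNge; apply: contraNN nir => le.
  by rewrite /initial (nz_chain_total next_uniq nr np hr hp le).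
have pr := nz_chain_total next_uniq np nr hp hr (ltnW lt).
have [w ew] := path_prefixP (esym sr) pr.
have tw : ~~ path_trivial w.
  by move: lt; rewrite (path_mul_arrows ew) size_cat /path_trivial /nilp;
    case: (path_arrows w) => //=; rewrite addn0 ltnn.
have [a [w' ew']] := path_firstP tw.
have [ap eap] : exists ap, path_mul (arrow_path a) p = Some ap.
  by apply: path_mul_defined; rewrite -(path_mul_compat ew) -(path_mul_src ew').
have er := path_mulA_some ew' eap ew.
have [_ nap] := nz_mul er nr.
have pa : prolongs p q a.
  exists ap => //; split=> //; first by rewrite (path_mul_src eap).
  by rewrite (path_mul_arrows eap); case: (path_arrows p) hp hd.
case: o ho hn => [a'|] ho hn; last by case: (hn erefl a).
have [ap' eap' [nap' _ _ _]] := ho a' erefl.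
have aa' : a' = a.
  have tp : ~~ path_trivial p by rewrite /path_trivial; case: (path_arrows p) hp.
  have [c [p' ep']] := path_lastP tp.
  have aux b bp : path_mul (arrow_path b) p = Some bp -> nz bp -> ar b * ar c != 0.
    move=> eb nb; apply: contraTneq nb => z; rewrite -pi_neq0 -(piM_some B eb).
    by rewrite -(piM_some B ep') mulrA -/(ar b) -/(ar c) z mul0r eqxx.
  exact: next_uniq (aux _ _ eap' nap') (aux _ _ eap nap).
subst a'; apply/asboolP; exists (pi w').
by rewrite -(piM_some B er) -(piM_some B eap).
Qed.

(** An arrow prolonging the trivial p must differ from the first arrow k of q. At most two arrows
    leave the vertex, so it is h, the first arrow of r. *)
Lemma arm_short o p q r h k : words p q -> arm_choice o p q -> nz r ->
  path_src r = path_src p -> ohead (path_arrows r) = Some h ->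
  path_trivial p -> ohead (path_arrows q) = Some k -> k != h -> (pi r : L^o) \in arm o p.
Proof.
move=> [np nq spq hd] [ho hn] nr sr hr tp hq kh.
have tr : ~~ path_trivial r by rewrite /path_trivial; case: (path_arrows r) hr.
have [h' [w ew]] := path_firstP tr.
have hh : h' = h.
  by have := path_mul_arrows ew => er; move: hr; rewrite er => -[].
subst h'; have [_ nh] := nz_mul ew nr.
have sh : src h = path_src p by rewrite -sr (path_mul_src ew).
have pE a : src a = path_src p -> path_mul (arrow_path a) p = Some (arrow_path a).
  by move=> sa; rewrite (path_trivialP tp) path_mulp1 /path_src /= sa eqxx.
have ph : prolongs p q h.
  exists (arrow_path h); first exact: pE.
  split=> //; first by rewrite -spq.
  by rewrite /path_arrows /= -/(path_arrows q); case: (path_arrows q) hq => [//|? ?] [->]; rewrite eq_sym.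
case: o ho hn => [a'|] ho hn; last by case: (hn erefl h).
have [ap' eap' [_ _ _ hd']] := ho a' erefl.
have sa' : src a' = path_src p.
  by rewrite -[LHS]/(path_src (arrow_path a')) (path_mul_compat eap') (path_trivialP tp).
have ak : a' != k.
  move: eap' hd'; rewrite pE // => -[<-]; rewrite /path_arrows /= -/(path_arrows q).
  by case: (path_arrows q) hq => [//|? ?] [->].
have sk : src k = path_src p.
  have := path_valP q; rewrite -/(path_src q) -/(path_arrows q).
  by case: (path_arrows q) hq => [//|? ?] [->] /= /andP[/eqP -> _].
have aa' : a' = h.
  apply/eqP; apply: contraT => ne.
  have := out_le2 (path_src p); rewrite leqNgt; case/negP.
  have <- : size [:: a'; h; k] = 3%N by [].
  rewrite cardE; apply: uniq_leq_size; first by rewrite /= !inE negb_or ne ak (eq_sym h) kh.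
  by move=> z; rewrite mem_enum !inE => /or3P[] /eqP ->; rewrite ?sa' ?sh ?sk eqxx.
subst a'; apply/asboolP; exists (pi w).
by rewrite (piM_some B eap') -(piM_some B ew); move: eap'; rewrite pE // => -[<-].
Qed.

(** A nonzero path that is not an initial segment either shares its first arrow with p or q, which
    is [arm_long], or leaves along the other arrow while one of p, q is trivial, which is
    [arm_short]; a third outgoing arrow does not exist. *)
Lemma addsub_type o1 o2 p q : words p q -> ~~ (path_trivial p && path_trivial q) ->
  arm_choice o1 p q -> arm_choice o2 q p -> forall l,
  (l * ev (path_src p) : L^o) \in addsub (arm o1 p) (arm o2 q) <->
  forall r, path_src r = path_src p -> initial r p q -> cf r l = 0.
Proof.
move=> W npq h1 h2 l; have W' := wordsC W; have [np nq spq hd] := W; set v := path_src p.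
split=> [/asboolP[x [y [x1 y2 e]]] r sr ir|H].
  rewrite -(cf_mul_ev l sr) e cfD (arm_type W h1 x1 sr ir).
  by rewrite (arm_type W' h2 y2) ?addr0 // ?sr -?spq // initialC.
rewrite (cf_expand B (l * ev v)); apply: rpred_sum => r _.
case: (eqVneq (cf r (l * ev v)) 0) => [->|cr]; first by rewrite scal0 mul0r rpred0.
have sr := cf_mul_ev_neq0 cr; have nr := cf_nz cr.
have nir : ~~ initial r p q.
  by apply: contraNN cr => ir; rewrite cf_mul_ev // H.
have nir' : ~~ initial r q p by rewrite initialC.
have sr' : path_src r = path_src q by rewrite sr.
have left x : x \in arm o1 p -> scal (cf r (l * ev v)) * x \in addsub (arm o1 p) (arm o2 q).
  move=> hx; apply/asboolP; exists (scal (cf r (l * ev v)) * x), 0; rewrite addr0; split=> //.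
    exact: (@rpredZ _ _ (arm o1 p) _ x hx).
  exact: rpred0.
have right x : x \in arm o2 q -> scal (cf r (l * ev v)) * x \in addsub (arm o1 p) (arm o2 q).
  move=> hx; apply/asboolP; exists 0, (scal (cf r (l * ev v)) * x); rewrite add0r; split=> //.
    exact: rpred0.
  exact: (@rpredZ _ _ (arm o2 q) _ x hx).
case Er: (ohead (path_arrows r)) => [h|]; last first.
  by move: nir; rewrite /initial; case: (path_arrows r) Er => // _; rewrite prefix0s.
case Ep: (ohead (path_arrows p)) => [a|]; case Eq: (ohead (path_arrows q)) => [b|].
- case: (eqVneq a h) => [ah|nah].
    by apply: left; apply: (arm_long W h1 nr sr Er _ nir); rewrite Ep ah.
  case: (eqVneq b h) => [bh|nbh].
    by apply: right; apply: (arm_long W' h2 nr sr' Er _ nir'); rewrite Eq bh.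
  have nab : a != b.
    by move: hd; case: (path_arrows p) Ep => [//|? ?] [->]; case: (path_arrows q) Eq => [//|? ?] [->].
  have so w c : path_src w = v -> ohead (path_arrows w) = Some c -> src c = v.
    move=> <-; have := path_valP w; rewrite -/(path_src w) -/(path_arrows w).
    by case: (path_arrows w) => [//|? ?] /= /andP[/eqP e _] [<-].
  have := out_le2 v; rewrite leqNgt => /negP[].
  have <- : size [:: a; b; h] = 3%N by [].
  rewrite cardE; apply: uniq_leq_size; first by rewrite /= !inE negb_or nab nah nbh.
  move=> z; rewrite mem_enum !inE => /or3P[] /eqP ->; apply/eqP.
  + exact: (so p).
  + exact: (so q).
  + exact: (so r).
- case: (eqVneq a h) => [ah|nah].
    by apply: left; apply: (arm_long W h1 nr sr Er _ nir); rewrite Ep ah.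
  have tq : path_trivial q by rewrite /path_trivial; case: (path_arrows q) Eq.
  by apply: right; apply: (arm_short W' h2 nr sr' Er tq Ep nah).
- case: (eqVneq b h) => [bh|nbh].
    by apply: right; apply: (arm_long W' h2 nr sr' Er _ nir'); rewrite Eq bh.
  have tp : path_trivial p by rewrite /path_trivial; case: (path_arrows p) Ep.
  by apply: left; apply: (arm_short W h1 nr sr Er tp Eq nbh).
case/negP: npq; rewrite /path_trivial; case: (path_arrows p) Ep => //.
by case: (path_arrows q) Eq.
Qed.

End StringModule.

Import Order.TTheory Num.Theory.

(** * Finitistic dimensions *)

Section Extrema.
Variables (d : Order.disp_t) (T : porderType d).
Implicit Types (A : set T) (x : T).

Lemma supremumE x0 A x : (A !=set0)%classic -> supremums A x -> supremum x0 A = x.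
Proof.
move=> /set0P A0 sx; rewrite /supremum (negbTE A0); apply: xget_unique => // y sy.
exact: is_subset1_supremums sy sx.
Qed.

Lemma supremum_max x0 A x : A x -> ubound A x -> supremum x0 A = x.
Proof. by move=> Ax ux; apply: supremumE; [exists x | split=> // y; apply]. Qed.

Lemma infimum_min x0 A x : A x -> lbound A x -> infimum x0 A = x.
Proof.
move=> Ax lx; rewrite /infimum ifF; last by apply/negbTE/set0P; exists x.
apply: xget_unique => [|y [ly gy]]; first by split=> // y; apply.
by apply/le_anti/andP; split; [apply: ly | apply: gy].
Qed.
End Extrema.

Section ProjectiveDimension.
Variable R : pzRingType.
Implicit Types M : lmodType R.
Local Open Scope ereal_scope.

(** Exact finite projective dimension as a natural number; extended integers enter only through
    [pdim_has_pd] and [pdim_fin]. *)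
Definition has_pd M n : Prop := pdle n M /\ forall m, pdle m M -> (n <= m)%N.

Lemma ex_has_pd M n : pdle n M -> exists m, has_pd M m.
Proof.
move=> Mn; have ex : exists n, `[< pdle n M >] by exists n; apply/asboolP.
have [m /asboolP Mm min] := ex_minnP ex.
by exists m; split=> // k Mk; apply: min; apply/asboolP.
Qed.

Lemma pdim_has_pd M n : has_pd M n -> pdim M = (n%:Z)%:E.
Proof.
move=> [Mn min]; apply: infimum_min.
  by exists n => //; apply/has_proj_resolutionP.
by move=> _ [m /has_proj_resolutionP Mm <-]; rewrite lee_fin lez_nat; apply: min.
Qed.

Lemma pdim_fin M : pdim M < +oo <-> exists n, has_pd M n.
Proof.
split=> [fin|[n /pdim_has_pd ->]]; last exact: ltey.
apply: contrapT => no; move: fin; suff -> : pdim M = +oo by rewrite ltxx.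
rewrite /pdim /infimum ifT //; apply/eqP/seteqP; split=> // x [n /has_proj_resolutionP Mn _].
by case: no; apply: ex_has_pd Mn.
Qed.

End ProjectiveDimension.

Lemma supremum_unbounded (A : set (\bar int)) x0 :
  (forall k : nat, exists m : nat, (k <= m)%N /\ A (m%:Z)%:E) -> supremum x0 A = +oo%E.
Proof.
move=> unb; apply: supremumE.
  by have [m [_ Am]] := unb 0%N; exists (m%:Z)%:E.
split=> [x _|y uy]; first exact: leey.
case: y uy => [r||] uy //; last first.
  by have [m [_ /uy]] := unb 0%N.
have [m [lem /uy]] := unb `|r|.+1%N; rewrite lee_fin => le.
have := le_trans le (ler_norm r); rewrite -abszE lez_nat.
by move=> /(leq_trans lem); rewrite ltnn.
Qed.

(** * Comparison with the given string algebra *)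

Section StringAlgebra.
Variables (K : fieldType) (G : quiver) (I : tsideal (pathalg K G)).

Lemma lambda_basis : string_presentation I -> exists B : path_basis K G (Lambda I),
  [/\ forall c, pb_scal B c = scal I c,
      forall p, pb_pi B p = cls I (of_path K p),
      forall p, nonzero_path B p = (of_path K p \notin I),
      forall a b b', arrow_elt B b * arrow_elt B a != 0 -> arrow_elt B b' * arrow_elt B a != 0 -> b = b'
    & forall a b b', arrow_elt B a * arrow_elt B b != 0 -> arrow_elt B a * arrow_elt B b' != 0 -> b = b'].
Proof.
case=> [[N [_ hnil _]] hmono _ hprev hnext].
have E a b : arrow_elt (Lambda_basis hmono hnil) a * arrow_elt (Lambda_basis hmono hnil) b != 0 ->
    of_arrow K a * of_arrow K b \notin I.
  by apply: contraNN => h; apply/eqP; rewrite -[LHS]clsM; apply/cls_eq0.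
exists (Lambda_basis hmono hnil); split.
- by move=> c.
- by move=> p.
- exact: mem_nzpaths.
- by move=> a b b' /E h /E; apply: hnext.
- by move=> a b b' /E h /E; apply: hprev.
Qed.

Section Basis.
Variable B : path_basis K G (Lambda I).
Hypothesis scalE : forall c, pb_scal B c = scal I c.
Hypothesis piE : forall p, pb_pi B p = cls I (of_path K p).
Hypothesis nzE : forall p, nonzero_path B p = (of_path K p \notin I).
Hypothesis out_le2 : forall v, (#|[pred a : arrow G | src a == v]| <= 2)%N.
Hypothesis next_uniq :
  forall a b b', arrow_elt B b * arrow_elt B a != 0 -> arrow_elt B b' * arrow_elt B a != 0 -> b = b'.
Hypothesis prev_uniq :
  forall a b b', arrow_elt B a * arrow_elt B b != 0 -> arrow_elt B a * arrow_elt B b' != 0 -> b = b'.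
Implicit Types (p q : qpath G) (M N : lmodType (Lambda I)).

Lemma wordP p q : word I p q <-> words B p q.
Proof.
rewrite /words !nzE; split=> [/and4P[h1 h2 /eqP h3 h4]|[h1 h2 /eqP h3 h4]].
  apply: And4 h1 h2 h3 _; move: h4.
  by case: (path_arrows p) => [|a s]; case: (path_arrows q).
apply: (introT and4P); apply: And4 h1 h2 h3 _; move: h4.
by case: (path_arrows p) => [|a s]; case: (path_arrows q).
Qed.

Lemma wordC p q : word I p q = word I q p.
Proof.
by apply/idP/idP => /wordP /wordsC /wordP.
Qed.

Lemma extends_leftP p q a : extends_left I p q a <-> prolongs B p q a.
Proof.
rewrite /extends_left /prolongs; case: path_mul => [ap|]; last by split=> // -[].
by rewrite wordP; split=> [h|[_ [<-]]] //; exists ap.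
Qed.

Lemma extends_rightP p q a : extends_right I p q a <-> prolongs B q p a.
Proof.
rewrite -extends_leftP /extends_right /extends_left.
by case: path_mul => // bq; rewrite wordC.
Qed.

Lemma C_leftE p q : exists2 o, arm_choice B o p q & C_left I p q = arm B o p.
Proof.
rewrite /C_left; case: pickP => [a /extends_leftP h|h].
  exists (Some a); first by split=> // _ [<-].
  by rewrite /arm /arrow_elt !piE -clsM.
exists None => //; split=> // _ a /extends_leftP; by rewrite h.
Qed.

Lemma C_rightE p q : exists2 o, arm_choice B o q p & C_right I p q = arm B o q.
Proof.
rewrite /C_right; case: pickP => [a /extends_rightP h|h].
  exists (Some a); first by split=> // _ [<-].
  by rewrite /arm /arrow_elt !piE -clsM.
exists None => //; split=> // _ a /extends_rightP; by rewrite h.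
Qed.

Lemma St_type p q : word I p q -> exists y : St I p q, generated y /\ has_type B p q y.
Proof.
move/wordP => W; rewrite /St -piE -/(vertex_unit B (path_src p)).
case: ifP => [/andP[tp tq]|npq].
  exact: subquot_type W (jacobson_mul_type B tp tq).
have [o1 h1 ->] := C_leftE p q; have [o2 h2 ->] := C_rightE p q.
exact: subquot_type W (addsub_type out_le2 next_uniq W (negbT npq) h1 h2).
Qed.

Lemma generated_fin_dimensional M (y : M) : generated y -> fin_dimensional M.
Proof.
case/(generated_span B) => n [b h]; exists n, b => m.
by have [c ->] := h m; exists c; apply: eq_bigr => i _; rewrite scalE.
Qed.

Lemma string_T_class M : @string_T K G I M -> string_class B M /\ exists n, has_pd M n.
Proof.
case=> p [q [/[dup] hw /wordP W EM [_ /pdim_fin fin] [f fi]]].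
split=> //; rewrite EM in f fi *.
have [y [gy hy]] := St_type hw; exists p, q, y; split=> //.
have /(has_type_inj B p q y fi) hfy := hy.
exists (subval _ (f y)); split; first by apply/(jacobsonP B); apply: subvalP.
by apply/(has_type_inj B p q (f y) (@subval_inj _ _ _)).
Qed.

(** The type fixes the module up to isomorphism, so [St p q] inherits the dimension of N and the
    embedding of L z in J. *)
Lemma class_string_T N n : string_class B N -> has_pd N n ->
  exists2 M : lmodType (Lambda I), @string_T K G I M & has_pd M n.
Proof.
case=> p [q [x [W gx hx [z [rz hz]]]]] [Nn Nmin].
have /wordP hw := W; have [y [gy hy]] := St_type hw.
have [f [_ fi fs]] := type_iso gx gy hx hy.
have [r1 r2] := retract_iso fi fs.
have pd : has_pd (St I p q) n.
  split=> [|m Sm]; first exact: pdle_retract r2.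
  by apply: Nmin; apply: pdle_retract r1.
exists (St I p q) => //; exists p, q; split=> //.
  by split; [exact: generated_fin_dimensional gy | apply/pdim_fin; exists n].
have hz' : has_type B p q (cyc_gen (z : (Lambda I)^o)).
  by apply/(has_type_inj B p q (cyc_gen (z : (Lambda I)^o)) (@subval_inj _ _ _)).
have [g [_ gi _]] := type_iso gy (@cyc_generated _ _ _) hy hz'.
have hJ t : subval _ (g t) \in jacobson (Lambda I).
  have /in_img[l <-] := subvalP (g t); apply/(jacobsonP B); exact: radicalMl.
exists (lift_sub (f := (subval _ \o g)%FUN) hJ) => t t' /(congr1 (subval _)) /= e.
by apply: gi; apply: subval_inj.
Qed.

End Basis.

End StringAlgebra.

Section FinitisticDimension.
Variables (K : fieldType) (G : quiver) (I : tsideal (pathalg K G)).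
Hypothesis hI : string_presentation I.

Let attained n : Prop := exists2 M : lmodType (Lambda I), @string_T K G I M & has_pd M n.

Let bound k : (forall n, attained n -> (n <= k)%N) ->
  forall M : lmodType (Lambda I), forall n, has_pd M n -> (n <= k.+1)%N.
Proof.
move=> hk M n [Mn min]; have [B [sE pE nE nu pu]] := lambda_basis hI.
have [_ _ deg _ _] := hI.
have out v : (#|[pred a : arrow G | src a == v]| <= 2)%N by case: (deg v).
apply: min; apply: (pdle_bound out nu pu _ Mn) => N cN m Nm.
have [j [Nj jmin]] := ex_has_pd Nm.
apply: pdle_leq (Nj); apply: hk.
by have [M' TM' pM'] := class_string_T sE pE nE out nu cN (conj Nj jmin); exists M'.
Qed.

Let bound0 : (forall n, ~ attained n) ->
  forall M : lmodType (Lambda I), forall n, has_pd M n -> n = 0%N.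
Proof.
move=> hk M n [Mn min]; have [B [sE pE nE nu pu]] := lambda_basis hI.
have [_ _ deg _ _] := hI.
have out v : (#|[pred a : arrow G | src a == v]| <= 2)%N by case: (deg v).
apply/eqP; rewrite -leqn0; apply: min.
apply: (projective_of_no_string out nu pu _ Mn) => N cN m Nm.
have [j [Nj jmin]] := ex_has_pd Nm.
have [M' TM' pM'] := class_string_T sE pE nE out nu cN (conj Nj jmin).
by apply: (hk j); exists M'.
Qed.

(** The witness is cyclic, hence finite dimensional; this is why the little dimension already
    reaches t + 1. *)
Let attained_little n : attained n ->
  exists2 M : lmodType (Lambda I), @Pfin_little K G I M & has_pd M n.+1.
Proof.
case=> M TM [Mn min]; have [B [sE pE nE nu pu]] := lambda_basis hI.
have [_ _ deg _ _] := hI.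
have out v : (#|[pred a : arrow G | src a == v]| <= 2)%N by case: (deg v).
have [cM _] := string_T_class pE nE out nu TM.
have [Q [y [gy Qle Qge]]] := string_quotient cM.
have pQ : has_pd Q n.+1.
  by split=> [|m /Qge[j -> /min]] //; apply: Qle.
exists Q => //; split; first exact: (@generated_fin_dimensional _ _ _ _ sE Q y gy).
by apply/pdim_fin; exists n.+1.
Qed.

Let zero_little : exists2 M : lmodType (Lambda I), @Pfin_little K G I M & has_pd M 0.
Proof.
pose M : lmodType (Lambda I) := submodule (ker (idfun : {linear (Lambda I)^o -> (Lambda I)^o})).
have M0 (x : M) : x = 0.
  by apply: subval_inj; have /in_ker e := subvalP x; apply: etrans e (esym (linear0 _)).
have pM : has_pd M 0 by split=> //; apply: projective0.
exists M => //; split; last by apply/pdim_fin; exists 0%N.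
by exists 0%N, (fun=> 0) => m; exists (fun=> 0); rewrite [m]M0 big_ord0.
Qed.

Let pdims_big x : pdims (@Pfin_big K G I) x <-> exists M : lmodType (Lambda I),
  exists2 n, has_pd M n & x = (n%:Z)%:E.
Proof.
split=> [[M /pdim_fin[n pM] ->]|[M [n pM ->]]].
  by exists M, n => //; apply: pdim_has_pd.
by exists M; [apply/pdim_fin; exists n | rewrite (pdim_has_pd pM)].
Qed.

Let pdims_little_big : (pdims (@Pfin_little K G I) `<=` pdims (@Pfin_big K G I))%classic.
Proof. by move=> x [M [_ fM] ->]; exists M. Qed.

Let pdims_little M n : @Pfin_little K G I M -> has_pd M n ->
  pdims (@Pfin_little K G I) (n%:Z)%:E.
Proof. by move=> fM pM; exists M; rewrite ?(pdim_has_pd pM). Qed.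

Let pdims_T x : pdims (@string_T K G I) x <-> exists2 n, attained n & x = (n%:Z)%:E.
Proof.
split=> [[M TM ->]|[n [M TM pM] ->]]; last by exists M; rewrite ?(pdim_has_pd pM).
have [p [q [_ _ [_ /pdim_fin [n pM]] _]]] := TM.
by exists n; [exists M | apply: pdim_has_pd].
Qed.

Lemma string_findim : little_findim I = big_findim I /\
  big_findim I = (string_t I + 1%:E)%E.
Proof.
have maxE n : (exists2 M : lmodType (Lambda I), @Pfin_little K G I M & has_pd M n) ->
    (forall (M : lmodType (Lambda I)) m, has_pd M m -> (m <= n)%N) ->
    little_findim I = (n%:Z)%:E /\ big_findim I = (n%:Z)%:E.
  move=> [M fM pM] ub; have An := pdims_little fM pM.
  have ubE : ubound (pdims (@Pfin_big K G I)) (n%:Z)%:E.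
    by move=> _ /pdims_big[M' [m pm ->]]; rewrite lee_fin lez_nat; apply: ub pm.
  split; apply: supremum_max => //; last exact: pdims_little_big.
  by move=> x /pdims_little_big; apply: ubE.
case: (pselect (exists n, attained n)) => [ex|no]; last first.
  have [|-> ->] := maxE 0%N zero_little.
    by move=> M m pm; rewrite (bound0 _ pm) // => n an; apply: no; exists n.
  (* The supremum of the empty set takes its default -1, matching the value 0 of both dimensions. *)
  split=> //; rewrite /string_t; have -> : pdims (@string_T K G I) = set0.
    by apply/seteqP; split=> // x /pdims_T[n an _]; case: no; exists n.
  by rewrite supremum0.
case: (pselect (exists b, forall n, attained n -> (n <= b)%N)) => [[b bP]|unb].
  have exb : exists n, `[< attained n >] by case: ex => n an; exists n; apply/asboolP.
  have [|k /asboolP ak kmax] := @ex_maxnP (fun n => `[< attained n >]) b exb.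
    by move=> n /asboolP; apply: bP.
  have kmax' n : attained n -> (n <= k)%N by move=> an; apply/kmax/asboolP.
  have [|-> ->] := maxE k.+1 (attained_little ak); first exact: bound kmax'.
  split=> //; have -> : string_t I = (k%:Z)%:E; last by rewrite -EFinD -PoszD addn1.
  apply: supremum_max; first by apply/pdims_T; exists k.
  by move=> _ /pdims_T[n an ->]; rewrite lee_fin lez_nat; apply: kmax'.
have unb' k : exists2 n, attained n & (k <= n)%N.
  apply: contrapT => no; case: unb; exists k => n an.
  by case: (leqP n k) => // /ltnW le; case: no; exists n.
have -> : string_t I = +oo%E.
  by apply: supremum_unbounded => k; have [n an le] := unb' k; exists n; split=> //; apply/pdims_T; exists n.
have lit k : exists m : nat, (k <= m)%N /\ pdims (@Pfin_little K G I) (m%:Z)%:E.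
  have [n an le] := unb' k; have [M fM pM] := attained_little an.
  by exists n.+1; split; [exact: leqW | exact: pdims_little fM pM].
have -> : little_findim I = +oo%E by apply: supremum_unbounded.
have -> : big_findim I = +oo%E.
  apply: supremum_unbounded => k; have [m [le Am]] := lit k.
  by exists m; split=> //; apply: pdims_little_big.
by [].
Qed.

End FinitisticDimension.

Theorem theorem3 (K : closedFieldType) (G : quiver)
    (I : tsideal (pathalg K G)) (hI : string_presentation I) :
  little_findim I = big_findim I /\
  big_findim I = (string_t I + 1%:E)%E.
Proof. exact: string_findim hI. Qed.
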